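(* Let $1\le k<n$ and let $A$ be a $k\times n$ matrix with integer entries and rank $k$. Then the system $Ax=0$ admits $n-k$ linearly independent solutions $z^{(r)}=(z^{(r)}_1,\ldots,z^{(r)}_n)\in\mathbb{Z}^n$, $1\le r\le n-k$, such that for every $p\ge2$, $$\prod_{r=1}^{n-k}\max_{1\le i\le n}|z^{(r)}_i|\ \le\ D^{-1}\sqrt{\frac p2}\Big(\frac1{n-k}\sum_{i=1}^n c_i^p\Big)^{1/p}\sqrt{\det(AA^* )}.$$
   Context: $A^*$ is the transpose of $A$. Let $v_1,\ldots,v_k\in\mathbb{R}^n$ be the rows of $A$ and $e_1,\ldots,e_n$ the standard basis of $\mathbb{R}^n$. For $1\le i\le n$, $c_i$ is the Euclidean distance from $e_i$ to the linear span of $v_1,\ldots,v_k$; equivalently $c_i^2=\det(A_iA_i^* )/\det(AA^* )$ where $A_i$ is the $(k+1)\times n$ matrix with rows $v_1,\ldots,v_k,e_i$. $D$ denotes the greatest common divisor of all $k\times k$ minors of $A$. *)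

(* Defs.v *)
From HB Require Import structures.
From mathcomp Require Import all_boot all_order all_algebra.
From mathcomp Require Import reals exp Rstruct.
From Stdlib Require Import Rdefinitions.
Set Implicit Arguments. Unset Strict Implicit. Unset Printing Implicit Defensive.
Import Order.TTheory GRing.Theory Num.Theory.
Local Open Scope ring_scope.

Definition Rr := Rdefinitions.R.

Definition mxR {m n : nat} (A : 'M[int]_(m, n)) : 'M[Rr]_(m, n) :=
  map_mx (fun z : int => (z%:~R : Rr)) A.

(* D = gcd of all k x k minors of A (over all column selections; minors with
   repeated columns are 0 and reorderings only change signs, so this is the
   gcd of the usual minors). *)
Definition minor_gcd {k n : nat} (A : 'M[int]_(k, n)) : nat :=
  \big[gcdn/0%N]_(f : {ffun 'I_k -> 'I_n}) absz (\det (colsub f A)).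

Definition Aext {k n : nat} (A : 'M[Rr]_(k, n)) (i : 'I_n) : 'M[Rr]_(k + 1, n) :=
  col_mx A (delta_mx 0 i).

(* c_i = distance from e_i to the row span, c_i^2 = det(A_i A_i^* )/det(A A^* ). *)
Definition cdist {k n : nat} (A : 'M[int]_(k, n)) (i : 'I_n) : Rr :=
  Num.sqrt (\det (Aext (mxR A) i *m (Aext (mxR A) i)^T) / \det (mxR A *m (mxR A)^T)).

(* Main.v *)
(** A lattice basis P of the integer kernel is chosen adapted to a set Z of
   independent kernel vectors with least total sup norm, so that the sup norms of Z
   behave as the successive minima lam_1 <= ... <= lam_m, m = n - k. Counting the
   lattice points of a dilated cube section modulo a large integer gives Minkowski's
   second theorem in the form  prod lam_j * vol <= 1,  where vol is the volume of
   {y : |<b_i, y>| <= 1/2 for all i} and b_i are the columns of P.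

   The volume is bounded below as follows. By Prekopa's theorem the indicator of each
   slab |<b_i, y>| <= 1/2 may be replaced by exp(- pi t^2) or by exp(- 16 t^4) at
   t = <b_i, y>, which only decreases the integral. Jensen's inequality against the
   Gaussian exp(- pi c |yP|^2) and its second and fourth moments then give
     vol >= det(PP^T)^(-1/2) c^(-m/2) exp((m - sum_i min(x_i, 24/pi^2 x_i^2)) / 2),
   with x_i = c_i^2 / c, for every c > 0. The choice of c turns this into the l^p
   bound; what is needed of the constant is 24/pi^2 <= e. Finally
   det(AA^T) = d^2 det(PP^T) for an integer d that is a combination of the maximal
   minors of A, hence a multiple of D. *)
Require Import Defs.
From HB Require Import structures.
From mathcomp Require Import all_boot all_order all_algebra fingroup perm.
From mathcomp Require Import Rstruct all_classical all_reals all_analysis.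
From mathcomp Require Import measurable_realfun zify ring lra.
Set Implicit Arguments. Unset Strict Implicit. Unset Printing Implicit Defensive.
Import Order.TTheory GRing.Theory Num.Theory.
Import numFieldNormedType.Exports.
Local Open Scope classical_set_scope.
Local Open Scope ring_scope.

(** * Log-concavity and the one-dimensional Prekopa-Leindler inequality *)

(** The vectors [Z] are fixed before [p]; the exponent enters only through the scale [c] and the
    choice, index by index, between the two weights. Both weights are needed: the Gaussian costs x_i
    always add up to m/c, so alone they cannot detect a small p-th moment. The quartic cost is kappa
    x^2 with kappa = 24/pi^2, and the smaller of x and kappa x^2 is at most kappa^(q-1) x^q for 1 <=
    q <= 2, where q = p/2. Trading a slab for a weight is a rearrangement statement: the weight has
    height at most 1 and mass at most 1, like the slab, but lies farther out, where parallel slabs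
    carry less mass. Integrals over R^m are iterated integrals in a fixed order, and log-concavity
    does the measure theory: it makes every inner integral a measurable function of the remaining
    variable. Linear changes of variables are avoided: Gaussian integrals come from completing
    squares, and the effect of a dilation is read off from the determinant in the lower bound
    instead of from the volume. *)

Section OneDim.
Context {R : realType}.
Notation mu := (@lebesgue_measure R).

Lemma interval_measure_le (A : set R) (d : R) : is_interval A -> 0 <= d ->
  (forall x y, A x -> A y -> x <= y -> y - x <= d) -> (mu A <= d%:E)%E.
Proof.
move=> iA d0 Ad.
have [->|/set0P[a Aa]] := eqVneq A set0; first by rewrite measure0 lee_fin.
have ubA : has_ubound A.
  exists (a + d) => y Ay; have [ay|/ltW ya] := leP a y.
    by have := Ad _ _ Aa Ay ay; lra.
  lra.
have lbA : has_lbound A.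
  exists (a - d) => y Ay; have [ay|/ltW ya] := leP a y.
    lra.
  by have := Ad _ _ Ay Aa ya; lra.
have sA : has_sup A by split => //; exists a.
have iA' : has_inf A by split => //; exists a.
have sub : A `<=` `[inf A, sup A]%classic.
  by move=> x Ax /=; rewrite in_itv/= ge_inf// ub_le_sup.
apply: (@le_trans _ _ (mu `[inf A, sup A]%classic)).
  by apply: le_measure => //; rewrite inE; [exact: is_interval_measurable|].
rewrite lebesgue_measure_itv/= lte_fin; case: ifP => _; last by rewrite lee_fin.
rewrite lee_fin; apply/ler_addgt0Pr => e e0.
have [x Ax xs] := sup_adherent (divr_gt0 e0 (ltr0n R 2)) sA.
have [y Ay ys] := inf_adherent (divr_gt0 e0 (ltr0n R 2)) iA'.
have : x - y <= d by have [yx|/ltW xy] := leP y x; [exact: Ad|lra].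
move: xs ys; rewrite /= !ltrBlDr; lra.
Qed.

Lemma interval_measure_ge (A : set R) x y : is_interval A ->
  A x -> A y -> ((y - x)%:E <= mu A)%E.
Proof.
move=> iA Ax Ay; have [xy|yx] := ltP x y; last first.
  by apply: (@le_trans _ _ 0%E) => //; rewrite lee_fin subr_le0.
apply: (@le_trans _ _ (mu `[x, y]%classic)).
  by rewrite lebesgue_measure_itv/= lte_fin xy.
apply: le_measure; rewrite ?inE//; first exact: is_interval_measurable.
by move=> z /=; rewrite in_itv/= => xzy; exact: (iA _ _ Ax Ay).
Qed.

(** The measure of an interval is the supremum of the differences of its points, so only single
    points have to be compared: [C] contains the combinations of [x, z] and of [y, t], whose
    difference is [l * (y - x) + (1 - l) * (t - z)]. Finiteness of [mu A] and [mu B] is deduced from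
    that of [mu C]. *)
Lemma brunn_minkowski_interval (A B C : set R) (l : R) :
  is_interval A -> is_interval B -> is_interval C -> A !=set0 -> B !=set0 ->
  0 < l < 1 ->
  (forall a b, A a -> B b -> C (l * a + (1 - l) * b)) ->
  (l%:E * mu A + (1 - l)%:E * mu B <= mu C)%E.
Proof.
move=> iA iB iC [a0 Aa0] [b0 Bb0] /andP[l0 l1] ABC.
have [->|Cfin] := eqVneq (mu C) +oo%E; first by rewrite leey.
have fC : mu C \is a fin_num by rewrite ge0_fin_numE// ltey.
have l1' : 0 < 1 - l by rewrite subr_gt0.
have main x y z t : A x -> A y -> B z -> B t ->
    l * (y - x) + (1 - l) * (t - z) <= fine (mu C).
  move=> Ax Ay Bz Bt; rewrite -lee_fin fineK//.
  have := interval_measure_ge iC (ABC _ _ Ax Bz) (ABC _ _ Ay Bt).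
  by congr (_ <= _)%E; congr EFin; ring.
have C0 : 0 <= fine (mu C) by exact: fine_ge0.
have muB z t : B z -> B t -> z <= t ->
    (l%:E * mu A <= (fine (mu C) - (1 - l) * (t - z))%:E)%E.
  move=> Bz Bt zt; have := main _ _ _ _ Aa0 Aa0 Bz Bt.
  rewrite subrr mulr0 add0r => h.
  have -> : fine (mu C) - (1 - l) * (t - z) =
      l * ((fine (mu C) - (1 - l) * (t - z)) / l) by rewrite [RHS]mulrC divfK ?gt_eqF.
  rewrite EFinM lee_pmul2l ?lte_fin//.
  apply: interval_measure_le => //; first by rewrite divr_ge0 ?subr_ge0// ltW.
  move=> x y Ax Ay _; rewrite ler_pdivlMr// mulrC lerBrDr; exact: main.
have fA : (l%:E * mu A)%E \is a fin_num.
  have := muB _ _ Bb0 Bb0 (lexx _) => h.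
  rewrite ge0_fin_numE; first exact: le_lt_trans h (ltry _).
  by rewrite mule_ge0// lee_fin ltW.
rewrite -(fineK fA) -(fineK fC) -leeBrDl// -EFinB.
have -> : fine (mu C) - fine (l%:E * mu A)%E =
    (1 - l) * ((fine (mu C) - fine (l%:E * mu A)%E) / (1 - l)).
  by rewrite [RHS]mulrC divfK ?gt_eqF.
rewrite EFinM lee_pmul2l ?lte_fin//.
have H z t : B z -> B t -> z <= t ->
    fine (l%:E * mu A)%E <= fine (mu C) - (1 - l) * (t - z).
  by move=> *; rewrite -lee_fin fineK//; exact: muB.
apply: interval_measure_le => //.
  by have := H _ _ Bb0 Bb0 (lexx _); rewrite subrr mulr0 subr0 => ?; rewrite divr_ge0 ?subr_ge0// ltW.
by move=> x y Bx By xy; have := H _ _ Bx By xy; rewrite ler_pdivlMr//; lra.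
Qed.

Section LayerCake.
Variable f : R -> R.
Hypotheses (f0 : forall x, 0 <= f x) (mf : measurable_fun setT f).

Let A : set (measurableTypeR R * measurableTypeR R) :=
  [set p | (0 <= p.2) && (p.2 < f p.1)].

Let mA : measurable A.
Proof.
have -> : A = [set p | 0 <= p.2] `&` [set p | p.2 < f p.1].
  by apply/seteqP; split => p; [move/andP|move=> ?; exact/andP].
apply: measurableI.
  have := @measurable_snd _ _ (measurableTypeR R) (measurableTypeR R).
  move=> /(_ measurableT `[0, +oo[%classic) h; rewrite setTI in h.
  have -> : [set p : measurableTypeR R * measurableTypeR R | 0 <= p.2] =
      snd @^-1` `[0, +oo[%classic.
    by apply/seteqP; split => p /=; rewrite in_itv/= andbT.
  by apply: h; exact: measurable_itv.
have -> : [set p : measurableTypeR R * measurableTypeR R | p.2 < f p.1] =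
    (fun p => f p.1 - p.2) @^-1` `]0, +oo[%classic.
  by apply/seteqP; split => p /=; rewrite in_itv/= andbT subr_gt0.
rewrite -[X in measurable X]setTI.
have mfun : measurable_fun setT
    (fun p : measurableTypeR R * measurableTypeR R => f p.1 - p.2).
  by apply: measurable_funB => //; exact: measurableT_comp.
by apply: mfun => //; exact: measurable_itv.
Qed.

Let sectionE (u : R) : u \in `[0, +oo[%classic ->
  mu (ysection A u) = mu [set x | (u < f x)%R].
Proof.
move=> u0; congr (mu _); apply/seteqP; split => x; rewrite /ysection/= inE /A/=.
  by case/andP.
by move: u0; rewrite inE/= in_itv/= andbT => ->.
Qed.

Lemma measurable_superlevel :
  measurable_fun (`[0%R, +oo[%classic : set (measurableTypeR R))
    (fun u : R => mu [set x | (u < f x)%R]).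
Proof.
apply: (eq_measurable_fun (mu \o ysection A)).
  by move=> u u0 /=; exact: sectionE.
by apply: measurable_funTS; exact: measurable_fun_ysection.
Qed.

(** Fubini for the region [0 <= u < f x]. For log-concave [f] the superlevel sets are intervals,
    which turns statements on integrals into statements on lengths. *)
Lemma layer_cake :
  (\int[mu]_x (f x)%:E = \int[mu]_(u in `[0%R, +oo[) mu [set x | (u < f x)%R])%E.
Proof.
have := @indic_fubini_tonelli _ _ (measurableTypeR R) (measurableTypeR R) R mu mu A mA.
rewrite indic_fubini_tonelli_FE// indic_fubini_tonelli_GE//.
have -> : (\int[mu]_x ((mu \o xsection A) x) = \int[mu]_x (f x)%:E)%E.
  apply: eq_integral => x _ /=.
  have -> : xsection A x = `[0, f x[%classic.
    by apply/seteqP; split => u; rewrite /xsection/= inE in_itv.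
  rewrite lebesgue_measure_itv/= lte_fin; case: ltgtP (f0 x) => // [fx _|<- _]; last by [].
  by rewrite sube0.
move=> ->; rewrite [RHS]integral_mkcond; apply: eq_integral => u _ /=.
rewrite patchE; case: ifPn => u0; first exact: sectionE.
have -> : ysection A u = set0.
  apply/seteqP; split => x //; rewrite /ysection/= inE /A/= => /andP[u0' _].
  by move: u0; rewrite notin_setE/= in_itv/= andbT.
exact: measure0.
Qed.

End LayerCake.

End OneDim.

Section LogConcave.
Context {R : realType}.

(** This is F(x)^l F(y)^(1-l) <= F(l x + (1-l) y). Where [F] vanishes the inequality is trivial, and
    the positivity conditions keep the convention [ln 0 = 0] from turning it into a false demand. *)
Definition logconcave (V : lmodType R) (F : V -> R) :=
  (forall x, 0 <= F x) /\
  forall x y l, 0 < l < 1 -> 0 < F x -> 0 < F y ->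
    expR (l * ln (F x) + (1 - l) * ln (F y)) <= F (l *: x + (1 - l) *: y).

Lemma logconcave_mul (V : lmodType R) (F G : V -> R) :
  logconcave F -> logconcave G -> logconcave (fun x => F x * G x).
Proof.
move=> [F0 hF] [G0 hG]; split=> [x|x y l l01]; first exact: mulr_ge0.
move=> FGx FGy.
have pos a b : 0 <= a -> 0 <= b -> 0 < a * b -> 0 < a /\ 0 < b :> R.
  move=> a0 b0; rewrite lt0r mulf_eq0 negb_or => /andP[/andP[a1 b1] _].
  by rewrite !lt0r a1 b1.
have [Fx Gx] := pos _ _ (F0 _) (G0 _) FGx.
have [Fy Gy] := pos _ _ (F0 _) (G0 _) FGy.
rewrite !lnM//.
have -> : l * (ln (F x) + ln (G x)) + (1 - l) * (ln (F y) + ln (G y)) =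
  (l * ln (F x) + (1 - l) * ln (F y)) + (l * ln (G x) + (1 - l) * ln (G y)) by ring.
rewrite expRD; apply: ler_pM; [exact: expR_ge0|exact: expR_ge0|exact: hF|exact: hG].
Qed.

Lemma logconcave_cst (V : lmodType R) (c : R) : 0 <= c -> logconcave (fun _ : V => c).
Proof.
move=> c0; split=> // x y l l01 cp _.
by rewrite -mulrDl addrC subrK mul1r lnK.
Qed.

Lemma logconcave_prod (V : lmodType R) I (r : seq I) (P : pred I) (F : I -> V -> R) :
  (forall i, P i -> logconcave (F i)) -> logconcave (fun x => \prod_(i <- r | P i) F i x).
Proof.
move=> hF; elim: r => [|a r IH].
  have -> : (fun x => \prod_(i <- [::] | P i) F i x) = fun=> 1.
    by apply/funext => x; rewrite big_nil.
  exact: logconcave_cst.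
have [Pa|Pa] := boolP (P a).
  have -> : (fun x => \prod_(i <- a :: r | P i) F i x) =
      fun x => F a x * \prod_(i <- r | P i) F i x.
    by apply/funext => x; rewrite big_cons Pa.
  by apply: logconcave_mul => //; exact: hF.
have -> // : (fun x => \prod_(i <- a :: r | P i) F i x) =
    fun x => \prod_(i <- r | P i) F i x.
by apply/funext => x; rewrite big_cons (negbTE Pa).
Qed.

Lemma logconcave_affine (V W : lmodType R) (F : W -> R) (f : V -> W) :
  logconcave F ->
  (forall x y l, f (l *: x + (1 - l) *: y) = l *: f x + (1 - l) *: f y) ->
  logconcave (F \o f).
Proof.
by move=> [F0 hF] hf; split=> [x|x y l l01 Fx Fy] /=; rewrite ?hf//; exact: hF.
Qed.

Lemma logconcave_min (V : lmodType R) (F : V -> R) x y l : logconcave F ->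
  0 <= l <= 1 -> Num.min (F x) (F y) <= F (l *: x + (1 - l) *: y).
Proof.
move=> [F0 hF] /andP[l0 l1].
have [->|ln0] := eqVneq l 0; first by rewrite scale0r add0r subr0 scale1r ge_min lexx orbT.
have [->|ln1] := eqVneq l 1; first by rewrite scale1r subrr scale0r addr0 ge_min lexx.
have l01 : 0 < l < 1 by rewrite !lt_neqAle l0 l1 ln1 eq_sym ln0.
have [Fx|Fx] := ltP 0 (F x); last first.
  by rewrite (le_trans _ (F0 _))// ge_min Fx.
have [Fy|Fy] := ltP 0 (F y); last first.
  by rewrite (le_trans _ (F0 _))// ge_min Fy orbT.
apply: le_trans (hF x y l l01 Fx Fy).
have m0 : 0 < Num.min (F x) (F y) by rewrite lt_min Fx.
rewrite -[leLHS]lnK// ler_expR.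
have -> : ln (Num.min (F x) (F y)) =
  l * ln (Num.min (F x) (F y)) + (1 - l) * ln (Num.min (F x) (F y)) by ring.
by rewrite lerD// ler_wpM2l ?subr_ge0 ?ler_ln ?posrE// ge_min lexx ?orbT.
Qed.

Lemma logconcave_superlevel (F : R^o -> R) (c : R) : logconcave F ->
  is_interval [set x | c < F x].
Proof.
move=> hF x y cx cy z /andP[xz zy] /=.
have [xy|yx] := ltP x y; last by have -> : z = x by apply/eqP; rewrite eq_le xz (le_trans zy yx).
have d0 : 0 < y - x by rewrite subr_gt0.
pose l := (y - z) / (y - x).
have l01 : 0 <= l <= 1.
  apply/andP; split; first by apply: divr_ge0; rewrite subr_ge0// ltW.
  by rewrite /l ler_pdivrMr// mul1r lerB.
have -> : z = l *: (x : R^o) + (1 - l) *: (y : R^o).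
  rewrite /GRing.scale/= /l; field; lra.
apply: lt_le_trans (logconcave_min x y hF l01).
by rewrite lt_min; apply/andP.
Qed.

(** Superlevel sets are intervals. No continuity is involved, so boxes and unit cubes are
    covered. *)
Lemma logconcave_measurable (F : R^o -> R) : logconcave F ->
  measurable_fun [set: measurableTypeR R] (F : measurableTypeR R -> measurableTypeR R).
Proof.
move=> hF mD; apply: (measurability _ (RGenOInfty.measurableE R)) => //.
move=> /= _ [_ [x ->] <-]; apply: measurableI => //.
apply: is_interval_measurable.
have -> : F @^-1` `]x, +oo[%classic = [set y | x < F y].
  by apply/seteqP; split => y; rewrite /= in_itv/= andbT.
exact: logconcave_superlevel.
Qed.

Notation mu := (@lebesgue_measure R).

Lemma interval_measure_opp_le (A : set R) : is_interval A ->
  (mu A <= mu [set x | A (- x)%R])%E.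
Proof.
move=> iA.
have iN : is_interval [set x | A (- x)%R].
  move=> x y /= Ax Ay z /andP[xz zy]; apply: (iA _ _ Ay Ax).
  by rewrite !lerN2 xz zy.
have [->|Nfin] := eqVneq (mu [set x | A (- x)%R]) +oo%E; first by rewrite leey.
have fN : mu [set x | A (- x)%R] \is a fin_num by rewrite ge0_fin_numE// ltey.
rewrite -(fineK fN); apply: interval_measure_le => //; first exact: fine_ge0.
move=> x y Ax Ay _; rewrite -lee_fin fineK//.
have -> : y - x = - x - - y by rewrite opprK addrC.
by apply: interval_measure_ge => //=; rewrite opprK.
Qed.

(** Reflection invariance, layer by layer: superlevel sets are intervals, and reflection preserves
    the differences of their points. *)
Lemma integral_opp_logconcave (F : R^o -> R) : logconcave F ->
  (\int[mu]_x (F (- x))%:E = \int[mu]_x (F x)%:E)%E.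
Proof.
move=> hF.
have hN : logconcave (fun x : R^o => F (- x)).
  by apply: (logconcave_affine hF) => x y l; rewrite opprD !scalerN.
rewrite (layer_cake hN.1 (logconcave_measurable hN)).
rewrite (layer_cake hF.1 (logconcave_measurable hF)).
apply: eq_integral => u _; apply/eqP; rewrite eq_le; apply/andP; split.
  have := @interval_measure_opp_le _ (logconcave_superlevel (c := u) hN).
  move=> /le_trans; apply; rewrite le_eqVlt; apply/orP; left; apply/eqP.
  by congr (mu _); apply/seteqP; split => x /=; rewrite opprK.
exact: (@interval_measure_opp_le _ (logconcave_superlevel (c := u) hF)).
Qed.

(** Weighted AM-GM: average the tangent line inequality of [expR] taken at the convex combination
    [c]. *)
Lemma amgm_expR (l a b : R) : 0 <= l <= 1 ->
  expR (l * a + (1 - l) * b) <= l * expR a + (1 - l) * expR b.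
Proof.
move=> /andP[l0 l1]; set c := l * a + (1 - l) * b.
have hc t : expR c * (1 + (t - c)) <= expR t.
  have -> : expR t = expR c * expR (t - c) by rewrite -expRD addrC subrK.
  by rewrite ler_wpM2l ?expR_ge0//; exact: expR_ge1Dx.
have h1 : l * (expR c * (1 + (a - c))) <= l * expR a by rewrite ler_wpM2l.
have h2 : (1 - l) * (expR c * (1 + (b - c))) <= (1 - l) * expR b.
  by rewrite ler_wpM2l// subr_ge0.
apply: le_trans (lerD h1 h2); rewrite le_eqVlt; apply/orP; left; apply/eqP.
rewrite /c; ring.
Qed.

(** After division of [f], [g] by their suprema [a], [b] and of [h] by a^l b^(1-l), one-dimensional
    Brunn-Minkowski applies at each level and integrates to an additive inequality. AM-GM makes it
    multiplicative, and the normalising constants cancel. The bound [M] is there to give finite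
    suprema. *)
Lemma prekopa_leindler1 (f g h : R^o -> R) (l M : R) :
  logconcave f -> logconcave g -> logconcave h ->
  (forall x, f x <= M) -> (forall x, g x <= M) ->
  mu.-integrable setT (EFin \o f) -> mu.-integrable setT (EFin \o g) ->
  mu.-integrable setT (EFin \o h) ->
  0 < l < 1 ->
  (forall x y, 0 < f x -> 0 < g y ->
     expR (l * ln (f x) + (1 - l) * ln (g y)) <= h (l *: x + (1 - l) *: y)) ->
  0 < \int[mu]_x f x -> 0 < \int[mu]_x g x ->
  expR (l * ln (\int[mu]_x f x) + (1 - l) * ln (\int[mu]_x g x)) <= \int[mu]_x h x.
Proof.
move=> hf hg hh fM gM If Ig Ih l01 H If0 Ig0.
have [l0 l1] := andP l01; have l1' : 0 < 1 - l by rewrite subr_gt0.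
have possup (k : R -> R) : (forall x, 0 <= k x) -> (forall x, k x <= M) ->
    0 < \int[mu]_x k x ->
    exists2 s : R, 0 < s & (forall x, k x <= s) /\ (forall u : R, u < s -> exists x, u < k x).
  move=> k0 kM Ik.
  have ub : has_sup (range k).
    by split; [exists (k 0); exists 0|exists M => _ [x _ <-]].
  exists (sup (range k)); last split.
  - rewrite ltNge; apply/negP => s0.
    have : \int[mu]_x k x = 0; last by move=> k0'; rewrite k0' ltxx in Ik.
    rewrite /Rintegral (_ : (fun x => (k x)%:E) = cst 0%E) ?integral0//.
    apply/funext => x; congr EFin; apply/eqP; rewrite eq_le k0 andbT.
    by apply: le_trans s0; apply: ub_le_sup; [exact: ub.2|exists x].
  - by move=> x; apply: ub_le_sup; [exact: ub.2|exists x].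
  - move=> u us; have [_ [x _ <-]] := sup_adherent (eps := sup (range k) - u) ltac:(by rewrite subr_gt0) ub.
    by rewrite opprB addrC subrK; exists x.
have [a a0 [fa fs]] := possup f hf.1 fM If0.
have [b b0 [gb gs]] := possup g hg.1 gM Ig0.
pose c := expR (l * ln a + (1 - l) * ln b).
have c0 : 0 < c by exact: expR_gt0.
have scale (k : R^o -> R) (s : R) : logconcave k -> 0 < s -> logconcave (fun x => s^-1 * k x).
  move=> hk s0; apply: logconcave_mul => //.
  by apply: logconcave_cst; rewrite invr_ge0 ltW.
have LC k (s : R) (hk : logconcave k) (s0 : 0 < s) :
    (\int[mu]_x (s^-1 * k x)%:E = \int[mu]_(u in `[0%R, +oo[) mu [set x | (u < s^-1 * k x)%R])%E.
  by apply: layer_cake; [exact: (scale _ _ hk s0).1|exact: (logconcave_measurable (scale _ _ hk s0))].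
have mlev k (s : R) (hk : logconcave k) (s0 : 0 < s) :
    measurable_fun (`[0%R, +oo[%classic : set (measurableTypeR R)) (fun u : R => mu [set x | (u < s^-1 * k x)%R]).
  exact: (measurable_superlevel (logconcave_measurable (scale _ _ hk s0))).
have key : (l%:E * (\int[mu]_x (a^-1 * f x)%:E) + (1 - l)%:E * (\int[mu]_x (b^-1 * g x)%:E)
    <= \int[mu]_x (c^-1 * h x)%:E)%E.
  rewrite !LC// -!ge0_integralZl//; try exact: mlev; try by rewrite lee_fin ltW.
  rewrite -ge0_integralD//; last first.
  - by apply: measurable_funeM; exact: mlev.
  - by move=> u _; rewrite mule_ge0// lee_fin ltW.
  - by apply: measurable_funeM; exact: mlev.
  - by move=> u _; rewrite mule_ge0// lee_fin ltW.
  apply: ge0_le_integral => //.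
  - by move=> u _; rewrite adde_ge0// mule_ge0// lee_fin ltW.
  - by apply: emeasurable_funD; apply: measurable_funeM; exact: mlev.
  - exact: mlev.
  move=> u; rewrite /= in_itv/= andbT => u0.
  (* The normalisation by suprema matters here: from level 1 on both sets on the left are empty,
     below it both are nonempty, as Brunn-Minkowski requires. *)
  have [u1|u1] := ltP u 1; last first.
    have emp (k : R -> R) (s : R) : 0 < s -> (forall x, k x <= s) -> [set x | (u < s^-1 * k x)%R] = set0.
      move=> s0 ks; apply/seteqP; split => x //=; apply/negP; rewrite -leNgt.
      by rewrite (le_trans _ u1)// mulrC ler_pdivrMr// mul1r.
    by rewrite (emp f a)// (emp g b)// measure0 !mule0 adde0.
  apply: brunn_minkowski_interval => //; try exact: (logconcave_superlevel (scale _ _ _ _)).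
  - have [x ux] := fs (u * a) ltac:(by rewrite gtr_pMl).
    by exists x; rewrite /= mulrC ltr_pdivlMr.
  - have [x ux] := gs (u * b) ltac:(by rewrite gtr_pMl).
    by exists x; rewrite /= mulrC ltr_pdivlMr.
  - move=> x y /=; rewrite ![_^-1 * _]mulrC !ltr_pdivlMr// => ux uy.
    have fx0 : 0 < f x by rewrite (le_lt_trans _ ux)// mulr_ge0// ltW.
    have gy0 : 0 < g y by rewrite (le_lt_trans _ uy)// mulr_ge0// ltW.
    apply: lt_le_trans (H x y fx0 gy0).
    have [->|un0] := eqVneq u 0; first by rewrite mul0r expR_gt0.
    have up : 0 < u by rewrite lt0r un0.
    rewrite -{1}(lnK up) -expRD ltr_expR.
    have -> : ln u + (l * ln a + (1 - l) * ln b) =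
      l * (ln u + ln a) + (1 - l) * (ln u + ln b) by ring.
    rewrite -!lnM// ltrD// ltr_pM2l// ltr_ln// posrE mulr_gt0//.
have RZ k (s : R) (hk : logconcave k) (Ik : mu.-integrable setT (EFin \o k)) (s0 : 0 < s) :
    (\int[mu]_x (s^-1 * k x)%:E = (s^-1 * \int[mu]_x k x)%:E)%E.
  under eq_integral do rewrite EFinM.
  rewrite integralZl// EFinM; congr (_ * _)%E.
  by rewrite /Rintegral fineK//; exact: integrable_fin_num.
move: key; rewrite !RZ// -!EFinM -EFinD lee_fin => key.
set A := \int[mu]_x f x in If0 key *; set B := \int[mu]_x g x in Ig0 key *.
have h1 : expR (l * ln (a^-1 * A) + (1 - l) * ln (b^-1 * B)) <= c^-1 * \int[mu]_x h x.
  apply: le_trans key; apply: le_trans (amgm_expR _ _ _) _; first by rewrite !ltW.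
  by rewrite !lnK// posrE mulr_gt0// invr_gt0.
have : c * expR (l * ln (a^-1 * A) + (1 - l) * ln (b^-1 * B)) <= \int[mu]_x h x.
  by move: h1; rewrite -(ler_pM2l c0) mulrA mulfV ?gt_eqF// mul1r.
apply: le_trans; rewrite -expRD ler_expR le_eqVlt; apply/orP; left; apply/eqP.
by rewrite !lnM ?posrE ?invr_gt0// !lnV ?posrE//; ring.
Qed.

End LogConcave.

(** * Iterated integrals *)

Section Gauss1.
Context {R : realType}.
Notation mu := (@lebesgue_measure R).

Lemma gauss_integral1 (a c : R) : 0 < a ->
  mu.-integrable setT (EFin \o (fun t : R => expR (- a * (t - c) ^+ 2))) /\
  \int[mu]_t expR (- a * (t - c) ^+ 2) = Num.sqrt (pi / a).
Proof.
move=> a0.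
(* The integrand is proportional to the normal density of variance 1/(2a). *)
pose s := (Num.sqrt (a *+ 2))^-1.
have a2 : 0 < a *+ 2 by rewrite mulrn_wgt0.
have s0 : s != 0 by rewrite invr_eq0 gt_eqF// sqrtr_gt0.
have s2 : s ^+ 2 = (a *+ 2)^-1 by rewrite /s exprVn sqr_sqrtr// ltW.
have e2 : (a *+ 2)^-1 *+ 2 = a^-1.
  by rewrite -mulr_natl -[a *+ 2]mulr_natl invfM mulrA mulfV ?mul1r// pnatr_eq0.
have E t : expR (- a * (t - c) ^+ 2) = (normal_peak s)^-1 * normal_pdf c s t.
  rewrite normal_pdfE// /normal_peak/= mulrA mulVf ?mul1r; last first.
    by rewrite invr_eq0 gt_eqF// sqrtr_gt0 mulrn_wgt0// mulr_gt0 ?pi_gt0// exprn_even_gt0.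
  by rewrite /normal_fun s2 e2 invrK mulrC mulrN mulNr.
have i1 := @integrable_normal_pdf R c s.
split.
  rewrite (_ : EFin \o _ = fun t => ((normal_peak s)^-1%:E * (normal_pdf c s t)%:E)%E).
    by apply: integrableZl.
  by apply/funext => t; rewrite /= E EFinM.
under eq_Rintegral do rewrite E.
rewrite RintegralZl// /Rintegral integral_normal_pdf mulr1 /normal_peak invrK.
by rewrite s2 -mulrnAl e2 mulrC.
Qed.

End Gauss1.

Section Iterated.
Context {R : realType}.
Notation mu := (@lebesgue_measure R).

Definition consr m (t : R) (y : 'rV[R]_m) : 'rV[R]_m.+1 := row_mx (t%:M : 'M[R]_1) y.

(** Stands for the integral over R^m, with the first coordinate outermost. The order is never
    interchanged; what is used is monotonicity, linearity, reflection and Prekopa's theorem. *)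
Fixpoint itint m : ('rV[R]_m -> R) -> R :=
  match m with
  | 0 => fun F => F 0
  | m'.+1 => fun F => \int[mu]_t itint (fun y => F (consr t y))
  end.

Fixpoint itmeas m : ('rV[R]_m -> R) -> Prop :=
  match m with
  | 0 => fun F => True
  | m'.+1 => fun F => (forall t, itmeas (fun y => F (consr t y))) /\
      measurable_fun [set: measurableTypeR R]
        ((fun t => itint (fun y => F (consr t y))) : measurableTypeR R -> measurableTypeR R)
  end.

Definition sqn m (y : 'rV[R]_m) := \sum_i y 0 i ^+ 2.

Lemma consr_0 m t (y : 'rV[R]_m) : consr t y 0 ord0 = t.
Proof.
have E : (t%:M : 'M[R]_1) 0 0 = t by rewrite mxE eqxx mulr1n.
by rewrite -[RHS]E -(row_mxEl (t%:M : 'M[R]_1) y 0 0); congr (_ _ _); apply: val_inj.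
Qed.

Lemma consr_lift m t (y : 'rV[R]_m) i : consr t y 0 (lift ord0 i) = y 0 i.
Proof.
by rewrite -(row_mxEr (t%:M : 'M[R]_1) y 0 i); congr (_ _ _); apply: val_inj.
Qed.

Lemma sqn_consr m t (y : 'rV[R]_m) : sqn (consr t y) = t ^+ 2 + sqn y.
Proof.
rewrite /sqn big_ord_recl consr_0; congr (_ + _).
by apply: eq_bigr => i _; rewrite consr_lift.
Qed.

Lemma rowvPe m (x y : 'rV[R]_m.+1) :
  x 0 ord0 = y 0 ord0 -> (forall i, x 0 (lift ord0 i) = y 0 (lift ord0 i)) -> x = y.
Proof.
by move=> h0 h; apply/rowP => i; case: (unliftP ord0 i) => [j ->|->].
Qed.

Lemma lincombE m a b (x y : 'rV[R]_m) i : (a *: x + b *: y) 0 i = a * x 0 i + b * y 0 i.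
Proof. by rewrite !mxE. Qed.

Lemma consr_lincomb m a b s t (x y : 'rV[R]_m) :
  consr (a * s + b * t) (a *: x + b *: y) = a *: consr s x + b *: consr t y.
Proof.
by apply: rowvPe => [|i]; rewrite lincombE ?consr_0 ?consr_lift// lincombE.
Qed.

Lemma consrN m t (y : 'rV[R]_m) : - consr t y = consr (- t) (- y).
Proof.
have := consr_lincomb (-1) 0 t 0 y 0.
by rewrite !scale0r !addr0 !scaleN1r mulr0 addr0 mulN1r.
Qed.

Definition dominated m (C e : R) (F : 'rV[R]_m -> R) :=
  forall y, F y <= C * expR (- e * sqn y).

(** The real-valued integral is 0 when the true one is infinite, so linearity and monotonicity need
    integrability at every stage. Domination by a Gaussian passes to slices and provides it. *)
Definition good m (F : 'rV[R]_m -> R) :=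
  [/\ forall y, 0 <= F y, exists C e, [/\ 0 <= C, 0 < e & dominated C e F] & itmeas F].

Let K (e : R) := Num.sqrt (pi / e).

Lemma dominated_slice m C e (F : 'rV[R]_m.+1 -> R) t : dominated C e F ->
  dominated (C * expR (- e * t ^+ 2)) e (fun y => F (consr t y)).
Proof.
move=> dF y; apply: le_trans (dF _) _.
by rewrite sqn_consr mulrDr expRD mulrA.
Qed.

(** The bound for a slice is again a Gaussian in the sliced coordinate, hence an integrable majorant
    for the next integration, which contributes one more factor [K e]. *)
Lemma itint_bound m C e (F : 'rV[R]_m -> R) : 0 <= C -> 0 < e ->
  (forall y, 0 <= F y) -> dominated C e F -> itmeas F ->
  0 <= itint F <= C * K e ^+ m.
Proof.
elim: m F C => [|m IH] F C C0 e0 F0 dF mF.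
  rewrite /= F0/= expr0 mulr1; apply: le_trans (dF _) _.
  by rewrite /sqn big_ord0 mulr0 expR0 mulr1.
have [mFt mI] := mF.
have bnd (t : R) : 0 <= itint (fun y => F (consr t y)) <= C * expR (- e * t ^+ 2) * K e ^+ m.
  apply: IH => [||y||]//; [|exact: dominated_slice|exact: mFt].
  by rewrite mulr_ge0 ?expR_ge0.
have [ig Ig] := gauss_integral1 0 e0.
have E : (fun t : R => C * K e ^+ m * expR (- e * (t - 0) ^+ 2)) =
    (fun t => C * expR (- e * t ^+ 2) * K e ^+ m).
  by apply/funext => u; rewrite subr0 mulrAC.
have ig' : mu.-integrable setT (EFin \o (fun t => C * expR (- e * t ^+ 2) * K e ^+ m)).
  rewrite -E; have -> : EFin \o (fun t : R => C * K e ^+ m * expR (- e * (t - 0) ^+ 2)) =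
    fun t => ((C * K e ^+ m)%:E * (expR (- e * (t - 0) ^+ 2))%:E)%E by [].
  exact: integrableZl.
have iF : mu.-integrable setT (EFin \o (fun t => itint (fun y => F (consr t y)))).
  apply: le_integrable ig' => //; first exact/measurable_EFinP.
  move=> u _ /=; have /andP[b0 b1] := bnd u.
  by rewrite lee_fin ger0_norm// (le_trans b1)// ler_norm.
apply/andP; split; first by apply: Rintegral_ge0 => t _; have /andP[] := bnd t.
apply: (@le_trans _ _ (\int[mu]_t (C * expR (- e * t ^+ 2) * K e ^+ m))).
  by apply: le_Rintegral => // t _; have /andP[] := bnd t.
by rewrite -E RintegralZl// Ig exprSr mulrA lexx.
Qed.

Lemma good_slice m (F : 'rV[R]_m.+1 -> R) t : good F -> good (fun y => F (consr t y)).
Proof.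
move=> [F0 [C [e [C0 e0 dF]]] [mF _]]; split; [by move=> y| |exact: mF].
exists (C * expR (- e * t ^+ 2)), e; split => //; first by rewrite mulr_ge0 ?expR_ge0.
exact: dominated_slice.
Qed.

Lemma itint_ge0 m (F : 'rV[R]_m -> R) : good F -> 0 <= itint F.
Proof.
by move=> [F0 [C [e [C0 e0 dF]]] mF]; have /andP[] := itint_bound C0 e0 F0 dF mF.
Qed.

Lemma good_integrable m (F : 'rV[R]_m.+1 -> R) : good F ->
  mu.-integrable setT (EFin \o (fun t => itint (fun y => F (consr t y)))) /\
  exists M, forall t, itint (fun y => F (consr t y)) <= M.
Proof.
move=> gF; have [F0 [C [e [C0 e0 dF]]] [mFt mI]] := gF.
have bnd (t : R) : 0 <= itint (fun y => F (consr t y)) <= C * expR (- e * t ^+ 2) * K e ^+ m.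
  apply: itint_bound => [||y||]//; [|exact: dominated_slice|exact: mFt].
  by rewrite mulr_ge0 ?expR_ge0.
have [ig Ig] := gauss_integral1 0 e0.
split.
  have ig' : mu.-integrable setT (EFin \o (fun t => C * K e ^+ m * expR (- e * (t - 0) ^+ 2))).
    have -> : EFin \o (fun t : R => C * K e ^+ m * expR (- e * (t - 0) ^+ 2)) =
      fun t => ((C * K e ^+ m)%:E * (expR (- e * (t - 0) ^+ 2))%:E)%E by [].
    exact: integrableZl.
  apply: le_integrable ig' => //; first exact/measurable_EFinP.
  move=> t _ /=; have /andP[b0 b1] := bnd t.
  by rewrite lee_fin ger0_norm// (le_trans b1)// subr0 mulrAC ler_norm.
exists (C * K e ^+ m) => t; have /andP[_ /le_trans] := bnd t; apply.
rewrite -mulrA mulrCA mulrC -[leRHS]mulr1 ler_wpM2l ?mulr_ge0 ?exprn_ge0 ?sqrtr_ge0//.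
by rewrite -expR0 ler_expR mulNr oppr_le0 mulr_ge0 ?sqr_ge0// ltW.
Qed.

Lemma itint_mono m (F G : 'rV[R]_m -> R) : good F -> good G ->
  (forall y, F y <= G y) -> itint F <= itint G.
Proof.
elim: m F G => [|m IH] F G gF gG FG; first exact: FG.
rewrite /=; apply: le_Rintegral => //.
- by have [] := good_integrable gF.
- by have [] := good_integrable gG.
- by move=> t _; apply: IH => //; exact: good_slice.
Qed.

Lemma itmeas_itintD m (F G : 'rV[R]_m -> R) : good F -> good G ->
  itmeas (fun y => F y + G y) /\ itint (fun y => F y + G y) = itint F + itint G.
Proof.
elim: m F G => [|m IH] F G gF gG; first by [].
have h t := IH _ _ (good_slice t gF) (good_slice t gG).
have E : (fun t => itint (fun y => F (consr t y) + G (consr t y))) =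
    (fun t => itint (fun y => F (consr t y)) + itint (fun y => G (consr t y))).
  by apply/funext => t; have [_ ->] := h t.
split=> /=; last first.
  rewrite E RintegralD//; [by have [] := good_integrable gF|by have [] := good_integrable gG].
split=> [t|]; first by have [] := h t.
rewrite E; apply: measurable_funD.
  by case: gF => _ _ [].
by case: gG => _ _ [].
Qed.

Lemma good_add m (F G : 'rV[R]_m -> R) : good F -> good G -> good (fun y => F y + G y).
Proof.
move=> gF gG; have [mFG _] := itmeas_itintD gF gG.
have [F0 [C [e [C0 e0 dF]]] _] := gF; have [G0 [D [f [D0 f0 dG]]] _] := gG.
split => //; first by move=> y; rewrite addr_ge0.
exists (C + D), (Num.min e f); split; [exact: addr_ge0|by rewrite lt_min e0|].
move=> y; rewrite mulrDl lerD//; [apply: le_trans (dF y) _|apply: le_trans (dG y) _];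
  rewrite ler_wpM2l// ler_expR !mulNr lerN2 ler_wpM2r ?ge_min ?lexx ?orbT//;
  by apply: sumr_ge0 => i _; exact: sqr_ge0.
Qed.

Lemma itintD m (F G : 'rV[R]_m -> R) : good F -> good G ->
  itint (fun y => F y + G y) = itint F + itint G.
Proof. by move=> gF gG; have [] := itmeas_itintD gF gG. Qed.

Lemma itmeas_itintZ m (F : 'rV[R]_m -> R) c : good F ->
  itmeas (fun y => c * F y) /\ itint (fun y => c * F y) = c * itint F.
Proof.
elim: m F => [|m IH] F gF; first by [].
have h t := IH _ (good_slice t gF).
have E : (fun t => itint (fun y => c * F (consr t y))) =
    (fun t => c * itint (fun y => F (consr t y))).
  by apply/funext => t; have [_ ->] := h t.
split=> /=; last first.
  by rewrite E RintegralZl//; have [] := good_integrable gF.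
split=> [t|]; first by have [] := h t.
by rewrite E; apply: measurable_funM => //; case: gF => _ _ [].
Qed.

Lemma good_scale m (F : 'rV[R]_m -> R) c : 0 <= c -> good F -> good (fun y => c * F y).
Proof.
move=> c0 gF; have [mF _] := itmeas_itintZ c gF.
have [F0 [C [e [C0 e0 dF]]] _] := gF.
split => //; first by move=> y; rewrite mulr_ge0.
exists (c * C), e; split=> // [|y]; first exact: mulr_ge0.
by rewrite -mulrA ler_wpM2l.
Qed.

Lemma itintZ m (F : 'rV[R]_m -> R) c : good F -> itint (fun y => c * F y) = c * itint F.
Proof. by move=> gF; have [] := itmeas_itintZ c gF. Qed.

(* Log-concave and dominated by a Gaussian: by Prekopa-Leindler the class is
   stable under integration over the first coordinate. This supplies the
   measurability that [good] asks for at every stage of the iterated integral. *)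
Definition lcd m (F : 'rV[R]_m -> R) :=
  logconcave F /\ exists C e, [/\ 0 <= C, 0 < e & dominated C e F].

Lemma lcd_slice m (F : 'rV[R]_m.+1 -> R) t : lcd F -> lcd (fun y => F (consr t y)).
Proof.
move=> [hF [C [e [C0 e0 dF]]]]; split.
  apply: (logconcave_affine hF) => x y l.
  by rewrite -consr_lincomb; congr consr; ring.
exists (C * expR (- e * t ^+ 2)), e; split => //; first by rewrite mulr_ge0 ?expR_ge0.
exact: dominated_slice.
Qed.

(** The two claims need a common induction: in dimension m + 1, measurability of the outer integrand
    follows from its log-concavity, which is Prekopa's theorem in dimension m, while the
    one-dimensional inequality for the outer integrands needs the integrability contained in
    [good]. *)
Lemma lcd_prekopa m :
  (forall F : 'rV[R]_m -> R, lcd F -> good F) /\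
  forall (f g h : 'rV[R]_m -> R) l, lcd f -> lcd g -> lcd h -> 0 < l < 1 ->
  (forall x y, 0 < f x -> 0 < g y ->
     expR (l * ln (f x) + (1 - l) * ln (g y)) <= h (l *: x + (1 - l) *: y)) ->
  0 < itint f -> 0 < itint g ->
  expR (l * ln (itint f) + (1 - l) * ln (itint g)) <= itint h.
Proof.
elim: m => [|m [IHg IH]].
  split=> [F [hF dF]|f g h l hf hg hh l01 H f0 g0].
    by split => //; exact: hF.1.
  by apply: le_trans (H _ _ f0 g0) _; rewrite !scaler0 addr0.
have marg (F : 'rV[R]_m.+1 -> R) : lcd F ->
    logconcave (fun t : R^o => itint (fun y => F (consr t y))).
  move=> hF; split=> [t|s t l l01 s0 t0].
    by apply: itint_ge0; apply: IHg; exact: lcd_slice.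
  apply: IH => //; try exact: lcd_slice.
  by move=> x y Fx Fy; rewrite consr_lincomb; exact: hF.1.2.
have G (F : 'rV[R]_m.+1 -> R) : lcd F -> good F.
  move=> hF; split; [exact: hF.1.1|exact: hF.2|split].
    by move=> t; have [] := IHg _ (lcd_slice t hF).
  exact: logconcave_measurable (marg _ hF).
split=> // f g h l hf hg hh l01 H f0 g0.
have [fi [M fM]] := good_integrable (G _ hf).
have [gi [N gN]] := good_integrable (G _ hg).
have [hi _] := good_integrable (G _ hh).
apply: (@prekopa_leindler1 _ _ _ _ l (Num.max M N)) => //; try exact: marg.
- by move=> t; rewrite le_max fM.
- by move=> t; rewrite le_max gN orbT.
move=> s t s0 t0; apply: IH => //; try exact: lcd_slice.
by move=> x y fx gy; rewrite consr_lincomb; exact: H.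
Qed.

Lemma lcd_good m (F : 'rV[R]_m -> R) : lcd F -> good F.
Proof. exact: (lcd_prekopa m).1. Qed.

(** Prekopa's theorem on marginals. Its main use has the offset of a slab as the parameter [u]. *)
Lemma itint_logconcave (V : lmodType R) m (F : V -> 'rV[R]_m -> R) :
  logconcave (fun p : V * 'rV[R]_m => F p.1 p.2) -> (forall u, lcd (F u)) ->
  logconcave (fun u => itint (F u)).
Proof.
move=> hF dF; split=> [u|u v l l01 u0 v0]; first exact/itint_ge0/lcd_good.
apply: (lcd_prekopa m).2 => // x y Fx Fy.
exact: (hF.2 (u, x) (v, y)).
Qed.

Lemma itint_opp m (F : 'rV[R]_m -> R) : lcd F -> itint (fun y => F (- y)) = itint F.
Proof.
elim: m F => [|m IH] F hF /=; first by rewrite oppr0.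
have hN t : (fun y => F (- consr t y)) = (fun y => F (consr (- t) (- y))).
  by apply/funext => y; rewrite consrN.
transitivity (\int[mu]_t (itint (fun y => F (consr (- t) y)))).
  by apply: eq_Rintegral => t _; rewrite hN (IH _ (lcd_slice (- t) hF)).
rewrite /Rintegral.
rewrite (@integral_opp_logconcave _ (fun t => itint (fun y => F (consr t y))))//.
apply: (@itint_logconcave R^o m (fun t y => F (consr t y))).
  apply: (logconcave_affine hF.1) => -[s x] [t y] l /=.
  by rewrite -consr_lincomb.
by move=> t; exact: lcd_slice.
Qed.

End Iterated.

(** * Comparison of slabs with log-concave weights *)

Section Box.
Context {R : realType}.

(* The value 1/2 at both ends makes adjacent boxes add up to a box everywhere,
   not only almost everywhere. *)
Definition box (w t : R) : R := (Num.sg (t + w / 2) - Num.sg (t - w / 2)) / 2.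

Variant box_spec (w t : R) : R -> Type :=
| BoxIn of `|t| < w / 2 : box_spec w t 1
| BoxEdge of `|t| = w / 2 : box_spec w t (1 / 2)
| BoxOut of w / 2 < `|t| : box_spec w t 0.

Lemma boxP w t : 0 < w -> box_spec w t (box w t).
Proof.
move=> w0; have half0 : 0 < w / 2 by rewrite divr_gt0.
rewrite /box; have [h|h|h] := ltrgtP `|t| (w / 2).
- move: (h); rewrite ltr_norml => /andP[h1 h2].
  have p1 : 0 < t + w / 2 by lra.
  have p2 : t - w / 2 < 0 by lra.
  rewrite (gtr0_sg p1) (ltr0_sg p2) opprK divff ?pnatr_eq0//.
  exact: BoxIn.
- have [t0|t0] := lerP 0 t.
  + have t1 : w / 2 < t by rewrite ger0_norm in h.
    have p1 : 0 < t + w / 2 by lra.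
    have p2 : 0 < t - w / 2 by lra.
    by rewrite (gtr0_sg p1) (gtr0_sg p2) subrr mul0r; exact: BoxOut.
  + have t1 : w / 2 < - t by rewrite ltr0_norm in h.
    have p1 : t + w / 2 < 0 by lra.
    have p2 : t - w / 2 < 0 by lra.
    by rewrite (ltr0_sg p1) (ltr0_sg p2) subrr mul0r; exact: BoxOut.
- have [t0|t0] := lerP 0 t.
  + have t1 : t = w / 2 by rewrite ger0_norm in h.
    have p1 : 0 < t + w / 2 by lra.
    have p2 : t - w / 2 = 0 by lra.
    by rewrite (gtr0_sg p1) p2 sgr0 subr0; exact: BoxEdge.
  + have t1 : - t = w / 2 by rewrite ltr0_norm in h.
    have p1 : t + w / 2 = 0 by lra.
    have p2 : t - w / 2 < 0 by lra.
    by rewrite (ltr0_sg p2) p1 sgr0 sub0r opprK; exact: BoxEdge.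
Qed.

Lemma box_ge0 w t : 0 < w -> 0 <= box w t.
Proof. by move=> w0; case: boxP => // _; lra. Qed.

Lemma box_le1 w t : 0 < w -> box w t <= 1.
Proof. by move=> w0; case: boxP => // _; lra. Qed.

Lemma box_in w t : `|t| < w / 2 -> box w t = 1.
Proof.
move=> h; have w0 : 0 < w by have := le_lt_trans (normr_ge0 t) h; rewrite pmulr_lgt0 ?invr_gt0.
case: boxP (h) => // [->|h']; first by rewrite ltxx.
by move/(lt_trans h'); rewrite ltxx.
Qed.

Lemma box_out w t : 0 < w -> w / 2 < `|t| -> box w t = 0.
Proof.
move=> w0; case: boxP => // [h' /(lt_trans h')|->]; by rewrite ltxx.
Qed.

Lemma boxN w t : box w (- t) = box w t.
Proof.
rewrite /box; have -> : - t + w / 2 = - (t - w / 2) by ring.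
have -> : - t - w / 2 = - (t + w / 2) by ring.
by rewrite !sgrN opprK addrC.
Qed.

(** The value 1/2 at the edges does no harm: a proper convex combination of two points of the closed
    interval lies on an edge only if both points are that edge, and elsewhere the combination has
    value 1. *)
Lemma box_logconcave w : 0 < w -> logconcave (box w : R^o -> R).
Proof.
move=> w0; split=> [t|x y l l01 x0 y0]; first exact: box_ge0.
have /andP[l0 l1] := l01.
have nx : `|x| <= w / 2 by move: x0; case: boxP => //; [move/ltW|move=> ->|rewrite ltxx].
have ny : `|y| <= w / 2 by move: y0; case: boxP => //; [move/ltW|move=> ->|rewrite ltxx].
have le1 : expR (l * ln (box w x) + (1 - l) * ln (box w y)) <= 1.
  rewrite -[leRHS]expR0 ler_expR; have lx := ln_le0 (box_le1 x w0).
  have ly := ln_le0 (box_le1 y w0).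
  have p1 : l * ln (box w x) <= 0 by apply: mulr_ge0_le0 => //; exact: ltW.
  have p2 : (1 - l) * ln (box w y) <= 0.
    by apply: mulr_ge0_le0 => //; rewrite subr_ge0 ltW.
  by rewrite -[leRHS]addr0; exact: lerD.
rewrite /GRing.scale/=; move: nx ny; rewrite !ler_norml => /andP[x1 x2] /andP[y1 y2].
have z1 : l * x + (1 - l) * y <= w / 2 by nra.
have z2 : - (w / 2) <= l * x + (1 - l) * y by nra.
have E : `|l * x + (1 - l) * y| = w / 2 -> x = y.
  move=> h; have : l * x + (1 - l) * y = w / 2 \/ l * x + (1 - l) * y = - (w / 2).
    by case: (lerP 0 (l * x + (1 - l) * y)) h => z0; [rewrite ger0_norm//; left|rewrite ltr0_norm// => ?; right; lra].
  have l1' : 0 < 1 - l by rewrite subr_gt0.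
  case=> e.
    have x3 : w / 2 <= x.
      rewrite leNgt; apply/negP => xw.
      have h1 : 0 < l * (w / 2 - x) by rewrite mulr_gt0// subr_gt0.
      have h2 : 0 <= (1 - l) * (w / 2 - y) by rewrite mulr_ge0 ?subr_ge0// ltW.
      lra.
    have y3 : w / 2 <= y.
      rewrite leNgt; apply/negP => xw.
      have h1 : 0 <= l * (w / 2 - x) by rewrite mulr_ge0 ?subr_ge0// ltW.
      have h2 : 0 < (1 - l) * (w / 2 - y) by rewrite mulr_gt0 ?subr_gt0.
      lra.
    lra.
  have x3 : x <= - (w / 2).
    rewrite leNgt; apply/negP => xw.
    have h1 : 0 < l * (x - - (w / 2)) by rewrite mulr_gt0// subr_gt0.
    have h2 : 0 <= (1 - l) * (y - - (w / 2)) by rewrite mulr_ge0 ?subr_ge0// ltW.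
    lra.
  have y3 : y <= - (w / 2).
    rewrite leNgt; apply/negP => xw.
    have h1 : 0 <= l * (x - - (w / 2)) by rewrite mulr_ge0 ?subr_ge0// ltW.
    have h2 : 0 < (1 - l) * (y - - (w / 2)) by rewrite mulr_gt0 ?subr_gt0.
    lra.
  lra.
have h0 : `|l * x + (1 - l) * y| <= w / 2 by rewrite ler_norml z1 z2.
case: (ltrgtP `|l * x + (1 - l) * y| (w / 2)) h0 => // h _.
  by rewrite (box_in h).
have xy := E h; subst y; have -> : l * x + (1 - l) * x = x by ring.
by rewrite -mulrDl addrC subrK mul1r lnK.
Qed.

Lemma box_partition w t N : 
  box w t + \sum_(j < N) (box w (t - j.+1%:R * w) + box w (t + j.+1%:R * w)) =
  box ((2 * N + 1)%:R * w) t.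
Proof.
elim: N => [|N IH]; first by rewrite big_ord0 addr0 mul1r.
rewrite big_ord_recr/= addrA IH /box.
have -> : (2 * N.+1 + 1)%:R = 2 * N%:R + 3 :> R by rewrite mulnS natrD natrD natrM; ring.
have -> : (2 * N + 1)%:R = 2 * N%:R + 1 :> R by rewrite natrD natrM.
have -> : N.+1%:R = N%:R + 1 :> R by rewrite -addn1 natrD.
set n := N%:R.
have -> : t - (n + 1) * w + w / 2 = t - (2 * n + 1) * w / 2 by field.
have -> : t + (n + 1) * w - w / 2 = t + (2 * n + 1) * w / 2 by field.
have -> : t - (n + 1) * w - w / 2 = t - (2 * n + 3) * w / 2 by field.
have -> : t + (n + 1) * w + w / 2 = t + (2 * n + 3) * w / 2 by field.
by ring.
Qed.

End Box.

(** * Exchange of one slab for a weight *)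

Section Swap.
Context {R : realType}.

Definition dot m (x y : 'rV[R]_m) := \sum_i x 0 i * y 0 i.

Lemma dot_lincomb m (b x y : 'rV[R]_m) s t :
  dot b (s *: x + t *: y) = s * dot b x + t * dot b y.
Proof.
rewrite /dot !mulr_sumr -big_split; apply: eq_bigr => i _ /=.
by rewrite lincombE; ring.
Qed.

Lemma dotN m (b x : 'rV[R]_m) : dot b (- x) = - dot b x.
Proof. by rewrite /dot -sumrN; apply: eq_bigr => i _; rewrite mxE mulrN. Qed.

Lemma lcd0 m : lcd (fun _ : 'rV[R]_m => 0).
Proof.
split; first exact: logconcave_cst.
by exists 0, 1; split => // y; rewrite mul0r.
Qed.

Lemma itint0 m : itint (fun _ : 'rV[R]_m => 0 : R) = 0.
Proof.
have := itintD (lcd_good (lcd0 m)) (lcd_good (lcd0 m)).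
rewrite (_ : (fun _ => 0 + 0) = fun=> 0); last by apply/funext => y; rewrite addr0.
by move/eqP; rewrite -subr_eq0 opprD addNKr oppr_eq0 => /eqP.
Qed.

Lemma itint_sum m N (F : 'I_N -> 'rV[R]_m -> R) : (forall i, good (F i)) ->
  good (fun y => \sum_i F i y) /\ itint (fun y => \sum_i F i y) = \sum_i itint (F i).
Proof.
elim: N F => [|N IH] F gF.
  rewrite (_ : (fun y => _) = fun=> 0); last by apply/funext => y; rewrite big_ord0.
  by rewrite big_ord0 itint0; split => //; exact/lcd_good/lcd0.
rewrite (_ : (fun y => _) =
    fun y => \sum_(i < N) F (widen_ord (leqnSn N) i) y + F ord_max y); last first.
  by apply/funext => y; rewrite big_ord_recr.
have [g1 e1] := IH (fun i => F (widen_ord (leqnSn N) i)) (fun i => gF _).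
by split; [exact: good_add|rewrite itintD// e1 big_ord_recr].
Qed.

(** [|s|] is a convex combination of [|t|] and [- |t|], where [a] takes the same value. *)
Lemma logconcave_even (a : R^o -> R) s t : logconcave a -> (forall t, a (- t) = a t) ->
  `|s| <= `|t| -> a t <= a s.
Proof.
move=> ha ev st; have [t0|t0] := eqVneq t 0.
  by move: st; rewrite t0 normr0 normr_le0 => /eqP ->.
have n0 : 0 < `|t| by rewrite normr_gt0.
have at_ : a `|t| = a t by case: (ger0P t) => _; rewrite ?ev.
have as_ : a `|s| = a s by case: (ger0P s) => _; rewrite ?ev.
rewrite -at_ -as_.
pose l := (`|s| / `|t| + 1) / 2.
have q1 : 0 <= `|s| / `|t| <= 1 by rewrite divr_ge0//= ler_pdivrMr// mul1r.
have l01 : 0 <= l <= 1 by rewrite /l; lra.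
have := logconcave_min (`|t| : R^o) (- `|t| : R^o) ha l01.
rewrite ev minxx; congr (_ <= a _).
rewrite /GRing.scale/= /l; field; lra.
Qed.

(** [Psi] is the product of the factors that stay. By itself it may fail to decay along some
    direction, so decay is only asked of its product with a Gaussian factor in [dot b y], the form
    being exchanged. *)
Variables (m : nat) (b : 'rV[R]_m) (Psi : 'rV[R]_m -> R).
Hypotheses (hPsi : logconcave Psi) (ePsi : forall y, Psi (- y) = Psi y)
  (tPsi : lcd (fun y => expR (- (dot b y) ^+ 2) * Psi y)).

Lemma logconcave_dot (G : R^o -> R) c : logconcave G ->
  logconcave (fun y : 'rV[R]_m => G (dot c y)).
Proof. by move=> hG; apply: (logconcave_affine hG) => x y l; exact: dot_lincomb. Qed.

Lemma lcd_tail (G : R^o -> R) C : 0 <= C -> logconcave G ->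
  (forall t, G t <= C * expR (- t ^+ 2)) -> lcd (fun y => G (dot b y) * Psi y).
Proof.
move=> C0 hG tG; split.
  by apply: logconcave_mul => //; exact: logconcave_dot.
have [_ [D [e [D0 e0 dF]]]] := tPsi.
exists (C * D), e; split=> // [|y]; first exact: mulr_ge0.
apply: (@le_trans _ _ (C * (expR (- dot b y ^+ 2) * Psi y))).
  by rewrite mulrA ler_wpM2r//; exact: hPsi.1.
by rewrite -mulrA ler_wpM2l.
Qed.

Let slab w tau y := box w (dot b y - tau) * Psi y.

Let boxS w tau : 0 < w -> logconcave (fun t : R^o => box w (t - tau)).
Proof.
move=> w0; apply: (logconcave_affine (box_logconcave w0)) => x y l.
by rewrite /GRing.scale/=; ring.
Qed.

Let slab_lcd w tau : 0 < w -> lcd (slab w tau).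
Proof.
move=> w0; apply: (@lcd_tail (fun t => box w (t - tau)) (expR ((`|tau| + w) ^+ 2))).
- exact: expR_ge0.
- exact: boxS.
move=> t; have [h|h] := leP (`|t - tau|) (w / 2); last first.
  by rewrite box_out// mulr_ge0 ?expR_ge0.
apply: le_trans (box_le1 _ w0) _; rewrite -expRD -[leLHS]expR0 ler_expR subr_ge0.
have h2 := ler_normD (t - tau) tau; rewrite subrK in h2.
rewrite -[leLHS]real_normK ?num_real//; apply: lerXn2r; rewrite ?nnegrE//; last by lra.
by rewrite addr_ge0// ltW.
Qed.

Let a w tau := itint (slab w tau).

(** Prekopa's theorem, applied to the slab mass as a function of the offset [tau]. With evenness
    this makes the mass decrease away from the centre. *)
Let a_logconcave w : 0 < w -> logconcave (a w : R^o -> R).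
Proof.
move=> w0; apply: (@itint_logconcave _ R^o m (slab w)); last by move=> u; exact: slab_lcd.
apply: logconcave_mul.
  apply: (@logconcave_affine _ _ _ (box w : R^o -> R) (fun p : R^o * 'rV[R]_m => dot b p.2 - p.1)).
    exact: box_logconcave.
  by move=> -[s x] [t y] l /=; rewrite dot_lincomb /GRing.scale/=; ring.
exact: (@logconcave_affine _ _ _ Psi (fun p : R^o * 'rV[R]_m => p.2)).
Qed.

Let a_even w tau : 0 < w -> a w (- tau) = a w tau.
Proof.
move=> w0; rewrite /a -(itint_opp (slab_lcd tau w0)); congr itint; apply/funext => y.
by rewrite /slab dotN ePsi -opprD boxN opprK.
Qed.

Let a_ge0 w tau : 0 < w -> 0 <= a w tau.
Proof. by move=> w0; exact/itint_ge0/lcd_good/slab_lcd. Qed.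

Let a_dec w s t : 0 < w -> 0 <= s -> s <= t -> a w t <= a w s.
Proof.
move=> w0 s0 st; apply: (logconcave_even (a_logconcave w0)); first by move=> u; exact: a_even.
by rewrite !ger0_norm// (le_trans s0).
Qed.

(** A step function of [dot b y] times [Psi], with value [c j] on the two [j]-th slabs. Constant
    coefficients 1 give one wide box; the coefficients [G w] below give an upper step function for
    [g]. *)
Let comb w N (c : nat -> R) y := c 0%N * slab w 0 y +
  \sum_(j < N) c j.+1 * (slab w (j.+1%:R * w) y + slab w (- (j.+1%:R * w)) y).

Let comb_int w N c : 0 < w -> (forall j, 0 <= c j) ->
  good (comb w N c) /\
  itint (comb w N c) = c 0%N * a w 0 + \sum_(j < N) c j.+1 * (a w (j.+1%:R * w) *+ 2).
Proof.
move=> w0 c0.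
have gs t := lcd_good (slab_lcd t w0).
have gp (j : 'I_N) : good (fun y => c j.+1 * (slab w (j.+1%:R * w) y + slab w (- (j.+1%:R * w)) y)).
  by apply: good_scale => //; exact: good_add.
have [g1 e1] := itint_sum gp.
have g0 : good (fun y => c 0%N * slab w 0 y) by exact: good_scale.
split; first exact: (good_add g0 g1).
rewrite (itintD g0 g1) e1 itintZ//; congr (_ + _); apply: eq_bigr => j _.
by rewrite itintZ ?itintD//; [rewrite -/(a _ _) -/(a _ _) a_even// mulr2n|exact: good_add].
Qed.

Let comb1 w N y : comb w N (fun=> 1) y = box ((2 * N + 1)%:R * w) (dot b y) * Psi y.
Proof.
rewrite /comb mul1r -box_partition mulrDl /slab subr0 mulr_suml; congr (_ + _).
by apply: eq_bigr => j _; rewrite mul1r opprK mulrDl.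
Qed.

(* The last condition is [\int g <= 1], phrased by the lower Riemann sums of [g]. *)
Definition swappable (g : R -> R) :=
  [/\ logconcave (g : R^o -> R), forall t, g (- t) = g t,
    exists2 C, 0 <= C & forall t, g t <= C * expR (- 2 * t ^+ 2),
    forall t, g t <= 1 &
    forall w N, 0 < w -> \sum_(k < N) w * g (k.+1%:R * w) <= 1 / 2].

Variable g : R -> R.
Hypothesis hg : swappable g.

(** An upper bound for [g] on the [j]-th slab, sampled one width nearer to the origin than its
    centre. Sampling at multiples of [w] lets the Riemann sums of [swappable] control the total, at
    the price of one extra slab. *)
Let G w (j : nat) : R := if j is j'.+1 then g (j'%:R * w) else 1.

Let G_ge0 w j : 0 <= G w j.
Proof. by case: hg => [[g0 _] _ _ _ _]; case: j => [|j] /=. Qed.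

Let G_le1 w j : G w j <= 1.
Proof. by case: hg => _ _ _ g1 _; case: j => [|j] /=. Qed.

Let sumG w N : 0 < w -> \sum_(j < N) G w j.+1 <= 1 + 1 / 2 / w.
Proof.
case: hg => _ _ _ g1 gR w0; case: N => [|N].
  by rewrite big_ord0 addr_ge0// !divr_ge0// ltW.
rewrite big_ord_recl; apply: lerD => //.
rewrite ler_pdivlMr// mulrC mulr_sumr; exact: gR.
Qed.

(* The even log-concave slab masses decrease away from the centre, so they are
   most favourable to the weights that are concentrated on the central slabs. *)
Let comb_le q N w : 0 < w -> (q <= N)%N -> (2 * q + 1)%:R * w = 1 ->
  itint (comb w N (G w)) <= itint (comb w q (fun=> 1)) + 3 * a w (q%:R * w).
Proof.
move=> w0 qN qw.
have [_ ->] := comb_int N w0 (G_ge0 w).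
have [_ ->] := comb_int q w0 (fun=> ler01).
set aq := a w (q%:R * w).
have E : \sum_(j < q) 1 * (a w (j.+1%:R * w) *+ 2) =
    \sum_(j < N) (j < q)%:R * (a w (j.+1%:R * w) *+ 2).
  rewrite (big_ord_widen_cond _ (fun _ => true) (fun j => 1 * (a w (j.+1%:R * w) *+ 2)) qN).
  rewrite big_mkcond; apply: eq_bigr => j _ /=.
  by case: ifP => _; rewrite ?mul0r.
(* Both sign patterns help: for [j < q] the coefficient is at most 0 and the mass at least [aq],
   beyond [q] the coefficient is at least 0 and the mass at most [aq]. *)
have H : \sum_(j < N) (G w j.+1 - (j < q)%:R) * (a w (j.+1%:R * w) *+ 2) <=
    \sum_(j < N) (G w j.+1 - (j < q)%:R) * (aq *+ 2).
  apply: ler_sum => j _; have := G_ge0 w j.+1; have := G_le1 w j.+1; move: (G w j.+1) => Gj Gj1 Gj0.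
  case: (ltnP j q) => jq /=.
    rewrite ler_wnM2l ?subr_le0// lerMn2r/=; apply/a_dec => //.
      by rewrite mulr_ge0// ltW.
    by rewrite ler_wpM2r ?ler_nat// ltW.
  rewrite subr0 ler_wpM2l// lerMn2r/=; apply/a_dec => //.
    by rewrite mulr_ge0// ltW.
  by rewrite ler_wpM2r ?ler_nat ?leqW// ltW.
have S1 : \sum_(j < N) ((j < q)%:R : R) = q%:R.
  transitivity (\sum_(j < q) (1 : R)); last by rewrite sumr_const card_ord.
  rewrite (big_ord_widen_cond _ (fun _ => true) (fun _ => 1 : R) qN) [RHS]big_mkcond.
  by apply: eq_bigr => j _ /=; case: ifP.
have D (f : nat -> R) : \sum_(j < N) (G w j.+1 - (j < q)%:R) * f j =
    \sum_(j < N) G w j.+1 * f j - \sum_(j < N) (j < q)%:R * f j.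
  by rewrite -sumrB; apply: eq_bigr => j _; rewrite mulrBl.
rewrite E !mul1r; move: H.
rewrite (D (fun j => a w (j.+1%:R * w) *+ 2)) -mulr_suml sumrB S1 => H.
have aq0 : 0 <= aq by exact: a_ge0.
have sg := sumG N w0.
(* As w = 1/(2q+1), the bound [1 + 1 / 2 / w] on the sum of the [G] is q + 3/2. The excess over [q]
   is at most 3/2, and with two slabs per index this is the error [3 * aq]. *)
have wi : 1 / 2 / w = q%:R + 1 / 2.
  have -> : w = (2 * q%:R + 1)^-1.
    have q0 : (2 * q + 1)%:R != 0 :> R by rewrite pnatr_eq0 addn1.
    by apply: (mulfI q0); rewrite qw natrD natrM mulfV// -natrM -natrD.
  by rewrite invrK; field.
have : (\sum_(j < N) G w j.+1 - q%:R) * (aq *+ 2) <= 3 / 2 * (aq *+ 2).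
  by rewrite ler_wpM2r ?mulrn_wge0//; lra.
rewrite mulr2n; lra.
Qed.

(** Within the range of the slabs the step function dominates. Outside, half of the decay exp(-2
    t^2) is kept and the other half is at most 1/(1 + (N w)^2), which vanishes as N w grows. *)
Let g_tail : exists2 C, 0 <= C & forall w N t, 0 < w ->
  g t <= (G w 0 * box w t + \sum_(j < N) G w j.+1 * (box w (t - j.+1%:R * w) + box w (t + j.+1%:R * w)))
   + C / (1 + (N%:R * w) ^+ 2) * expR (- t ^+ 2).
Proof.
have [hl ev [C C0 tl] g1 gR] := hg.
exists C => // w N t w0.
have gd (s u : R) : `|s| <= `|u| -> g u <= g s by exact: logconcave_even.
have Ct0 : 0 <= C / (1 + (N%:R * w) ^+ 2) * expR (- t ^+ 2).
  by rewrite mulr_ge0 ?expR_ge0// divr_ge0// addr_ge0// sqr_ge0.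
have [h|h] := ltP `|t| ((2 * N + 1)%:R * w / 2).
  apply: (@le_trans _ _ (g t * box ((2 * N + 1)%:R * w) t)).
    by rewrite (box_in h) mulr1.
  rewrite -box_partition mulrDr mulr_sumr -[leLHS]addr0; apply: lerD => //.
  apply: lerD; first by rewrite /= ler_wpM2r ?box_ge0.
  apply: ler_sum => j _; rewrite !mulrDr.
  (* The values 1 and -1 of [s] treat the two slabs of index [j.+1] at once. *)
  have key s : g t * box w (t - s * j.+1%:R * w) <= G w j.+1 * box w (t - s * j.+1%:R * w) \/ `|s| != 1.
    have [s1|] := eqVneq `|s| 1; last by right.
    left; have [h'|h'] := leP `|t - s * j.+1%:R * w| (w / 2); last by rewrite box_out// !mulr0.
    rewrite ler_wpM2r ?box_ge0// /=; apply: gd.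
    rewrite ger0_norm; last by rewrite mulr_ge0// ltW.
    have : `|s * j.+1%:R * w| <= `|t| + w / 2.
      have -> : s * j.+1%:R * w = t - (t - s * j.+1%:R * w) by ring.
      by apply: le_trans (ler_normB _ _) _; rewrite lerD2l.
    rewrite !normrM s1 mul1r normr_nat (gtr0_norm w0) -addn1 natrD mulrDl mul1r; lra.
  have [k1|] := key 1; last by rewrite normr1 eqxx.
  have [k2|] := key (-1); last by rewrite normrN1 eqxx.
  rewrite mul1r in k1; move: k2; rewrite !mulN1r mulNr opprK => k2.
  exact: lerD.
have Nt : N%:R * w <= `|t|.
  by apply: le_trans h; rewrite natrD natrM; lra.
apply: (@le_trans _ _ (C / (1 + (N%:R * w) ^+ 2) * expR (- t ^+ 2))); last first.
  rewrite lerDr addr_ge0//; first by rewrite mulr_ge0 ?box_ge0.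
  by apply: sumr_ge0 => j _; rewrite mulr_ge0 ?addr_ge0 ?box_ge0.
apply: le_trans (tl t) _; rewrite -mulrA ler_wpM2l//.
have -> : - 2 * t ^+ 2 = - t ^+ 2 + - t ^+ 2 by ring.
rewrite expRD ler_wpM2r ?expR_ge0// expRN lef_pV2 ?posrE ?expR_gt0//; last first.
  by rewrite ltr_pwDl// sqr_ge0.
apply: le_trans (expR_ge1Dx _); rewrite lerD2l.
rewrite -[leRHS]real_normK ?num_real// ler_sqr ?nnegrE//.
by rewrite mulr_ge0// ltW.
Qed.

(** The width is w = 1/(2q+1), so that the unit box consists of exactly 2q+1 slabs. The
    discretisation error [3 * a w (q%:R * w)] vanishes as q grows, and the tail as N/(2q+1)
    grows. *)
Lemma itint_swap :
  itint (fun y => g (dot b y) * Psi y) <= itint (fun y => box 1 (dot b y) * Psi y).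
Proof.
have [hl ev [C0 C00 tl] g1 gR] := hg.
have [C CC0 tailP] := g_tail.
set If := itint (fun y => box 1 (dot b y) * Psi y).
set J := itint (fun y => expR (- (dot b y) ^+ 2) * Psi y).
have J0 : 0 <= J by exact/itint_ge0/lcd_good.
have If0 : 0 <= If.
  apply/itint_ge0/lcd_good; rewrite (_ : (fun y => _) = slab 1 0); first exact: slab_lcd.
  by apply/funext => y; rewrite /slab subr0.
have gg : good (fun y => g (dot b y) * Psi y).
  apply/lcd_good/(lcd_tail C00) => // t; apply: le_trans (tl t) _.
  by rewrite ler_wpM2l// ler_expR; have := sqr_ge0 t; lra.
have main q N : (q <= N)%N -> itint (fun y => g (dot b y) * Psi y) <=
   If + 3 * If / (2 * q + 1)%:R + C / (1 + (N%:R / (2 * q + 1)%:R) ^+ 2) * J.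
  move=> qN; set w : R := (2 * q + 1)%:R^-1.
  have q0 : 0 < (2 * q + 1)%:R :> R by rewrite ltr0n addn1.
  have w0 : 0 < w by rewrite invr_gt0.
  have qw : (2 * q + 1)%:R * w = 1 by rewrite mulfV// gt_eqF.
  have [gc ec] := comb_int N w0 (G_ge0 w).
  have gt : good (fun y => C / (1 + (N%:R * w) ^+ 2) * (expR (- (dot b y) ^+ 2) * Psi y)).
    apply: good_scale; last exact: lcd_good.
    by rewrite divr_ge0// addr_ge0// sqr_ge0.
  apply: (@le_trans _ _ (itint (fun y => comb w N (G w) y +
      C / (1 + (N%:R * w) ^+ 2) * (expR (- (dot b y) ^+ 2) * Psi y)))).
    apply: itint_mono => //; first exact: good_add.
    move=> y; have := tailP w N (dot b y) w0.
    move/(ler_wpM2r (hPsi.1 y)) => /le_trans; apply.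
    rewrite le_eqVlt; apply/orP; left; apply/eqP.
    rewrite mulrDl /comb mulrDl mulr_suml; congr (_ + _ + _); last by rewrite -!mulrA.
      by rewrite /slab subr0 mulrA.
    by apply: eq_bigr => j _; rewrite /slab opprK -[in RHS]mulrDl mulrA.
  rewrite (itintD gc gt) itintZ; last exact: lcd_good.
  rewrite lerD2r; apply: le_trans (comb_le w0 qN qw) _.
  have -> : itint (comb w q (fun=> 1)) = If.
    by congr itint; apply/funext => y; rewrite comb1 qw.
  rewrite lerD2l -mulrA ler_wpM2l// ler_pdivlMr//.
  (* The outermost of the 2q+1 slabs of the unit box is the lightest, so it carries at most the
     fraction 1/(2q+1) of [If]. *)
  have := (comb_int q w0 (fun=> ler01)).2.
  have -> : itint (comb w q (fun=> 1)) = If.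
    by congr itint; apply/funext => y; rewrite comb1 qw.
  move=> ->; rewrite mul1r.
  have -> : (2 * q + 1)%:R = 1 + \sum_(j < q) 2 :> R.
    by rewrite sumr_const card_ord natrD natrM addrC mulr_natr.
  rewrite mulrDr mulr1 mulr_sumr; apply: lerD.
    by apply: a_dec => //; rewrite mulr_ge0// ltW.
  apply: ler_sum => j _; rewrite mul1r mulr_natr lerMn2r/=; apply: a_dec => //.
    by rewrite mulr_ge0// ltW.
  by rewrite ler_wpM2r ?ler_nat// ltW.
have arch (x e : R) : 0 <= x -> 0 < e -> exists n, x / n.+1%:R < e.
  move=> x0 e0; exists (Num.truncn (x / e)).
  by rewrite ltr_pdivrMr// -ltr_pdivrMl// mulrC; exact: truncnS_gt.
apply/ler_addgt0Pr => e e0.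
have e20 : 0 < e / 2 by rewrite divr_gt0.
have [q hq] := arch (3 * If) _ (mulr_ge0 (ler0n _ 3) If0) e20.
have [p hp] := arch (C * J) _ (mulr_ge0 CC0 J0) e20.
(* Chosen so that N/(2q+1) is the integer [maxn q p.+1]: at least [q] slabs on each side, and a tail
   of at most [C * J / p.+1]. *)
pose N := (maxn q p.+1 * (2 * q + 1))%N.
have qN : (q <= N)%N by rewrite /N addn1 mulnS (leq_trans (leq_maxl q p.+1))// leq_addr.
apply: le_trans (main q N qN) _.
have h1 : 3 * If / (2 * q + 1)%:R <= e / 2.
  apply: le_trans (ltW hq); rewrite ler_wpM2l ?mulr_ge0// lef_pV2 ?posrE ?ltr0n ?addn1//.
  by rewrite ler_nat ltnS mul2n -addnn leq_addr.
have h2 : C / (1 + (N%:R / (2 * q + 1)%:R) ^+ 2) * J <= e / 2.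
  rewrite mulrAC; apply: le_trans (ltW hp).
  have d0 : 0 < 1 + (N%:R / (2 * q + 1)%:R) ^+ 2 :> R by rewrite ltr_pwDl// sqr_ge0.
  rewrite ler_wpM2l ?mulr_ge0// lef_pV2 ?posrE ?ltr0n//.
  have -> : N%:R / (2 * q + 1)%:R = (maxn q p.+1)%:R :> R.
    by rewrite /N natrM mulfK// pnatr_eq0 addn1.
  rewrite -natrX -[X in _ <= X + _]/(1%:R) -natrD ler_nat add1n ltnS.
  apply: leq_trans (leq_trans (leqnSn p) (leq_maxr q p.+1)) _; rewrite expnS expn1 leq_pmulr//.
  by rewrite leq_max orbT.
lra.
Qed.

End Swap.

Section SwapAll.
Context {R : realType}.

Definition subgauss (r : R) (f : R -> R) :=
  exists2 C, 0 <= C & forall t, f t <= C * expR (- r * t ^+ 2).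

Lemma expR_prod I (r : seq I) (P : pred I) (F : I -> R) :
  \prod_(i <- r | P i) expR (F i) = expR (\sum_(i <- r | P i) F i).
Proof. by rewrite (big_morph expR (@expRD R) (@expR0 R)). Qed.

Variables (m n : nat) (b : 'I_n -> 'rV[R]_m) (e : R).
(** The vectors [b i] span, in quantitative form: factors decaying in each [dot (b i) y] have a
    product decaying in [y]. *)
Hypotheses (e0 : 0 < e) (be : forall y, e * sqn y <= \sum_i dot (b i) y ^+ 2).

Lemma lcd_prod (f : 'I_n -> R -> R) r : 0 < r -> (forall i, logconcave (f i : R^o -> R)) ->
  (forall i, subgauss r (f i)) -> lcd (fun y => \prod_i f i (dot (b i) y)).
Proof.
move=> r0 hf sf; split.
  by apply: logconcave_prod => i _; exact: logconcave_dot.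
have /(_ _)/cid2 sf' := sf.
pose C i := projT1 (sf' i).
have C0 i : 0 <= C i by rewrite /C; case: (sf' i).
have hC i t : f i t <= C i * expR (- r * t ^+ 2) by rewrite /C; case: (sf' i).
exists (\prod_i C i), (r * e); split=> // [||y]; [exact: prodr_ge0|exact: mulr_gt0|].
apply: (@le_trans _ _ (\prod_i (C i * expR (- r * dot (b i) y ^+ 2)))).
  by apply: ler_prod => i _; rewrite (hf i).1 hC.
rewrite big_split/= expR_prod ler_wpM2l ?prodr_ge0// ler_expR -mulr_sumr !mulNr lerN2 -mulrA.
by rewrite ler_wpM2l// ltW.
Qed.

Lemma logconcave_gauss (a : R) : 0 <= a -> logconcave (fun t : R^o => expR (- (a * t ^+ 2))).
Proof.
move=> a0; split=> [t|x y l /andP[/ltW l0 l1] _ _]; first exact: expR_ge0.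
have l1' : 0 <= 1 - l by rewrite subr_ge0 ltW.
rewrite !expRK ler_expR /GRing.scale/=.
have : 0 <= a * (l * (1 - l) * (x - y) ^+ 2).
  apply: mulr_ge0 => //; apply: mulr_ge0; [exact: mulr_ge0|exact: sqr_ge0].
rewrite -subr_ge0 => h; rewrite -subr_ge0; apply: le_trans h _.
rewrite le_eqVlt; apply/orP; left; apply/eqP; ring.
Qed.

Lemma swappable_subgauss g : swappable g -> subgauss 1 g.
Proof.
move=> [_ _ [C C0 tl] _ _]; exists C => // t; apply: le_trans (tl t) _.
by rewrite ler_wpM2l// ler_expR; have := sqr_ge0 t; lra.
Qed.

Lemma box_subgauss : subgauss 1 (box 1 : R -> R).
Proof.
exists (expR 1) => [|t]; first exact: expR_ge0.
have [h|h] := leP (`|t|) (1 / 2); last by rewrite box_out// mulr_ge0 ?expR_ge0.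
apply: le_trans (box_le1 _ ltr01) _; rewrite mulN1r -expRD -[leLHS]expR0 ler_expR subr_ge0.
rewrite -[leLHS]real_normK ?num_real//.
have := normr_ge0 t; nra.
Qed.

(** One factor at a time: [h k] has boxes at the indices below [k]. At each exchange the remaining
    factors form [Psi], and putting a Gaussian in the vacant place restores the decay. *)
Lemma itint_prod_swap (g : 'I_n -> R -> R) : (forall i, swappable (g i)) ->
  itint (fun y => \prod_i g i (dot (b i) y)) <= itint (fun y => \prod_i box 1 (dot (b i) y)).
Proof.
move=> hg.
pose h k (i : 'I_n) := if (i < k)%N then box 1 else g i : R -> R.
have hL k i : logconcave (h k i : R^o -> R).
  by rewrite /h; case: ifP => _; [exact: box_logconcave|case: (hg i)].
have hE k i t : h k i (- t) = h k i t.
  by rewrite /h; case: ifP => _; [exact: boxN|case: (hg i)].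
have hS k i : subgauss 1 (h k i).
  by rewrite /h; case: ifP => _; [exact: box_subgauss|exact: swappable_subgauss].
suff main k : (k <= n)%N ->
    itint (fun y => \prod_i g i (dot (b i) y)) <= itint (fun y => \prod_i h k i (dot (b i) y)).
  apply: le_trans (main n (leqnn _)) _.
  rewrite (_ : (fun y => _) = fun y => \prod_i box 1 (dot (b i) y))//.
  by apply/funext => y; apply: eq_bigr => i _; rewrite /h ltn_ord.
elim: k => [_|k IH kn]; first by [].
apply: le_trans (IH (ltnW kn)) _.
pose i0 := Ordinal kn.
pose Psi y := \prod_(i | i != i0) h k i (dot (b i) y).
have E j : (j = k \/ j = k.+1) -> (fun y => \prod_i h j i (dot (b i) y)) =
    (fun y => h j i0 (dot (b i0) y) * Psi y).
  move=> hj; apply/funext => y; rewrite (bigD1 i0)//=; congr (_ * _).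
  apply: eq_bigr => i ii0; rewrite /h; case: hj => -> //.
  have ik : (i : nat) != k by apply: contra ii0 => /eqP ik; apply/eqP/val_inj.
  by rewrite ltnS leq_eqVlt (negbTE ik).
rewrite (E k); last by left.
rewrite (E k.+1); last by right.
have -> : h k.+1 i0 = box 1 by rewrite /h ltnSn.
have hk : h k i0 = g i0 by rewrite /h ltnn.
rewrite hk; apply: itint_swap => //.
- by apply: logconcave_prod => i _; exact: logconcave_dot.
- by move=> y; apply: eq_bigr => i _; rewrite dotN hE.
pose h' i := if i == i0 then (fun t => expR (- t ^+ 2)) else h k i.
rewrite (_ : (fun y => _) = fun y => \prod_i h' i (dot (b i) y)); last first.
  apply/funext => y; rewrite [RHS](bigD1 i0)//= /h' eqxx; congr (_ * _).
  by apply: eq_bigr => i /negbTE ->.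
apply: (lcd_prod ltr01) => i; rewrite /h'; case: ifP => _ //.
  have := logconcave_gauss ler01; congr logconcave.
  by apply/funext => t; rewrite mul1r.
by exists 1 => // t; rewrite mul1r mulN1r.
Qed.

End SwapAll.

(** * The two weights that may replace a slab *)

Section Swappables.
Context {R : realType}.
Notation mu := (@lebesgue_measure R).

(** Twice the sum is the integral of the step function [S N], which has value [g (k.+1%:R * w)] on
    the symmetric set [J k] and stays below [g] because [g] decreases in [|t|]. *)
Lemma riemann_sum_le (g : R -> R) : logconcave (g : R^o -> R) -> (forall t, g (- t) = g t) ->
  mu.-integrable setT (EFin \o g) -> \int[mu]_t g t <= 1 ->
  forall w N, 0 < w -> \sum_(k < N) w * g (k.+1%:R * w) <= 1 / 2.
Proof.
move=> hg ev ig Ig w N w0.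
have gd s t : `|s| <= `|t| -> g t <= g s by exact: logconcave_even.
pose J1 (k : nat) : set R := `]k%:R * w, k.+1%:R * w]%classic.
pose J2 (k : nat) : set R := `[- (k.+1%:R * w), - (k%:R * w)[%classic.
pose J (k : nat) : set R := J1 k `|` J2 k.
have kw0 (k : nat) : 0 <= k%:R * w by rewrite mulr_ge0// ltW.
have kS (k : nat) : k.+1%:R * w = k%:R * w + w by rewrite -addn1 natrD mulrDl mul1r.
have mJ k : measurable (J k) by apply: measurableU; exact: measurable_itv.
have muJ k : mu (J k) = (w *+ 2)%:E.
  have -> : mu (J k) = (mu (J1 k) + mu (J2 k))%E.
    apply: measureU; [exact: measurable_itv|exact: measurable_itv|].
    apply/seteqP; split => t //=; rewrite /J1 /J2/= !in_itv/= => -[/andP[h1 _] /andP[_ h2]].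
    by have := kw0 k; lra.
  rewrite /J1 /J2 !lebesgue_measure_itv/= !lte_fin kS ifT; last lra.
  rewrite ifT; last lra.
  by rewrite -EFinD; congr EFin; rewrite mulr2n; ring.
pose S N t := \sum_(k < N) g (k.+1%:R * w) * \1_(J k) t.
have JE k t : J k t <-> k%:R * w < `|t| <= k.+1%:R * w.
  rewrite /J/= /J1 /J2/= !in_itv/=; have := kw0 k; have := kw0 k.+1 => h1 h2.
  case: (ger0P t) => t0; split.
  - by case=> // /andP[a1 a2]; lra.
  - by left.
  - by case=> /andP[a1 a2]; apply/andP; lra.
  - by move=> /andP[a1 a2]; right; apply/andP; lra.
have SP M t : (`|t| <= M%:R * w -> S M t <= g t) /\ (M%:R * w < `|t| -> S M t = 0).
  elim: M => [|M [IH1 IH2]]; first by rewrite /S big_ord0; split => // _; exact: hg.1.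
  rewrite /S big_ord_recr/= -/(S M t) indicE.
  have [h|h] := boolP (t \in J M).
    have /JE/andP[h1 h2] := set_mem h.
    rewrite mulr1 IH2// add0r; split; last by move=> h3; have := lt_le_trans h3 h2; rewrite ltxx.
    by move=> _; apply: gd; rewrite [leRHS]ger0_norm.
  rewrite mulr0 addr0; have nJ : ~ (M%:R * w < `|t| <= M.+1%:R * w).
    by move=> /JE hJ; move: h; rewrite mem_set.
  split=> h1.
    have [h2|h2] := leP `|t| (M%:R * w); first exact: IH1.
    by exfalso; apply: nJ; rewrite h2 h1.
  by apply: IH2; apply: lt_trans h1; rewrite kS ltrDl.
have Sg t : S N t <= g t.
  have [h|h] := leP `|t| (N%:R * w); first exact: (SP N t).1.
  by rewrite (SP N t).2//; exact: hg.1.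
have i1J k : mu.-integrable setT (EFin \o (\1_(J k) : R -> R)).
  apply/integrableP; split; first by apply/measurable_EFinP; apply: measurable_indic; exact: mJ.
  rewrite [ltLHS](_ : _ = (\int[mu]_x (\1_(J k) x)%:E)%E); last first.
    by apply: eq_integral => t _; rewrite /= ger0_norm.
  rewrite integral_indic ?setIT; [|exact: measurableT|exact: mJ].
  by change (mu (J k) < +oo)%E; rewrite muJ ltry.
have iJ k : mu.-integrable setT (EFin \o (fun t => g (k.+1%:R * w) * \1_(J k) t)).
  rewrite (_ : EFin \o _ = fun t => ((g (k.+1%:R * w))%:E * (\1_(J k) t)%:E)%E)//.
  exact: (@integrableZl _ _ _ mu setT _ (g (k.+1%:R * w)) (EFin \o \1_(J k))).
have SI M : mu.-integrable setT (EFin \o S M) /\ \int[mu]_t S M t = \sum_(k < M) g (k.+1%:R * w) * (w *+ 2).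
  elim: M => [|M [IH1 IH2]].
    rewrite (_ : S 0%N = fun=> 0); last by apply/funext => t; rewrite /S big_ord0.
    by rewrite big_ord0; split; [exact: integrable0|rewrite /Rintegral integral0].
  rewrite (_ : S M.+1 = fun t => S M t + g (M.+1%:R * w) * \1_(J M) t); last first.
    by apply/funext => t; rewrite /S big_ord_recr.
  split; first by apply: (integrableD measurableT IH1 (iJ M)).
  rewrite RintegralD// IH2 big_ord_recr/=; congr (_ + _).
  rewrite RintegralZl//; congr (_ * _).
  rewrite /Rintegral integral_indic ?setIT; [|exact: measurableT|exact: mJ].
  by change (fine (mu (J M)) = w *+ 2); rewrite muJ.
have [iS ES] := SI N.
have : \int[mu]_t S N t <= 1 by apply: le_trans Ig; apply: le_Rintegral.
rewrite ES -mulr_suml -mulr_sumr mulr2n; lra.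
Qed.

Lemma swappable_gauss : swappable (fun t : R => expR (- (pi * t ^+ 2))).
Proof.
have pi0 := @pi_gt0 R.
have ev t : expR (- (pi * (- t) ^+ 2)) = expR (- (pi * t ^+ 2)) :> R by rewrite sqrrN.
have hl := @logconcave_gauss R _ (ltW pi0).
split => //.
- exists 1 => // t; rewrite mul1r ler_expR.
  by have := sqr_ge0 t; have := @pi_ge2 R; nra.
- by move=> t; rewrite -[leRHS]expR0 ler_expR oppr_le0 mulr_ge0 ?sqr_ge0// ltW.
have [i1 e1] := gauss_integral1 0 pi0.
have E : (fun t : R => expR (- pi * (t - 0) ^+ 2)) = (fun t => expR (- (pi * t ^+ 2))).
  by apply/funext => t; rewrite subr0 mulNr.
rewrite E in i1 e1.
have e1' : \int[mu]_t expR (- (pi * t ^+ 2)) <= 1 by rewrite e1 divff ?sqrtr1// gt_eqF.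
exact: (riemann_sum_le hl ev i1 e1').
Qed.

(* The constants 3/8 and 8 make [min 1 (exp (- 8 (|t| - 3/8)))], the majorant
   of [exp (- 16 t^4)] given by a tangent line, a function of integral 1. *)
Lemma swappable_quartic : swappable (fun t : R => expR (- (16 * t ^+ 4))).
Proof.
have ev t : expR (- (16 * (- t) ^+ 4)) = expR (- (16 * t ^+ 4)) :> R.
  by congr expR; ring.
have q4 (t : R) : t ^+ 4 = (t ^+ 2) ^+ 2 by rewrite -exprM.
have le1 t : expR (- (16 * t ^+ 4)) <= 1 :> R.
  by rewrite -[leRHS]expR0 ler_expR oppr_le0 mulr_ge0// q4 sqr_ge0.
split => //.
- split=> [t|x y l /andP[/ltW l0 l1] _ _]; first exact: expR_ge0.
  rewrite !expRK ler_expR /GRing.scale/= !q4.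
  have l1' : 0 <= 1 - l by rewrite subr_ge0 ltW.
  have h1 : (l * x + (1 - l) * y) ^+ 2 <= l * x ^+ 2 + (1 - l) * y ^+ 2.
    have : 0 <= l * (1 - l) * (x - y) ^+ 2 by apply: mulr_ge0; [exact: mulr_ge0|exact: sqr_ge0].
    rewrite -subr_ge0 => h; rewrite -subr_ge0; apply: le_trans h _.
    rewrite le_eqVlt; apply/orP; left; apply/eqP; ring.
  have h2 : (l * x ^+ 2 + (1 - l) * y ^+ 2) ^+ 2 <= l * (x ^+ 2) ^+ 2 + (1 - l) * (y ^+ 2) ^+ 2.
    have : 0 <= l * (1 - l) * (x ^+ 2 - y ^+ 2) ^+ 2 by apply: mulr_ge0; [exact: mulr_ge0|exact: sqr_ge0].
    rewrite -subr_ge0 => h; rewrite -subr_ge0; apply: le_trans h _.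
    rewrite le_eqVlt; apply/orP; left; apply/eqP; ring.
  have h3 := le_trans (lerXn2r 2 (sqr_ge0 _) (le_trans (sqr_ge0 _) h1) h1) h2.
  lra.
- exists (expR 1) => [|t]; first exact: expR_ge0.
  rewrite -expRD ler_expR q4; have := sqr_ge0 (t ^+ 2 - 1 / 16); have := sqr_ge0 t; nra.
(* For t >= 0 this is the integral of the majorant from 0 to [t]; it stays at most 1/2, and the sum
   is compared with it by telescoping. *)
pose H (t : R) := if t <= 3 / 8 then t else 1 / 2 - expR (- (8 * (t - 3 / 8))) / 8.
(* The tangent of 16 t^4 at t = 1/2 is 8 t - 3. *)
have tang (t : R) : expR (- (16 * t ^+ 4)) <= expR (- (8 * (t - 3 / 8))).
  rewrite ler_expR; have : 0 <= (2 * t - 1) ^+ 2 * ((2 * t + 1) ^+ 2 + 2).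
    by rewrite mulr_ge0 ?sqr_ge0// addr_ge0 ?sqr_ge0.
  have -> : (2 * t - 1) ^+ 2 * ((2 * t + 1) ^+ 2 + 2) = 16 * t ^+ 4 - 8 * t + 3 by ring.
  lra.
have step u w : 0 <= u -> 0 < w -> w * expR (- (16 * (u + w) ^+ 4)) <= H (u + w) - H u.
  move=> u0 w0; rewrite /H; have [h1|h1] := leP (u + w) (3 / 8).
    rewrite ifT; last lra.
    by rewrite addrAC subrr add0r -[leRHS]mulr1 ler_wpM2l// ltW.
  set a := expR (- (8 * (u + w - 3 / 8))).
  have a0 : 0 < a by exact: expR_gt0.
  have ha : w * expR (- (16 * (u + w) ^+ 4)) <= w * a by rewrite ler_wpM2l// ltW.
  have [h2|h2] := leP u (3 / 8).
    have : a * (1 + 8 * (u + w - 3 / 8)) <= 1.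
      have E1 : a * expR (8 * (u + w - 3 / 8)) = 1 by rewrite -expRD addNr expR0.
      by rewrite -[leRHS]E1 ler_wpM2l ?expR_ge1Dx// ltW.
    have : a <= 1 by rewrite -[leRHS]expR0 ler_expR; lra.
    nra.
  have E : expR (- (8 * (u - 3 / 8))) = a * expR (8 * w) by rewrite -expRD; congr expR; ring.
  rewrite E; have := expR_ge1Dx (8 * w); nra.
move=> w N w0.
have tele : \sum_(k < N) w * expR (- (16 * (k.+1%:R * w) ^+ 4)) <= H (N%:R * w).
  elim: N => [|N IH]; first by rewrite big_ord0 mul0r /H ifT.
  rewrite big_ord_recr/= -[leRHS](subrK (H (N%:R * w))) addrC; apply: lerD => //.
  have -> : N.+1%:R * w = N%:R * w + w by rewrite -addn1 natrD mulrDl mul1r.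
  by apply: step => //; rewrite mulr_ge0// ltW.
apply: le_trans tele _; rewrite /H; case: ifP => h; first by lra.
by have := expR_gt0 (- (8 * (N%:R * w - 3 / 8))); lra.
Qed.

End Swappables.

(** * Gaussian integrals and moments *)

Section Schur.
Variable F : fieldType.

Lemma det_schur_dr m1 m2 (A : 'M[F]_m1) (B : 'M[F]_(m1, m2)) (C : 'M[F]_(m2, m1)) (D : 'M[F]_m2) :
  D \in unitmx -> \det (block_mx A B C D) = \det (A - B *m invmx D *m C) * \det D.
Proof.
move=> uD.
have E : block_mx A B C D *m block_mx 1%:M 0 (- (invmx D *m C)) 1%:M =
    block_mx (A - B *m invmx D *m C) B 0 D.
  by rewrite mulmx_block !mulmx1 !mulmx0 !add0r !mulmxN mulmxA mulmxA mulmxV// mul1mx subrr.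
have := congr1 determinant E; rewrite det_mulmx det_lblock !det1 !mulr1 => ->.
by rewrite det_ublock.
Qed.

Lemma det_schur_ul m1 m2 (A : 'M[F]_m1) (B : 'M[F]_(m1, m2)) (C : 'M[F]_(m2, m1)) (D : 'M[F]_m2) :
  A \in unitmx -> \det (block_mx A B C D) = \det A * \det (D - C *m invmx A *m B).
Proof.
move=> uA.
have E : block_mx A B C D *m block_mx 1%:M (- (invmx A *m B)) 0 1%:M =
    block_mx A 0 C (D - C *m invmx A *m B).
  rewrite mulmx_block !mulmx1 !mulmx0 !addr0 !mulmxN !mulmxA mulmxV// mul1mx.
  by rewrite addNr [- _ + _]addrC.
have := congr1 determinant E; rewrite det_mulmx det_ublock !det1 !mulr1 => ->.
by rewrite det_lblock.
Qed.

(** Both Schur complements of the matrix with blocks 1, -e b, b^T, S compute the same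
    determinant. *)
Lemma det_rank1 m (S : 'M[F]_m) (b : 'rV[F]_m) (e : F) : S \in unitmx ->
  \det (S + e *: (b^T *m b)) = \det S * (1 + e * (b *m invmx S *m b^T) 0 0).
Proof.
move=> uS.
have h1 := det_schur_ul (- (e *: b)) b^T S (unitmx1 F 1).
have h2 := det_schur_dr 1%:M (- (e *: b)) b^T uS.
move: h1; rewrite h2 det1 mul1r invmx1 mulmx1 mulmxN opprK -scalemxAr => <-.
rewrite mulrC det_mx11 !mulNmx opprK -!scalemxAl; move: (b *m invmx S *m b^T) => X.
by rewrite !mxE eqxx.
Qed.

End Schur.

Section GaussItint.
Context {R : realType}.
Notation mu := (@lebesgue_measure R).

Definition qform m (S : 'M[R]_m) (y : 'rV[R]_m) := (y *m S *m y^T) 0 0.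

Definition posdef m (S : 'M[R]_m) := S^T = S /\ forall y, y != 0 -> 0 < qform S y.

Lemma posdef_unit m (S : 'M[R]_m) : posdef S -> S \in unitmx.
Proof.
move=> [_ pS]; rewrite -row_free_unit -kermx_eq0; apply/eqP/row_matrixP => i.
rewrite row0; apply/eqP/negP => /negP ni.
have := pS _ ni; rewrite /qform -row_mul mulmx_ker row0 mul0mx mxE ltxx.
by [].
Qed.

(** Completing the square in [z]; the coefficient left at [u ^+ 2] is the Schur complement of
    [S]. *)
Lemma qform_consr m (s : R) (v : 'rV[R]_m) (S : 'M[R]_m) u z : S^T = S -> S \in unitmx ->
  qform (block_mx (s%:M : 'M[R]_1) v v^T S : 'M[R]_(1 + m)) (consr u z) =
  qform S (z + u *: (v *m invmx S)) + u ^+ 2 * (s - qform (invmx S) v).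
Proof.
move=> tS uS; rewrite /qform /consr.
rewrite mul_row_block tr_row_mx mul_row_col.
have vz : v *m z^T = z *m v^T.
  by apply/matrixP => i j; rewrite !mxE !ord1; apply: eq_bigr => k _; rewrite !mxE mulrC.
have tI : (invmx S)^T = invmx S by rewrite trmx_inv tS.
have E : (z + u *: (v *m invmx S)) *m S *m (z + u *: (v *m invmx S))^T =
   z *m S *m z^T + (u *+ 2) *: (z *m v^T) + (u ^+ 2) *: (v *m invmx S *m v^T).
  rewrite mulmxDl -scalemxAl -mulmxA mulVmx// mulmx1 linearD/= linearZ/= trmx_mul tI.
  rewrite mulmxDl !mulmxDr -!scalemxAl -!scalemxAr !mulmxA vz scalerA -expr2.
  rewrite (mulmxK uS) -!addrA; congr (_ + _).
  by rewrite !addrA -scalerDl -mulr2n.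
rewrite E !tr_scalar_mx !mul_scalar_mx mulmxDl -!scalemxAl mul_mx_scalar scalerA.
rewrite mul_mx_scalar mulmxDl -scalemxAl vz.
move: (z *m v^T) (z *m S *m z^T) (v *m invmx S *m v^T) => X Y W.
rewrite !mxE eqxx mulr1n; ring.
Qed.

Lemma posdef_dr m (s : R) (v : 'rV[R]_m) (S : 'M[R]_m) :
  posdef (block_mx (s%:M : 'M[R]_1) v v^T S : 'M[R]_(1 + m)) ->
  posdef S /\ 0 < s - qform (invmx S) v.
Proof.
move=> [tS pS]; move: tS; rewrite tr_block_mx => /eq_block_mx[_ _ _ tS'].
have pS' : posdef S.
  split=> // y y0; have := pS (consr 0 y); rewrite /qform /consr.
  rewrite mul_row_block tr_row_mx mul_row_col !tr_scalar_mx !mul_scalar_mx !scale0r !add0r.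
  rewrite mul_mx_scalar scale0r add0r; apply; apply: contra y0 => /eqP h.
  by apply/eqP; have := congr1 (@rsubmx _ 1 1 m) h; rewrite row_mxKr raddf0.
split=> //; have uS := posdef_unit pS'.
have := pS (consr 1 (- (v *m invmx S))).
rewrite qform_consr// scale1r addNr /qform mul0mx mul0mx mxE add0r expr1n mul1r; apply.
apply/eqP => h; have := congr1 (fun x : 'rV[R]_m.+1 => x 0 ord0) h.
by rewrite consr_0 mxE => /eqP; rewrite oner_eq0.
Qed.

(** Induction on the dimension through Schur complements. The centre [w] and the factor [c] are
    arbitrary because the slice at [t] is again a Gaussian, with moved centre and a factor depending
    on [t]. *)
Lemma gauss_itint m (S : 'M[R]_m) w : posdef S -> 0 < \det S /\
  forall c, itint (fun y => c * expR (- (pi * qform S (y - w)))) = c / Num.sqrt (\det S).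
Proof.
elim: m S w => [|m IH] S w pS.
  rewrite det_mx00; split=> //= c.
  by rewrite /qform mxE big_ord0 mulr0 oppr0 expR0 sqrtr1 invr1.
pose S1 := S : 'M[R]_(1 + m).
pose s := ulsubmx S1 0 0; pose v := ursubmx S1; pose S' := drsubmx S1.
have ES : S1 = block_mx (s%:M : 'M[R]_1) v v^T S'.
  rewrite -[LHS]submxK; congr block_mx.
    by rewrite [LHS]mx11_scalar.
  by rewrite /v trmx_ursub; congr (dlsubmx _); rewrite [RHS]pS.1.
rewrite -[S]/S1 ES in pS *.
have [pS' a0] := posdef_dr pS.
have uS := posdef_unit pS'.
set a := s - _ in a0 *.
have dS : \det (block_mx (s%:M : 'M[R]_1) v v^T S') = a * \det S'.
  rewrite det_schur_dr// det_mx11; congr (_ * _).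
  rewrite /a /qform; move: (v *m invmx S' *m v^T) => X.
  by rewrite !mxE eqxx mulr1n.
have [d0 _] := IH _ 0 pS'.
rewrite dS; split=> [|c]; first exact: mulr_gt0.
pose w0 := w 0 ord0; pose w' := rsubmx (w : 'rV[R]_(1 + m)).
have Ew : w = consr w0 w'.
  apply: rowvPe => [|i]; rewrite ?consr_0 ?consr_lift// mxE.
  by congr (w _ _); exact: val_inj.
rewrite /=.
have E t : itint (fun y => c * expR (- (pi * qform (block_mx (s%:M : 'M[R]_1) v v^T S') (consr t y - w))))
    = c / Num.sqrt (\det S') * expR (- (pi * a) * (t - w0) ^+ 2).
  rewrite mulrAC -(IH _ (w' - (t - w0) *: (v *m invmx S')) pS').2.
  congr itint; apply/funext => y.
  have -> : consr t y - w = consr (t - w0) (y - w').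
    by rewrite Ew consrN; have := consr_lincomb 1 1 t (- w0) y (- w'); rewrite !scale1r !mul1r.
  rewrite qform_consr ?pS'.1// -[RHS]mulrA -expRD; congr (_ * expR _).
  rewrite opprB addrA addrAC -/a.
  ring.
under eq_Rintegral do rewrite E.
have pa0 : 0 < pi * a by rewrite mulr_gt0// pi_gt0.
have [gi gI] := gauss_integral1 w0 pa0.
rewrite RintegralZl// gI.
have -> : Num.sqrt (pi / (pi * a)) = (Num.sqrt a)^-1.
  by rewrite invfM mulrA divff ?gt_eqF ?pi_gt0// mul1r sqrtrV ?ltW.
have -> : Num.sqrt (a * \det S') = Num.sqrt a * Num.sqrt (\det S') by rewrite sqrtrM// ltW.
by rewrite invfM [(_)^-1 * _]mulrC mulrA.
Qed.

End GaussItint.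

(** * Numerical inequalities *)

Section RealIneq.
Context {R : realType}.

Lemma expR_ge_taylor (x : R) n : 0 <= x ->
  \sum_(k < n) x ^+ k / k`!%:R <= expR x.
Proof.
move=> x0; rewrite -(big_mkord xpredT (fun k => x ^+ k / k`!%:R)).
have nd : nondecreasing_seq (series (exp_coeff x)).
  by apply: nondecreasing_series => k _ _; exact: exp_coeff_ge0.
exact: (nondecreasing_cvgn_le nd (is_cvg_series_exp_coeff x) n).
Qed.

Lemma expR_ge_taylor2 (x : R) : 0 <= x -> 1 + x + x ^+ 2 / 2 <= expR x.
Proof.
move=> x0; have := expR_ge_taylor 3 x0.
rewrite !big_ord_recr/= big_ord0 add0r expr0 expr1.
by rewrite (_ : 0`!%:R = 1 :> R)// ?(_ : 1`!%:R = 1 :> R)// (_ : 2`!%:R = 2 :> R)// !divr1.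
Qed.

Lemma expR1_ge : 8 / 3 <= expR 1 :> R.
Proof.
apply: le_trans (expR_ge_taylor 4 ler01).
rewrite !big_ord_recr/= big_ord0 add0r !expr1n.
rewrite (_ : 0`!%:R = 1 :> R)// ?(_ : 1`!%:R = 1 :> R)// (_ : 2`!%:R = 2 :> R)//.
rewrite (_ : 3`!%:R = 6 :> R)//; lra.
Qed.

(** If pi < 3, then sin(pi/8) <= 3/8, and two applications of the double angle formula give
    cos(pi/2) > 0. The bound yields 24/pi^2 <= 8/3 <= e. *)
Lemma pi_ge3 : 3 <= pi :> R.
Proof.
have sinle (u : R) : 0 <= u -> sin u <= u.
  move=> u0; have [c _] := @MVT_segment R sin cos 0 u u0 (fun x _ => is_derive_sin x)
    (continuous_subspaceT (@continuous_sin R)).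
  by rewrite sin0 !subr0 => ->; rewrite -[leRHS]mul1r ler_wpM2r// cos_le1.
rewrite leNgt; apply/negP => pi3.
have p0 := @pi_gt0 R; have p2 := @pi_ge2 R; pose q := pi : R.
have p8 : 0 <= q / 8 by rewrite /q; lra.
have s8 : sin (q / 8) <= 3 / 8 by have := sinle _ p8; rewrite /q; lra.
have s80 : 0 <= sin (q / 8) by apply: sin_ge0_pi; rewrite /q; lra.
have c4 : cos (q / 4) = 1 - (sin (q / 8)) ^+ 2 *+ 2.
  rewrite (_ : q / 4 = (q / 8) *+ 2); last by rewrite -[RHS]mulr_natr; field.
  by rewrite cos_mulr2n cos2sin2 !mulr2n; ring.
have c2 : cos (q / 2) = (cos (q / 4)) ^+ 2 *+ 2 - 1.
  by rewrite (_ : q / 2 = (q / 4) *+ 2) ?cos_mulr2n// -[RHS]mulr_natr; field.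
have := @cos_pihalf R; rewrite -/q c2 c4.
have : (sin (q / 8)) ^+ 2 <= 9 / 64 by nra.
have := sqr_ge0 (sin (q / 8)); move: (sin (q / 8) ^+ 2) => z z0 z1.
rewrite !mulr2n; nra.
Qed.

(** The coefficients up to d^2 are those of the Taylor series, since the moments are read off from
    them; the true cubic coefficient is 5/16, and 1 absorbs the remainder for d <= 1/2. *)
Lemma inv_sqrt_ub_minus (d : R) : 0 <= d <= 1 / 2 ->
  (Num.sqrt (1 - d))^-1 <= 1 + d / 2 + 3 / 8 * d ^+ 2 + d ^+ 3.
Proof.
move=> /andP[d0 d1]; set p := (X in _ <= X).
have p0 : 0 < p by rewrite /p; nra.
have s0 : 0 < Num.sqrt (1 - d) by rewrite sqrtr_gt0; lra.
rewrite -[leLHS]mul1r ler_pdivrMr//.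
suff H : 1 <= (p * Num.sqrt (1 - d)) ^+ 2.
  rewrite leNgt; apply/negP => h; move: H; rewrite leNgt expr_lt1 ?h// mulr_ge0// ltW//.
rewrite exprMn [X in _ * X]sqr_sqrtr; last lra.
have E : p ^+ 2 * (1 - d) = 1 + d ^+ 3 * (11 / 8 - 79 / 64 * d - 25 / 64 * d ^+ 2 + 1 / 4 * d ^+ 3 - d ^+ 4).
  by rewrite /p; field.
rewrite E -[leLHS]addr0 lerD2l mulr_ge0 ?exprn_ge0//.
have h2 : d ^+ 2 <= 1 / 4 by nra.
have h3 : 0 <= d ^+ 3 by rewrite exprn_ge0.
have h4 : d ^+ 4 <= 1 / 16 by rewrite (_ : d ^+ 4 = (d ^+ 2) ^+ 2) -?exprM//; nra.
lra.
Qed.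

Lemma inv_sqrt_ub_plus (d : R) : 0 <= d ->
  (Num.sqrt (1 + d))^-1 <= 1 - d / 2 + 3 / 8 * d ^+ 2.
Proof.
move=> d0; set p := (X in _ <= X).
have p0 : 0 < p by rewrite /p; have := sqr_ge0 (d - 2 / 3); nra.
have s0 : 0 < Num.sqrt (1 + d) by rewrite sqrtr_gt0; lra.
rewrite -[leLHS]mul1r ler_pdivrMr//.
suff H : 1 <= (p * Num.sqrt (1 + d)) ^+ 2.
  rewrite leNgt; apply/negP => h; move: H; rewrite leNgt expr_lt1 ?h// mulr_ge0// ltW//.
rewrite exprMn [X in _ * X]sqr_sqrtr; last lra.
have E : p ^+ 2 * (1 + d) = 1 + d ^+ 3 * (5 / 8 - 15 / 64 * d + 9 / 64 * d ^+ 2).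
  by rewrite /p; field.
rewrite E -[leLHS]addr0 lerD2l mulr_ge0 ?exprn_ge0//.
have := sqr_ge0 (d - 5 / 6); nra.
Qed.

Lemma le_of_le_addeps (x y K e0 : R) : 0 <= K -> 0 < e0 ->
  (forall e, 0 < e -> e <= e0 -> x <= y + K * e) -> x <= y.
Proof.
move=> K0 e00 H; apply/ler_addgt0Pr => d d0.
pose e := Num.min e0 (d / (K + 1)).
have K1 : 0 < K + 1 by lra.
have ep : 0 < e by rewrite lt_min e00 divr_gt0.
apply: le_trans (H e ep _) _; first by rewrite ge_min lexx.
rewrite lerD2l; apply: (@le_trans _ _ (K * (d / (K + 1)))).
  by rewrite ler_wpM2l// ge_min lexx orbT.
rewrite mulrA ler_pdivrMr//; nra.
Qed.

End RealIneq.

Section Moments.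
Context {R : realType}.

(** An even power is not log-concave on the line, having a zero between positive values, but each of
    its two halves is. This brings the moments within reach of [lcd_good]. *)
Definition halfpow (k : nat) (t : R) : R := if 0 < t then t ^+ k else 0.

Lemma halfpow_logconcave k : logconcave (halfpow k : R^o -> R).
Proof.
split=> [t|x y l /andP[l0 l1]].
  by rewrite /halfpow; case: ifP => // t0; rewrite exprn_ge0// ltW.
rewrite /halfpow; case: ifP => [x0 _|]; last by rewrite ltxx.
case: ifP => [y0 _|]; last by rewrite ltxx.
have l1' : 0 < 1 - l by rewrite subr_gt0.
have z0 : 0 < l *: x + (1 - l) *: y by rewrite /GRing.scale/= addr_gt0// mulr_gt0.
rewrite z0 !lnXn// !mulrnAr -mulrnDl -mulr_natr expRM_natr.
apply: lerXn2r; [by rewrite nnegrE expR_ge0|by rewrite nnegrE ltW|].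
apply: le_trans (amgm_expR _ _ _) _; first by rewrite !ltW.
by rewrite !lnK.
Qed.

Lemma halfpow_add k t : (0 < k)%N -> ~~ odd k -> halfpow k t + halfpow k (- t) = t ^+ k.
Proof.
move=> k0 ek; rewrite /halfpow oppr_gt0; case: ltrgtP => // [t0|t0|<-].
- by rewrite addr0.
- by rewrite add0r exprNn -signr_odd (negbTE ek) expr0 mul1r.
- by rewrite addr0 expr0n; case: k k0 {ek}.
Qed.

Variables (n m : nat) (B : 'M[R]_(n, m)) (e : R).
Let T (i : 'I_n) (y : 'rV[R]_m) := dot (row i B) y.
Hypotheses (e0 : 0 < e) (Be : forall y, e * sqn y <= \sum_i T i y ^+ 2).

Let S := B^T *m B.

(* When the rows of [B^T] are a basis of the kernel of [A], this is the [c_i ^ 2]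
   of the paper. *)
Definition leverage (i : 'I_n) : R := (row i B *m invmx S *m (row i B)^T) 0 0.

Lemma qform_gram y : qform S y = \sum_i T i y ^+ 2.
Proof.
have -> : qform S y = ((y *m B^T) *m (y *m B^T)^T) 0 0.
  by rewrite trmx_mul trmxK /qform /S !mulmxA.
rewrite mxE; apply: eq_bigr => i _; rewrite [X in _ * X]mxE -expr2; congr (_ ^+ 2).
by rewrite mxE; apply: eq_bigr => j _; rewrite !mxE mulrC.
Qed.

Lemma qform_rank1 (b y : 'rV[R]_m) : qform (b^T *m b) y = dot b y ^+ 2.
Proof.
rewrite /qform mulmxA -mulmxA mxE big_ord1 expr2; congr (_ * _).
  by rewrite mxE; apply: eq_bigr => j _; rewrite mxE mulrC.
by rewrite mxE; apply: eq_bigr => j _; rewrite mxE.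
Qed.

Lemma qformD (P Q : 'M[R]_m) y : qform (P + Q) y = qform P y + qform Q y.
Proof. by rewrite /qform mulmxDr mulmxDl mxE. Qed.

Lemma qformZ c (P : 'M[R]_m) y : qform (c *: P) y = c * qform P y.
Proof. by rewrite /qform -scalemxAr -scalemxAl mxE. Qed.

Lemma sqn_gt0 (y : 'rV[R]_m) : y != 0 -> 0 < sqn y.
Proof.
move=> y0; rewrite lt0r sumr_ge0 ?andbT => [|i _]; last exact: sqr_ge0.
apply: contra y0; rewrite psumr_eq0 => [/allP h|i _]; last exact: sqr_ge0.
apply/eqP/rowP => i; rewrite mxE; apply/eqP.
by have := h i (mem_index_enum _); rewrite sqrf_eq0.
Qed.

Lemma gram_posdef : posdef S.
Proof.
split; first by rewrite /S trmx_mul trmxK.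
move=> y y0; rewrite qform_gram; apply: lt_le_trans (Be y).
by rewrite mulr_gt0// sqn_gt0.
Qed.

(** A negative [d] is allowed: only the square of [T i] loses weight, and its coefficient is at
    least [c + d]. *)
Lemma pert_posdef c d i : 0 < c -> 0 < c + d ->
  posdef (c *: S + d *: ((row i B)^T *m row i B)).
Proof.
move=> c0 cd0; have [tS pS] := gram_posdef; split.
  by rewrite linearD/= !linearZ/= tS trmx_mul trmxK.
move=> y y0; rewrite qformD !qformZ qform_rank1 qform_gram.
have := pS _ y0; rewrite qform_gram (bigD1 i)//= -/(T i y).
have : 0 <= \sum_(j | j != i) T j y ^+ 2 by apply: sumr_ge0 => j _; exact: sqr_ge0.
have := sqr_ge0 (T i y).
move: (\sum_(j | j != i) _) (T i y ^+ 2) => X Y Y0 X0 XY.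
have [Y1|Y1] := ltP 0 Y.
  have := mulr_ge0 (ltW c0) X0; have := mulr_gt0 cd0 Y1; nra.
have -> : Y = 0 by apply/eqP; rewrite eq_le Y0 Y1.
by rewrite mulr0 addr0 add0r mulr_gt0//; lra.
Qed.

Variables (c : R).
Hypothesis c0 : 0 < c.

Let N y := \prod_i expR (- (pi * c * T i y ^+ 2)).

Let NE y : N y = expR (- (pi * qform (c *: S) y)).
Proof.
rewrite /N expR_prod; congr expR.
by rewrite qformZ qform_gram sumrN mulrA mulr_sumr.
Qed.

Let Z := (Num.sqrt (\det (c *: S)))^-1.

Let pc0 : 0 < pi * c. Proof. by rewrite mulr_gt0// pi_gt0. Qed.

Let D i := leverage i / c.

Lemma leverage_ge0 i : 0 <= leverage i.
Proof.
have [tS pS] := gram_posdef; have uS := posdef_unit gram_posdef.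
rewrite /leverage; set b := row i B.
have -> : (b *m invmx S *m b^T) 0 0 = qform S (b *m invmx S).
  by rewrite /qform trmx_mul trmx_inv tS mulmxKV// !mulmxA.
have [->|h] := eqVneq (b *m invmx S) 0; first by rewrite /qform !mul0mx mxE.
by rewrite ltW// pS.
Qed.

Let D0 i : 0 <= D i. Proof. by rewrite divr_ge0 ?leverage_ge0// ltW. Qed.

(** The leverages are the diagonal entries of the orthogonal projection onto the column space of
    [B], whose trace is [m]. *)
Lemma sum_leverage : \sum_i leverage i = m%:R.
Proof.
have uS := posdef_unit gram_posdef.
transitivity (\tr (B *m invmx S *m B^T)).
  apply: eq_bigr => i _; rewrite /leverage !mxE; apply: eq_bigr => j _.
  rewrite !mxE; congr (_ * _); apply: eq_bigr => k _; by rewrite !mxE.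
by rewrite -mulmxA mxtrace_mulC -mulmxA mulVmx// mxtrace1.
Qed.

Let lcd_weight i (f : R -> R) : logconcave (f : R^o -> R) ->
  (exists2 C, 0 <= C & forall t, f t <= C * expR (pi * c / 2 * t ^+ 2)) ->
  lcd (fun y => f (T i y) * N y).
Proof.
move=> hf [C C0 fC].
pose g j t := expR (- (pi * c * t ^+ 2)) * (if j == i then f t else 1).
have -> : (fun y => f (T i y) * N y) = fun y => \prod_j g j (T j y).
  apply/funext => y; rewrite /g big_split/= mulrC; congr (_ * _).
  rewrite (bigD1 i)//= eqxx big1 ?mulr1// => j /negbTE -> //.
apply: (lcd_prod e0 Be (r := pi * c / 2)); first by rewrite divr_gt0.
  move=> j; apply: logconcave_mul; first by apply: logconcave_gauss; exact: ltW.
  by case: (j == i) => //; exact: logconcave_cst.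
move=> j; rewrite /g; case: (j == i).
  exists C => // t; rewrite mulrC; apply: (@le_trans _ _ (C * expR (pi * c / 2 * t ^+ 2) * expR (- (pi * c * t ^+ 2)))).
    by rewrite ler_wpM2r ?expR_ge0.
  by rewrite -mulrA -expRD ler_wpM2l// ler_expR; lra.
exists 1 => // t; rewrite mul1r mulr1 ler_expR.
have : 0 <= pi * c * t ^+ 2 by rewrite mulr_ge0 ?sqr_ge0// ltW.
lra.
Qed.

Let lcd_N : lcd N.
Proof.
apply: (lcd_prod e0 Be (f := fun=> fun t => expR (- (pi * c * t ^+ 2))) pc0).
  by move=> i; apply: logconcave_gauss; exact: ltW.
by move=> i; exists 1 => // t; rewrite mul1r mulNr.
Qed.

Let itint_N : itint N = Z.
Proof.
have p : posdef (c *: S).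
  have [tS pS] := gram_posdef; split; first by rewrite linearZ/= tS.
  by move=> y y0; rewrite qformZ mulr_gt0// pS.
have h := (gauss_itint 0 p).2 1; rewrite mul1r in h.
rewrite /Z -h; congr itint; apply/funext => y.
by rewrite mul1r subr0 NE.
Qed.

Let Z0 : 0 < Z.
Proof.
have [tS pS] := gram_posdef; rewrite invr_gt0 sqrtr_gt0.
have p : posdef (c *: S).
  by split=> [|y y0]; [rewrite linearZ/= tS|rewrite qformZ mulr_gt0// pS].
exact: (gauss_itint 0 p).1.
Qed.

(* The moments of [T i] under the Gaussian weight come from perturbing one
   coefficient of the quadratic form, i.e. from a rank one update of the determinant. *)
Let itint_pert i d : 0 < c + d ->
  [/\ good (fun y => expR (- (pi * d * T i y ^+ 2)) * N y), 0 < 1 + d * D i &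
  itint (fun y => expR (- (pi * d * T i y ^+ 2)) * N y) = Z / Num.sqrt (1 + d * D i)].
Proof.
move=> cd0.
have p := pert_posdef i c0 cd0.
have us := posdef_unit gram_posdef.
have uc : c *: S \in unitmx by rewrite unitmxZ// unitfE gt_eqF.
have dE : \det (c *: S + d *: ((row i B)^T *m row i B)) = \det (c *: S) * (1 + d * D i).
  rewrite det_rank1//; congr (_ * (1 + _ * _)).
  by rewrite /D /leverage invmxZ// -scalemxAr -scalemxAl mxE mulrC.
have [d0 dI] := gauss_itint 0 p.
have dc : 0 < \det (c *: S) by move: Z0; rewrite invr_gt0 sqrtr_gt0.
have d1 : 0 < 1 + d * D i by move: d0; rewrite dE pmulr_rgt0.
have E : (fun y => expR (- (pi * d * T i y ^+ 2)) * N y) =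
    (fun y => 1 * expR (- (pi * qform (c *: S + d *: ((row i B)^T *m row i B)) (y - 0)))).
  apply/funext => y; rewrite subr0 mul1r qformD [qform (d *: _) _]qformZ qform_rank1 -/(T i y).
  by rewrite mulrDr opprD expRD mulrC NE mulrA.
split=> //.
  pose a j := if j == i then pi * (c + d) else pi * c.
  have -> : (fun y => expR (- (pi * d * T i y ^+ 2)) * N y) =
      fun y => \prod_j expR (- (a j * T j y ^+ 2)).
    apply/funext => y; rewrite /N (bigD1 i)//= [RHS](bigD1 i)//= mulrA -expRD /a eqxx.
    congr (expR _ * _); first by ring.
    by apply: eq_bigr => j /negbTE ->.
  apply: lcd_good; apply: (lcd_prod e0 Be (f := fun j t => expR (- (a j * t ^+ 2))) (r := Num.min (pi * (c + d)) (pi * c))).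
  - by rewrite lt_min pc0 mulr_gt0// pi_gt0.
  - move=> j; apply: logconcave_gauss; rewrite /a; case: ifP => _; last exact: ltW.
    by rewrite mulr_ge0 ?ltW// pi_gt0.
  move=> j; exists 1 => // t; rewrite mul1r ler_expR mulNr lerN2 ler_wpM2r ?sqr_ge0//.
  by rewrite /a; case: ifP => _; rewrite ge_min lexx ?orbT.
by rewrite E dI dE sqrtrM ?ltW// mul1r invfM.
Qed.

Let good_pow i k : (0 < k)%N -> ~~ odd k -> good (fun y => T i y ^+ k * N y).
Proof.
move=> k0 ek.
have [j kj] : exists j, k = j.+1.*2.
  by exists k./2.-1; rewrite prednK ?half_gt0//; [rewrite even_halfK|case: k k0 ek => [|[|]]].
have a0 : 0 < pi * c / 2 by rewrite divr_gt0.
(* From x^(j+1)/(j+1)! <= exp x at x = (pi c/2) t^2, which leaves half of the Gaussian for decay. *)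
pose C : R := j.+1`!%:R / (pi * c / 2) ^+ j.+1.
have C0 : 0 <= C by rewrite divr_ge0 ?exprn_ge0// ltW.
have bd t : halfpow k t <= C * expR (pi * c / 2 * t ^+ 2).
  rewrite /halfpow; case: ifP => t0; last by rewrite mulr_ge0 ?expR_ge0.
  have x0 : 0 <= pi * c / 2 * t ^+ 2 by rewrite mulr_ge0 ?sqr_ge0// ltW.
  have h := expR_ge1Dxn j x0.
  apply: (@le_trans _ _ (C * ((pi * c / 2 * t ^+ 2) ^+ j.+1 / j.+1`!%:R))).
    have Ea (a : R) : (a * t ^+ 2) ^+ j.+1 = a ^+ j.+1 * t ^+ k.
      by rewrite exprMn -exprM mul2n kj.
    have Cinv (F A X : R) : F != 0 -> A != 0 -> X = F / A * (A * X / F).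
      by move=> F0 A0; field; rewrite F0 A0.
    rewrite Ea /C -Cinv// ?expf_neq0 ?gt_eqF// ltr0n; exact: fact_gt0.
  by rewrite ler_wpM2l// (le_trans _ h)// lerDr.
have hp s : logconcave (fun t : R^o => halfpow k (s * t)).
  apply: (logconcave_affine (halfpow_logconcave k)) => x y l.
  by rewrite /GRing.scale/=; ring.
have E : (fun y => T i y ^+ k * N y) =
    (fun y => halfpow k (1 * T i y) * N y + halfpow k (-1 * T i y) * N y).
  by apply/funext => y; rewrite -mulrDl mul1r mulN1r halfpow_add.
have gs s : s ^+ 2 = 1 -> good (fun y => halfpow k (s * T i y) * N y).
  move=> s2; apply/lcd_good/(@lcd_weight i (fun t => halfpow k (s * t))); first exact: hp.
  by exists C => // t; have := bd (s * t); rewrite exprMn s2 mul1r.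
by rewrite E; apply: good_add; apply: gs; rewrite ?sqrrN expr1n.
Qed.

Let M k i := itint (fun y => T i y ^+ k * N y).

Let M_ge0 k i : (0 < k)%N -> ~~ odd k -> 0 <= M k i.
Proof. by move=> k0 ek; apply: itint_ge0; exact: good_pow. Qed.

(** Integrate 1 + x + x^2/2 <= exp x at x = pi d T_i^2; the right side is the Gaussian integral with
    the form perturbed by -d. *)
Let moment_ub i d : 0 < d -> d < c ->
  Z + pi * d * M 2 i + (pi * d) ^+ 2 / 2 * M 4 i <= Z / Num.sqrt (1 - d * D i).
Proof.
move=> d0 dc; have [g1 _ <-] : [/\ good (fun y => expR (- (pi * - d * T i y ^+ 2)) * N y), 0 < 1 + - d * D i &
  itint (fun y => expR (- (pi * - d * T i y ^+ 2)) * N y) = Z / Num.sqrt (1 - d * D i)].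
  by have [] := @itint_pert i (- d); [lra|move=> g h1 h2; split => //; rewrite h2 mulNr].
have pd0 : 0 <= pi * d by rewrite mulr_ge0 ?ltW// pi_gt0.
have gN := lcd_good lcd_N.
have g2 := good_scale pd0 (good_pow i (isT : 0 < 2)%N isT).
have pd20 : 0 <= (pi * d) ^+ 2 / 2 by rewrite divr_ge0// sqr_ge0.
have g4 := good_scale pd20 (good_pow i (isT : 0 < 4)%N isT).
rewrite -itint_N /M -itintZ; last exact: good_pow.
rewrite -[_ / 2 * itint _]itintZ; last exact: good_pow.
rewrite -(itintD gN g2) -(itintD (good_add gN g2) g4).
apply: itint_mono => //; first by apply: good_add => //; exact: good_add.
move=> y.
have -> : N y + pi * d * (T i y ^+ 2 * N y) + (pi * d) ^+ 2 / 2 * (T i y ^+ 4 * N y) =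
  (1 + pi * d * T i y ^+ 2 + (pi * d) ^+ 2 / 2 * T i y ^+ 4) * N y by ring.
rewrite ler_wpM2r//; first exact: lcd_N.1.1.
have x0 : 0 <= pi * d * T i y ^+ 2 by rewrite mulr_ge0// sqr_ge0.
have -> : - (pi * - d * T i y ^+ 2) = pi * d * T i y ^+ 2 by ring.
apply: le_trans (expR_ge_taylor2 x0); rewrite le_eqVlt; apply/orP; left; apply/eqP.
by field.
Qed.

Let moment_lb i d : 0 < d -> Z <= Z / Num.sqrt (1 + d * D i) + pi * d * M 2 i.
Proof.
move=> d0; have [g1 _ <-] := @itint_pert i d (addr_gt0 c0 d0).
have pd0 : 0 <= pi * d by rewrite mulr_ge0 ?ltW// pi_gt0.
have gN := lcd_good lcd_N.
have g2 := good_scale pd0 (good_pow i (isT : 0 < 2)%N isT).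
rewrite -{1}itint_N /M -itintZ; last exact: good_pow.
rewrite -(itintD g1 g2); apply: itint_mono => //; first exact: good_add.
move=> y.
have -> : expR (- (pi * d * T i y ^+ 2)) * N y + pi * d * (T i y ^+ 2 * N y) =
  (expR (- (pi * d * T i y ^+ 2)) + pi * d * T i y ^+ 2) * N y by ring.
rewrite -{1}[N y]mul1r ler_wpM2r//.
  exact: lcd_N.1.1.
by have := expR_ge1Dx (- (pi * d * T i y ^+ 2)); lra.
Qed.

Let small i : exists2 d0, 0 < d0 < c & forall d, 0 < d -> d <= d0 -> 0 <= d * D i <= 1 / 2.
Proof.
have p : 0 < D i + 1 by rewrite ltr_wpDl.
have c2 : 0 < c / 2 by rewrite divr_gt0.
have q : 0 < 1 / 2 / (D i + 1) by rewrite divr_gt0// divr_gt0.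
exists (Num.min (c / 2) (1 / 2 / (D i + 1))).
  by apply/andP; split; [rewrite lt_min c2 q|rewrite gt_min; apply/orP; left; have := c0; lra].
move=> d d0; rewrite le_min => /andP[_ h]; apply/andP; split; first by rewrite mulr_ge0// ltW.
by move: h; rewrite ler_pdivlMr// mulrDr mulr1; lra.
Qed.

Let Z_ge0 : 0 <= Z. Proof. exact: ltW. Qed.

Let moment2_upper_field (p d z x : R) : p != 0 ->
  p * d * (z * (x / (2 * p)) + z / p * x ^+ 2 * d) = z * (d * x / 2 + (d * x) ^+ 2).
Proof. by move=> p0; field. Qed.

Let moment2_lower_field (p d z x M2 : R) : p != 0 ->
  p * d * (M2 + 3 / 8 * z / p * x ^+ 2 * d) = p * d * M2 + z * (3 / 8 * (d * x) ^+ 2).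
Proof. by move=> p0; field. Qed.

Let scaled_moment2_field (p d z x : R) : p != 0 -> p * d * (z * (x / (2 * p))) = z * (d * x / 2).
Proof. by move=> p0; field. Qed.

Let moment4_upper_field (p d z x : R) : p != 0 ->
  (p * d) ^+ 2 / 2 * (z * (3 * (x / (2 * p)) ^+ 2) + 2 * z / p ^+ 2 * x ^+ 3 * d) =
  z * (3 / 8 * (d * x) ^+ 2 + (d * x) ^+ 3).
Proof. by move=> p0; field. Qed.

Let quartic_weight_field (p x : R) : p != 0 -> 1 / 2 * (24 / p ^+ 2 * x ^+ 2) = 12 / p ^+ 2 * x ^+ 2.
Proof. by move=> p0; field. Qed.

Let gauss_weight_field (p z x : R) : p != 0 -> p * (z * (x / (2 * p))) = x / 2 * z.
Proof. by move=> p0; field. Qed.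

Let quartic_moment_field (p z x : R) : p != 0 ->
  12 / p ^+ 2 * x ^+ 2 * z = 16 * (z * (3 * (x / (2 * p)) ^+ 2)).
Proof. by move=> p0; field. Qed.

Let trace_moment_field (p a z x : R) : p != 0 -> a != 0 -> p * a * (z * (x / a / (2 * p))) = z * (x / 2).
Proof. by move=> p0 a0; field; rewrite p0 a0. Qed.

(** The two perturbation inequalities agree to first order in [d]; dividing by pi d and letting [d]
    tend to 0 replaces differentiation under the integral. *)
Lemma moment2 i : M 2 i = Z * (D i / (2 * pi)).
Proof.
have [d0 /andP[d00 d0c] sm] := small i.
have p0 := @pi_gt0 R; have pn0 : pi != 0 :> R by rewrite gt_eqF.
have DD := D0 i.
apply/eqP; rewrite eq_le; apply/andP; split.
  apply: (@le_of_le_addeps _ _ _ (Z / pi * D i ^+ 2) d0) => //.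
    by rewrite mulr_ge0 ?sqr_ge0// divr_ge0// ltW.
  move=> d dp dd0; have /andP[x0 x1] := sm d dp dd0.
  have h := moment_ub i dp (le_lt_trans dd0 d0c).
  have h2 : 0 <= (pi * d) ^+ 2 / 2 * M 4 i by rewrite mulr_ge0 ?divr_ge0 ?sqr_ge0 ?M_ge0.
  have h3 : Z / Num.sqrt (1 - d * D i) <= Z * (1 + d * D i / 2 + 3 / 8 * (d * D i) ^+ 2 + (d * D i) ^+ 3).
    by apply: ler_wpM2l => //; apply: inv_sqrt_ub_minus; rewrite x0 x1.
  have h4 : Z * (1 + d * D i / 2 + 3 / 8 * (d * D i) ^+ 2 + (d * D i) ^+ 3) <= Z * (1 + d * D i / 2 + (d * D i) ^+ 2).
    apply: ler_wpM2l => //; rewrite -addrA lerD2l.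
    move: x0 x1; set x := d * D i => x0 x1; have := sqr_ge0 x; rewrite exprS; nra.
  have h5 : pi * d * M 2 i <= pi * d * (Z * (D i / (2 * pi)) + Z / pi * D i ^+ 2 * d).
    have -> : pi * d * (Z * (D i / (2 * pi)) + Z / pi * D i ^+ 2 * d) =
      Z * (d * D i / 2 + (d * D i) ^+ 2) by exact: moment2_upper_field.
    lra.
  by move: h5; rewrite ler_pM2l// mulr_gt0.
apply: (@le_of_le_addeps _ _ _ (3 / 8 * Z / pi * D i ^+ 2) d0) => //.
  by rewrite mulr_ge0 ?sqr_ge0// divr_ge0// ?ltW// mulr_gt0.
move=> d dp dd0; have /andP[x0 x1] := sm d dp dd0.
have h := moment_lb i dp.
have h3 : Z / Num.sqrt (1 + d * D i) <= Z * (1 - d * D i / 2 + 3 / 8 * (d * D i) ^+ 2).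
  by apply: ler_wpM2l => //; exact: inv_sqrt_ub_plus.
have h5 : pi * d * (Z * (D i / (2 * pi))) <= pi * d * (M 2 i + 3 / 8 * Z / pi * D i ^+ 2 * d).
  have -> : pi * d * (M 2 i + 3 / 8 * Z / pi * D i ^+ 2 * d) =
    pi * d * M 2 i + Z * (3 / 8 * (d * D i) ^+ 2) by exact: moment2_lower_field.
  have -> : pi * d * (Z * (D i / (2 * pi))) = Z * (d * D i / 2) by exact: scaled_moment2_field.
  lra.
by move: h5; rewrite ler_pM2l// mulr_gt0.
Qed.

(** With the exact second moment the first-order terms of [moment_ub] cancel and the coefficient of
    d^2 remains. An upper bound suffices, since the quartic weight has this moment with a negative
    sign in its exponent. *)
Lemma moment4 i : M 4 i <= Z * (3 * (D i / (2 * pi)) ^+ 2).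
Proof.
have [d0 /andP[d00 d0c] sm] := small i.
have p0 := @pi_gt0 R; have pn0 : pi != 0 :> R by rewrite gt_eqF.
have DD := D0 i.
apply: (@le_of_le_addeps _ _ _ (2 * Z / pi ^+ 2 * D i ^+ 3) d0) => //.
  by rewrite mulr_ge0 ?exprn_ge0// divr_ge0 ?sqr_ge0// mulr_ge0// ltW.
move=> d dp dd0; have /andP[x0 x1] := sm d dp dd0.
have h := moment_ub i dp (le_lt_trans dd0 d0c).
have h3 : Z / Num.sqrt (1 - d * D i) <= Z * (1 + d * D i / 2 + 3 / 8 * (d * D i) ^+ 2 + (d * D i) ^+ 3).
  by apply: ler_wpM2l => //; apply: inv_sqrt_ub_minus; rewrite x0 x1.
rewrite moment2 in h.
have E : pi * d * (Z * (D i / (2 * pi))) = Z * (d * D i / 2) by exact: scaled_moment2_field.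
rewrite E in h.
have h5 : (pi * d) ^+ 2 / 2 * M 4 i <= (pi * d) ^+ 2 / 2 * (Z * (3 * (D i / (2 * pi)) ^+ 2) + 2 * Z / pi ^+ 2 * D i ^+ 3 * d).
  have -> : (pi * d) ^+ 2 / 2 * (Z * (3 * (D i / (2 * pi)) ^+ 2) + 2 * Z / pi ^+ 2 * D i ^+ 3 * d) =
    Z * (3 / 8 * (d * D i) ^+ 2 + (d * D i) ^+ 3) by exact: moment4_upper_field.
  lra.
by move: h5; rewrite ler_pM2l// divr_gt0// exprn_gt0// mulr_gt0.
Qed.

(** Under the density N/Z the mean of pi T_i^2 is x_i/2, that of 16 T_i^4 is at most 16 * 3 (x_i/(2
    pi))^2 = (12/pi^2) x_i^2, and that of the exponent of the Gaussian itself is m/2. The statement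
    has the factor 1/2 taken out. *)
Theorem box_volume (P : pred 'I_n) :
  expR (1 / 2 * (m%:R - \sum_i (if P i then leverage i / c
     else 24 / pi ^+ 2 * (leverage i / c) ^+ 2))) / Num.sqrt (\det (c *: S)) <=
  itint (fun y => \prod_i box 1 (T i y)).
Proof.
have p0 := @pi_gt0 R; have pn0 : pi != 0 :> R by rewrite gt_eqF.
pose W i t := if P i then pi * t ^+ 2 else 16 * t ^+ 4 : R.
pose g i t := expR (- W i t).
have hg i : swappable (g i).
  rewrite /g /W; case: (P i); [exact: swappable_gauss|exact: swappable_quartic].
apply: le_trans (itint_prod_swap e0 Be hg).
pose K i := if P i then D i / 2 else 12 / pi ^+ 2 * D i ^+ 2.
pose kappa := \sum_i K i - m%:R / 2.
have K0 i : 0 <= K i.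
  rewrite /K; case: (P i); first by rewrite divr_ge0.
  by rewrite mulr_ge0 ?sqr_ge0// divr_ge0 ?sqr_ge0.
have sK0 : 0 <= \sum_i K i by apply: sumr_ge0.
have -> : 1 / 2 * (m%:R - \sum_i (if P i then leverage i / c
     else 24 / pi ^+ 2 * (leverage i / c) ^+ 2)) = - kappa.
  rewrite /kappa opprB mulrBr mulr_sumr; congr (_ - _); first by rewrite mul1r mulrC.
  apply: eq_bigr => i _; rewrite /K -/(D i); case: (P i); first by rewrite mul1r mulrC.
  exact: quartic_weight_field.
rewrite -/Z.
have lg : lcd (fun y => \prod_i g i (T i y)).
  apply: (lcd_prod e0 Be ltr01) => i; first by case: (hg i).
  exact: swappable_subgauss.
have gg := lcd_good lg.
have gN := lcd_good lcd_N.
have ek0 := expR_ge0 (- kappa).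
have gW i : good (fun y => W i (T i y) * N y) /\ itint (fun y => W i (T i y) * N y) <= K i * Z.
  rewrite /W /K; case: (P i).
    rewrite (_ : (fun y => _) = fun y => pi * (T i y ^+ 2 * N y)); last first.
      by apply/funext => y; rewrite mulrA.
    have g2 := good_pow i (isT : 0 < 2)%N isT.
    split; first by apply: good_scale => //; exact: ltW.
    rewrite itintZ// -/(M 2 i) moment2 le_eqVlt; apply/orP; left; apply/eqP.
    exact: gauss_weight_field.
  rewrite (_ : (fun y => _) = fun y => 16 * (T i y ^+ 4 * N y)); last first.
    by apply/funext => y; rewrite mulrA.
  have g4 := good_pow i (isT : 0 < 4)%N isT.
  split; first by apply: good_scale.
  rewrite itintZ// -/(M 4 i).
  have -> : 12 / pi ^+ 2 * D i ^+ 2 * Z = 16 * (Z * (3 * (D i / (2 * pi)) ^+ 2)).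
    exact: quartic_moment_field.
  by rewrite ler_wpM2l// moment4.
have [gsW eW] := itint_sum (fun i => (gW i).1).
have pc0' : 0 <= pi * c by exact: ltW.
have gQi i := good_scale pc0' (good_pow i (isT : 0 < 2)%N isT).
have [gsQ eQ] := itint_sum gQi.
have IQ : itint (fun y => \sum_i pi * c * (T i y ^+ 2 * N y)) = Z * (m%:R / 2).
  rewrite eQ -sum_leverage mulr_suml mulr_sumr; apply: eq_bigr => i _.
  rewrite itintZ; last exact: good_pow.
  rewrite -/(M 2 i) moment2 /D.
  have cn0 : c != 0 by rewrite gt_eqF.
  exact: trace_moment_field.
have IW : itint (fun y => \sum_i W i (T i y) * N y) <= Z * \sum_i K i.
  by rewrite eW mulr_sumr; apply: ler_sum => i _; rewrite mulrC; exact: (gW i).2.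
(* [good] admits nonnegative functions only, so the negative terms of 1 + (kappa - w + Q) go to the
   other side; what remains is [q] and Q. *)
pose q := 1 + \sum_i K i.
have q0 : 0 <= q by rewrite addr_ge0.
have h1 : good (fun y => expR (- kappa) * ((\sum_i W i (T i y) * N y) + m%:R / 2 * N y)).
  by apply: good_scale => //; apply: good_add => //; apply: good_scale => //; rewrite divr_ge0.
have h2 : good (fun y => expR (- kappa) * (q * N y + \sum_i pi * c * (T i y ^+ 2 * N y))).
  by apply: good_scale => //; apply: good_add => //; exact: good_scale.
(* Jensen's inequality for the density [N / Z], in the form of the tangent line
   inequality [expR x >= 1 + x], which needs no measure on ['rV_m]. *)
have main : itint (fun y => expR (- kappa) * (q * N y + \sum_i pi * c * (T i y ^+ 2 * N y))) <=
    itint (fun y => \prod_i g i (T i y) +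
      expR (- kappa) * ((\sum_i W i (T i y) * N y) + m%:R / 2 * N y)).
  apply: itint_mono => //; first exact: good_add.
  move=> y; pose w := \sum_i W i (T i y); pose Q := \sum_i pi * c * T i y ^+ 2.
  have -> : \prod_i g i (T i y) = expR (- w) by rewrite expR_prod sumrN.
  have NQ : N y = expR (- Q) by rewrite /N expR_prod sumrN.
  rewrite -mulr_suml -/w.
  have -> : \sum_i pi * c * (T i y ^+ 2 * N y) = Q * N y.
    by rewrite mulr_suml; apply: eq_bigr => i _; rewrite mulrA.
  have : expR (- kappa) * N y * (1 + (kappa - w + Q)) <= expR (- w).
    have -> : expR (- w) = expR (- kappa) * N y * expR (kappa - w + Q).
      by rewrite NQ -!expRD; congr expR; ring.
    by rewrite ler_wpM2l ?expR_ge1Dx// mulr_ge0// NQ expR_ge0.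
  rewrite -lerBlDr => h; apply: le_trans h; rewrite le_eqVlt; apply/orP; left; apply/eqP.
  by rewrite /q /kappa; ring.
have m20 : 0 <= m%:R / 2 :> R by rewrite divr_ge0.
have gmN := good_scale m20 gN; have gqN := good_scale q0 gN.
move: main; rewrite (itintD gg h1) (itintZ _ (good_add gqN gsQ)) (itintZ _ (good_add gsW gmN)).
rewrite (itintD gqN gsQ) (itintD gsW gmN) !(itintZ _ gN) IQ itint_N => main.
have h3 := ler_wpM2l ek0 IW.
have E : expR (- kappa) * (q * Z + Z * (m%:R / 2)) =
  expR (- kappa) * Z + expR (- kappa) * (Z * \sum_i K i) + expR (- kappa) * (m%:R / 2 * Z).
  by rewrite /q; ring.
rewrite E [X in _ <= _ + X]mulrDr in main.
lra.
Qed.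

End Moments.

(** * Counting lattice points *)

Section Cube.
Context {R : realType}.
Notation mu := (@lebesgue_measure R).

(** Half open, so that every point lies in the unit cube at the vector of its floors. *)
Definition unitind (x t : R) : R := if x <= t < x + 1 then 1 else 0.

Lemma unitind_logconcave x : logconcave (unitind x : R^o -> R).
Proof.
split=> [t|s t l /andP[l0 l1]]; first by rewrite /unitind; case: ifP.
rewrite /unitind; case: ifP => [/andP[s1 s2] _|]; last by rewrite ltxx.
case: ifP => [/andP[t1 t2] _|]; last by rewrite ltxx.
rewrite ln1 !mulr0 addr0 expR0 ifT// /GRing.scale/=.
have h1 : 0 <= l * (s - x) by rewrite mulr_ge0 ?subr_ge0// ltW.
have h2 : 0 <= (1 - l) * (t - x) by rewrite mulr_ge0 ?subr_ge0// ltW.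
have h3 : 0 < l * (x + 1 - s) by rewrite mulr_gt0 ?subr_gt0.
have h4 : 0 < (1 - l) * (x + 1 - t) by rewrite mulr_gt0 ?subr_gt0.
apply/andP; split; lra.
Qed.

Lemma unitind_subgauss x : subgauss 1 (unitind x).
Proof.
exists (expR ((`|x| + 1) ^+ 2)) => [|t]; first exact: expR_ge0.
rewrite /unitind; case: ifP => [/andP[t1 t2]|_]; last by rewrite mulr_ge0 ?expR_ge0.
rewrite -expRD -[leLHS]expR0 ler_expR mulN1r subr_ge0.
have h : `|t| <= `|x| + 1 by rewrite ler_norml; have := ler_norm x; have := ler_norm (- x); rewrite normrN; lra.
by rewrite -[leLHS]real_normK ?num_real//; apply: lerXn2r; rewrite ?nnegrE ?addr_ge0.
Qed.

Lemma integral_unitind x : mu.-integrable setT (EFin \o unitind x) /\ \int[mu]_t unitind x t = 1.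
Proof.
have E : unitind x = \1_(`[x, x + 1[%classic).
  apply/funext => t; rewrite indicE /unitind; case: ifP => h.
    by rewrite mem_set//= in_itv.
  by rewrite memNset//= in_itv/= h.
rewrite E; split; first exact: integrable_indic_itv.
rewrite /Rintegral integral_indic// setIT.
have /= -> : mu `[x, x + 1[%classic = 1%E.
  by rewrite lebesgue_measure_itv/= lte_fin ltrDl ltr01 -EFinB addrAC subrr add0r.
by [].
Qed.

Definition cube m (x : 'rV[R]_m) (y : 'rV[R]_m) := \prod_i unitind (x 0 i) (y 0 i).

Lemma cube_lcd m (x : 'rV[R]_m) : lcd (cube x).
Proof.
have E y i : dot (row i (1%:M : 'M[R]_m)) y = y 0 i.
  rewrite /dot (bigD1 i)//= big1 ?addr0 => [|j ji]; rewrite !mxE.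
    by rewrite eqxx mul1r.
  by rewrite eq_sym (negbTE ji) mul0r.
rewrite (_ : cube x = fun y => \prod_i unitind (x 0 i) (dot (row i (1%:M : 'M[R]_m)) y)); last first.
  by apply/funext => y; apply: eq_bigr => i _; rewrite E.
apply: (@lcd_prod _ _ _ _ 1 ltr01 _ (fun i => unitind (x 0 i)) 1 ltr01).
- by move=> y; rewrite mul1r; apply: ler_sum => i _; rewrite E.
- by move=> i; exact: unitind_logconcave.
- by move=> i; exact: unitind_subgauss.
Qed.

Lemma itint_cube m (x : 'rV[R]_m) : itint (cube x) = 1.
Proof.
elim: m x => [|m IH] x; first by rewrite /= /cube big_ord0.
pose x' := \row_i x 0 (lift ord0 i).
have E t : (fun y => cube x (consr t y)) = (fun y => unitind (x 0 ord0) t * cube x' y).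
  apply/funext => y; rewrite /cube big_ord_recl consr_0; congr (_ * _).
  by apply: eq_bigr => i _; rewrite consr_lift mxE.
rewrite /=; have -> : (fun t => itint (fun y => cube x (consr t y))) = unitind (x 0 ord0).
  apply/funext => t; rewrite E itintZ ?IH ?mulr1//.
  exact/lcd_good/cube_lcd.
exact: (integral_unitind _).2.
Qed.

End Cube.

Section Count.
Context {R : realType}.
Variables (m n : nat) (P : 'M[int]_(m, n)).

Definition supnorm k (v : 'rV[int]_k) : nat := \max_i absz (v ord0 i).

Let B : 'M[R]_(n, m) := (map_mx intr P)^T.
Variable e : R.
Hypotheses (e0 : 0 < e) (Be : forall y, e * sqn y <= \sum_i dot (row i B) y ^+ 2).

Definition abssum : nat := (\sum_i \sum_j absz (P i j))%N.

Let vecof N (f : {ffun 'I_m -> 'I_N.+1}) : 'rV[int]_m := \row_i ((f i : nat)%:Z - (N./2)%:Z).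

Let floorv (y : 'rV[R]_m) : 'rV[int]_m := \row_i Num.floor (y 0 i).

(** A point of the dilated section is covered by the unit cube at its floor vector. Rounding moves
    each form by at most [abssum], so the floor vector satisfies the slightly weaker bound that
    defines [F]; each cube has volume 1. *)
Lemma count_box (t : nat) : (0 < t)%N ->
  exists F : seq 'rV[int]_m, [/\ uniq F,
    forall X, X \in F -> (2 * supnorm (X *m P) <= t + 2 * abssum)%N &
    itint (fun y => \prod_i box 1 (dot (row i (t%:R^-1 *: B)) y)) <= (size F)%:R].
Proof.
move=> t0.
have tp : 0 < t%:R :> R by rewrite ltr0n.
(* [Q] bounds [sqn y] on the section, so the coordinates are at most Q + 1 in absolute value; with
   this [N] their floors lie between -N/2 and N/2, the range of [vecof]. *)
pose Q : R := n%:R * (t%:R / 2) ^+ 2 / e.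
pose N := (2 * (Num.truncn Q).+2)%N.
pose F := [seq X <- undup [seq vecof f | f : {ffun 'I_m -> 'I_N.+1}] | (2 * supnorm (X *m P) <= t + 2 * abssum)%N].
exists F; split; first by rewrite filter_uniq// undup_uniq.
  by move=> X; rewrite mem_filter => /andP[].
have gc i : good (cube (map_mx intr (tnth (in_tuple F) i) : 'rV[R]_m)) by exact/lcd_good/cube_lcd.
have [gS eS] := itint_sum gc.
have -> : (size F)%:R = \sum_(i < size F) itint (cube (map_mx intr (tnth (in_tuple F) i) : 'rV[R]_m)).
  under eq_bigr do rewrite itint_cube.
  by rewrite sumr_const card_ord.
have dB i y : dot (row i (t%:R^-1 *: B)) y = t%:R^-1 * dot (row i B) y.
  by rewrite /dot mulr_sumr; apply: eq_bigr => j _; rewrite !mxE mulrA.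
rewrite -eS; apply: itint_mono => //.
  have e'0 : 0 < e / t%:R ^+ 2 by rewrite divr_gt0// exprn_gt0.
  apply: lcd_good.
  apply: (lcd_prod e'0 (b := fun i => row i (t%:R^-1 *: B)) _ (f := fun=> box 1) ltr01).
  - move=> y; under eq_bigr do rewrite dB exprMn.
    by rewrite -mulr_sumr mulrAC exprVn mulrC ler_wpM2l// invr_ge0 exprn_ge0// ltW.
  - by move=> _; exact: box_logconcave.
  - by move=> _; exact: box_subgauss.
move=> y.
have Sge0 : 0 <= \sum_(i < size F) cube (map_mx intr (tnth (in_tuple F) i) : 'rV[R]_m) y.
  by apply: sumr_ge0 => i _; exact: (cube_lcd _).1.1.
have [h|/existsNP[i hi]] := pselect (forall i, `|dot (row i (t%:R^-1 *: B)) y| <= 1 / 2); last first.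
  rewrite (bigD1 i)//= box_out ?mul0r//.
  by rewrite ltNge; apply/negP.
have hB i : `|dot (row i B) y| <= t%:R / 2.
  have := h i; rewrite dB normrM gtr0_norm ?invr_gt0// mulrC ler_pdivrMr//; lra.
have yb j : `|y 0 j| <= Q + 1.
  have h1 : e * sqn y <= n%:R * (t%:R / 2) ^+ 2.
    apply: le_trans (Be y) _.
    rewrite -[n in n%:R]card_ord -sum1_card natr_sum mulr_suml; apply: ler_sum => i _.
    rewrite mul1r -[leLHS]real_normK ?num_real//; apply: lerXn2r; rewrite ?nnegrE ?divr_ge0//.
  have h2 : y 0 j ^+ 2 <= sqn y.
    by rewrite /sqn (bigD1 j)//= lerDl; apply: sumr_ge0 => i _; exact: sqr_ge0.
  have h3 : sqn y <= Q by rewrite ler_pdivlMr// mulrC.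
  have := normr_ge0 (y 0 j); have : `|y 0 j| ^+ 2 <= Q by rewrite real_normK ?num_real//; lra.
  nra.
pose X := floorv y.
have Xin : X \in F.
  rewrite mem_filter; apply/andP; split.
    rewrite mul2n -geq_half_double; apply/bigmax_leqP => i _; rewrite geq_half_double -mul2n.
    rewrite -(ler_nat R) natrM natrD natrM.
    have -> : (absz ((X *m P) ord0 i))%:R = `|dot (row i B) (map_mx intr X)| :> R.
      rewrite -[_%:R]/((absz ((X *m P) ord0 i))%:~R) abszE intr_norm; congr `|_|.
      rewrite mxE rmorph_sum; apply: eq_bigr => j _.
      by rewrite !mxE rmorphM mulrC.
    have dd : `|dot (row i B) (map_mx intr X) - dot (row i B) y| <= abssum%:R.
      rewrite /dot -sumrB; apply: le_trans (ler_norm_sum _ _ _) _.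
      rewrite /abssum natr_sum; apply: ler_sum => j _.
      rewrite -mulrBr normrM !mxE.
      have fl : `|(Num.floor (y 0 j))%:~R - y 0 j| <= 1.
        have h1 := floor_le (y 0 j); have h2 := floorD1_gt (y 0 j).
        by rewrite intrD in h2; rewrite ler_norml; lra.
      apply: (@le_trans _ _ `|(P j i)%:~R|); first by rewrite ler_piMr.
      rewrite -intr_norm -abszE -[_%:~R]/(_%:R) ler_nat (bigD1 i)//=.
      exact: leq_addr.
    have := ler_normD (dot (row i B) (map_mx intr X) - dot (row i B) y) (dot (row i B) y).
    by rewrite subrK; have := hB i; lra.
  rewrite mem_undup; apply/mapP.
  have fb j : exists k : 'I_N.+1, (k : nat)%:Z - (N./2)%:Z = Num.floor (y 0 j).
    have Hb : - ((Num.truncn Q).+2)%:Z <= Num.floor (y 0 j) /\ Num.floor (y 0 j) <= ((Num.truncn Q).+2)%:Z.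
      have := yb j; rewrite ler_norml => /andP[y1 y2].
      have Qt := truncnS_gt Q; split.
        rewrite floor_ge_int rmorphN/=; apply: le_trans y1; rewrite lerN2.
        by rewrite -[_%:~R]/(_%:R) -[X in _ <= X]natr1; lra.
      have h1 := floor_le (y 0 j).
      rewrite -(ler_int R) (le_trans h1)// (le_trans y2)//.
      by rewrite -[_%:~R]/(_%:R) -[X in _ <= X]natr1; lra.
    have N2 : N./2 = (Num.truncn Q).+2 by rewrite /N mul2n doubleK.
    have kb : (absz (Num.floor (y 0 j) + (N./2)%:Z)%R < N.+1)%N.
      move: Hb; rewrite N2 /N; move: (Num.floor _) (Num.truncn _) => z k; lia.
    exists (Ordinal kb); move: Hb; rewrite [nat_of_ord _]/= N2.
    move: (Num.floor _) (Num.truncn _) => z k; lia.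
  pose f := [ffun j => sval (cid (fb j))].
  exists f; first by rewrite mem_enum.
  apply/rowP => j; rewrite !mxE ffunE; by case: (cid (fb j)) => k /= ->.
have [i Xi] : exists i : 'I_(size F), tnth (in_tuple F) i = X.
  by have /tnthP[i ->] : X \in in_tuple F by []; exists i.
rewrite (bigD1 i)//= -[leLHS]addr0; apply: lerD; last first.
  by apply: sumr_ge0 => j _; exact: (cube_lcd _).1.1.
rewrite Xi /cube [leRHS]big1 => [|j _].
  apply: (@le_trans _ _ (\prod_(i < n) (1 : R))); last by rewrite big1.
  by apply: ler_prod => j _; rewrite box_ge0 ?box_le1.
rewrite !mxE /unitind ifT// floor_le/=.
by rewrite -[X in _ < _ + X]/(1%:~R) -intrD; exact: floorD1_gt.
Qed.

End Count.

(** * Minkowski's second theorem as a counting inequality *)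

Section Minkowski.
(** [nu] is an integral seminorm, and [lam_min] is what is kept of the successive minima: a vector
    leaving the span of the first [j] coordinates has norm at least [lam j]. *)
Variables (m : nat) (nu : 'rV[int]_m -> nat) (lam : nat -> nat).
Hypotheses (nuD : forall X Y, (nu (X + Y)%R <= nu X + nu Y)%N)
  (nuZ : forall (a : int) X, nu (a *: X) = (absz a * nu X)%N)
  (lam_gt0 : forall i, (i < m)%N -> (0 < lam i)%N)
  (lam_mono : forall i, (i.+1 < m)%N -> (lam i <= lam i.+1)%N)
  (lam_min : forall (X : 'rV[int]_m) (j : 'I_m), X 0 j != 0 -> (lam j <= nu X)%N).

Let nu0 : nu 0 = 0%N.
Proof. by rewrite -(scale0r (0 : 'rV[int]_m)) nuZ. Qed.

Let nuN X : nu (- X) = nu X.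
Proof. by rewrite -scaleN1r nuZ mul1n. Qed.

Let nuB X Y : (nu (X - Y)%R <= nu X + nu Y)%N.
Proof. by rewrite -(nuN Y). Qed.

Let nu_sum N (a : 'I_N -> 'rV[int]_m) : (nu (\sum_i a i)%R <= \sum_i nu (a i))%N.
Proof.
elim/big_ind2: _ => [|x1 x2 y1 y2 h1 h2|//]; first by rewrite nu0.
by apply: leq_trans (nuD _ _) _; exact: leq_add.
Qed.

Let dl l := if l is l'.+1 then (lam l - lam l')%N else lam 0.

Let sum_dl i : (i < m)%N -> (\sum_(l < i.+1) dl l = lam i)%N.
Proof.
elim: i => [|i IH] im; first by rewrite big_ord1.
by rewrite big_ord_recr/= IH ?(ltnW im)// subnKC// lam_mono.
Qed.

(** Bounds [nu] on differences of two remainder vectors, independently of [M]. *)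
Let Cu : nat := (\sum_(j < m) lam j * nu (delta_mx ord0 j))%N.

Variables (M : nat) (F : seq 'rV[int]_m).
Hypotheses (M0 : (0 < M)%N) (uF : uniq F)
  (FM : forall X, X \in F -> (2 * nu X + Cu.+1 <= M)%N).

Let agree (l : nat) (X Y : 'rV[int]_m) := [forall i : 'I_m, (l <= i)%N ==> (Y 0 i == X 0 i)].

(* A vector of [F] that depends only on the coordinates of [X] from [l] on. *)
Let c l (X : 'rV[int]_m) := head X [seq Y <- F | agree l X Y].

Let agreeP l (X Y : 'rV[int]_m) : reflect (forall i : 'I_m, (l <= i)%N -> Y 0 i = X 0 i) (agree l X Y).
Proof.
by apply: (iffP forallP) => h i; [move=> li; apply/eqP; exact: (implyP (h i))|apply/implyP => li; apply/eqP; exact: h].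
Qed.

Let c_in l (X : 'rV[int]_m) : X \in F -> c l X \in F /\ agree l X (c l X).
Proof.
move=> XF; rewrite /c.
have : X \in [seq Y <- F | agree l X Y] by rewrite mem_filter XF andbT; apply/agreeP.
case E : [seq Y <- F | agree l X Y] => [//|Y s] _ /=.
have : Y \in [seq Y <- F | agree l X Y] by rewrite E mem_head.
by rewrite mem_filter => /andP[].
Qed.

Let c_eq l (X Y : 'rV[int]_m) : X \in F -> Y \in F -> agree l X Y -> c l X = c l Y.
Proof.
move=> XF YF /agreeP XY; rewrite /c.
have E : [seq Z <- F | agree l X Z] = [seq Z <- F | agree l Y Z].
  apply: eq_filter => Z; apply/agreeP/agreeP => h i li; rewrite h//; first by rewrite XY.
  by rewrite XY.
rewrite -E.
have : X \in [seq Z <- F | agree l X Z] by rewrite mem_filter XF andbT; apply/agreeP.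
by case: [seq Z <- F | agree l X Z].
Qed.

(* A lattice version of the compression of a body along the successive subspaces.
   Coordinate [i] is [lam i * X i + u i] plus a term in the coordinates of [X]
   beyond [i], so [Phi] is injective. If two values differ by [M z] and [j] is the
   last index with [z j != 0], then [X] and [X'] agree beyond [j], the difference
   has norm less than [M * lam j], and this contradicts [lam j <= nu z]. *)
Let Phi (X u : 'rV[int]_m) : 'rV[int]_m := \sum_(l < m) (dl l)%:Z *: c l X + u.

Let in_range (u : 'rV[int]_m) := forall i, 0 <= u 0 i < (lam i)%:Z.

Let Phi_coord (X u : 'rV[int]_m) (i : 'I_m) : X \in F ->
  Phi X u 0 i = (lam i)%:Z * X 0 i + u 0 i + \sum_(l < m | (i < l)%N) (dl l)%:Z * c l X 0 i.
Proof.
move=> XF; rewrite /Phi mxE summxE addrAC; congr (_ + _).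
rewrite (bigID (fun l : 'I_m => (i < l)%N))/= addrC; congr (_ + _); last first.
  by apply: eq_bigr => l _; rewrite mxE.
transitivity (\sum_(l < m | ~~ (i < l)%N) (dl l)%:Z * X 0 i).
  apply: eq_bigr => l; rewrite -leqNgt => li; rewrite mxE; congr (_ * _).
  by have /agreeP := (c_in l XF).2; apply.
rewrite -mulr_suml; congr (_ * _).
rewrite -(sum_dl (ltn_ord i)) (big_morph Posz PoszD (erefl _)).
rewrite (big_ord_widen_cond m (fun _ => true) (fun l => (dl l)%:Z) (ltn_ord i)).
by apply: eq_bigl => l /=; rewrite -leqNgt ltnS.
Qed.

(** Descending through the coordinates: once those beyond [i] agree, so do the terms of [Phi] that
    depend on them, and the rest is division with remainder by [lam i]. *)
Let down (X X' u u' : 'rV[int]_m) j : X \in F -> X' \in F -> in_range u -> in_range u' ->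
  (forall i : 'I_m, (j <= i)%N -> Phi X u 0 i = Phi X' u' 0 i) ->
  forall i : 'I_m, (j <= i)%N -> X 0 i = X' 0 i /\ u 0 i = u' 0 i.
Proof.
move=> XF X'F ru ru' PhiE i.
have [k] := ubnP (m - i); elim: k i => [//|k IH] i mik ji.
have E : \sum_(l < m | (i < l)%N) (dl l)%:Z * c l X 0 i =
    \sum_(l < m | (i < l)%N) (dl l)%:Z * c l X' 0 i.
  apply: eq_bigr => l il; rewrite (@c_eq l X X')//.
  apply/agreeP => i' li'; apply/esym; apply: (IH i' _ _).1.
    by have := ltn_ord i'; have := ltn_ord i; lia.
  by apply: leq_trans ji _; exact: ltnW (leq_trans il li').
have := PhiE i ji; rewrite !Phi_coord// E => /addIr.
have := ru i; have := ru' i; have := lam_gt0 (ltn_ord i).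
move: (X 0 i) (X' 0 i) (u 0 i) (u' 0 i) (lam i) => x x' v v' L L0 h h' e.
move/andP: h => [h1 h2]; move/andP: h' => [h3 h4].
have xx : x = x'.
  apply/eqP; rewrite eq_le; apply/andP; split.
    rewrite leNgt; apply/negP => lt.
    have : L%:Z * (x' + 1) <= L%:Z * x by rewrite ler_wpM2l//; lia.
    by rewrite mulrDr; lia.
  rewrite leNgt; apply/negP => lt.
  have : L%:Z * (x + 1) <= L%:Z * x' by rewrite ler_wpM2l//; lia.
  by rewrite mulrDr; lia.
by split => //; move: e; rewrite xx => /addrI.
Qed.

Let nu_range (w : 'rV[int]_m) : (forall i, absz (w ord0 i) <= lam i)%N -> (nu w <= Cu)%N.
Proof.
move=> h; rewrite (row_sum_delta w); apply: leq_trans (nu_sum _) _.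
apply: leq_sum => i _; rewrite nuZ; exact: leq_mul.
Qed.

Let Phi_inj (X X' u u' z : 'rV[int]_m) : X \in F -> X' \in F -> in_range u -> in_range u' ->
  Phi X u - Phi X' u' = M%:Z *: z -> X = X' /\ u = u'.
Proof.
move=> XF X'F ru ru' E.
have [z0|z0] := eqVneq z 0.
  have e : Phi X u = Phi X' u' by apply/eqP; rewrite -subr_eq0 E z0 scaler0.
  have h := @down X X' u u' 0 XF X'F ru ru' (fun i _ => congr1 (fun Z : 'rV[int]_m => Z 0 i) e).
  by split; apply/rowP => i; have [] := h i (leq0n _).
exfalso.
have [j0 zj0] : exists j : 'I_m, z 0 j != 0.
  apply/existsP; rewrite -negb_forall; apply: contra z0 => /forallP h.
  by apply/eqP/rowP => i; rewrite mxE; apply/eqP; have := h i.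
case: (@arg_maxnP _ j0 (fun j => z 0 j != 0) (fun j => j : nat) zj0) => j zj jmax.
have h := @down X X' u u' j.+1 XF X'F ru ru'.
have {}h (i : 'I_m) : (j < i)%N -> X 0 i = X' 0 i /\ u 0 i = u' 0 i.
  apply: h => {}i ji; apply/eqP; rewrite -subr_eq0.
  have := congr1 (fun Z : 'rV[int]_m => Z 0 i) E; rewrite !mxE => ->.
  rewrite mulf_eq0; apply/orP; right; apply/negPn/negP => zi.
  by have /= := jmax i zi; lia.
have cE l : (j < l)%N -> c l X = c l X'.
  move=> jl; apply: c_eq => //; apply/agreeP => i li.
  by apply/esym; have [] := h i (leq_trans jl li).
have lamj := lam_min zj.
(* The terms with l > j cancel, and each other difference has norm at most [M - Cu.+1] by the
   condition on [F]. The total is less than [M * lam j], because [Cu < lam j * Cu.+1]. *)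
have bd : (nu (M%:Z *: z) <= lam j * (M - Cu.+1) + Cu)%N.
  rewrite -E /Phi opprD addrACA; apply: leq_trans (nuD _ _) _; apply: leq_add; last first.
    apply: nu_range => i; rewrite !mxE; move: (ru i) (ru' i) => /andP[]; move: (u _ i) => a ? ? /andP[]; move: (u' _ i) => b ? ?; lia.
  rewrite -sumrB (bigID (fun l : 'I_m => (l < j.+1)%N))/= [X in _ + X]big1 ?addr0; last first.
    by move=> l; rewrite -leqNgt => jl; rewrite cE// subrr.
  rewrite -(sum_dl (ltn_ord j)) big_distrl/=.
  rewrite (big_ord_widen_cond m (fun _ => true) (fun l => dl l * (M - Cu.+1))%N (ltn_ord j)).
  rewrite big_mkcond [X in (_ <= X)%N]big_mkcond/=; apply: leq_trans (nu_sum _) _.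
  apply: leq_sum => l _; case: ifP => _; last by rewrite nu0.
  rewrite -scalerBr nuZ/= leq_mul2l; apply/orP; right.
  apply: leq_trans (nuB _ _) _.
  have := FM (c_in l XF).1; have := FM (c_in l X'F).1; lia.
rewrite nuZ/= in bd; have := lam_gt0 (ltn_ord j).
have MC : (Cu.+1 <= M)%N by apply: leq_trans (FM XF); exact: leq_addl.
move: bd lamj MC; move: (nu z) (lam j) Cu => a L C; nia.
Qed.

(** By [Phi_inj], the pairs of a vector of [F] and a remainder vector inject into the residues
    modulo [M] through [Phi]. *)
Lemma minkowski_second_count : (size F * \prod_(i < m) lam i <= M ^ m)%N.
Proof.
pose T := fprod (fun i : 'I_m => ('I_(lam i) : finType)).
have cT : #|{: T}| = (\prod_(i < m) lam i)%N.
  by rewrite card_fprod; apply: eq_bigr => i _; rewrite card_ord.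
case: M M0 Phi_inj FM => [//|M'] _ inj _.
pose uv (f : T) : 'rV[int]_m := \row_i (f i : nat)%:Z.
pose X (k : 'I_(size F)) := tnth (in_tuple F) k.
pose g (p : 'I_(size F) * T) : {ffun 'I_m -> 'I_M'.+1} :=
  [ffun i => inord (absz (Phi (X p.1) (uv p.2) ord0 i %% M'.+1)%Z)].
have ru f : in_range (uv f) by move=> i; rewrite mxE lez_nat ltz_nat ltn_ord.
have XF k : X k \in F by exact: mem_tnth.
have ginj : injective g.
  move=> [k f] [k' f'] /ffunP E.
  have Ez i : (M'.+1%:Z %| Phi (X k) (uv f) ord0 i - Phi (X k') (uv f') ord0 i)%Z.
    rewrite -eqz_mod_dvd; apply/eqP; have := E i; rewrite !ffunE/= => /(congr1 val).
    have M1 : M'.+1%:Z != 0 by [].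
    have md a : (absz (a %% M'.+1)%Z < M'.+1)%N.
      by have := ltz_pmod a (isT : 0 < M'.+1%:Z); have := modz_ge0 a M1; lia.
    rewrite /= !inordK// => e.
    by have := modz_ge0 (Phi (X k) (uv f) ord0 i) M1; have := modz_ge0 (Phi (X k') (uv f') ord0 i) M1; lia.
  pose z : 'rV[int]_m := \row_i ((Phi (X k) (uv f) ord0 i - Phi (X k') (uv f') ord0 i) %/ M'.+1)%Z.
  have zE : Phi (X k) (uv f) - Phi (X k') (uv f') = M'.+1%:Z *: z.
    apply/rowP => i; rewrite [RHS]mxE [z _ _]mxE [RHS]mulrC divzK//.
    by rewrite [LHS]mxE; congr (_ + _); rewrite mxE.
  have [e1 e2] := inj _ _ _ _ z (XF k) (XF k') (ru f) (ru f') zE.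
  congr (_, _).
    by apply: val_inj; apply/eqP; rewrite -(nth_uniq 0 _ _ uF) ?ltn_ord// -!(tnth_nth _ (in_tuple F)) -/(X k) -/(X k') e1.
  apply/fprodP => i; apply: val_inj.
  by have := congr1 (fun Z : 'rV[int]_m => Z 0 i) e2; rewrite !mxE => -[].
have := leq_card g ginj; rewrite card_prod card_ord cT card_ffun !card_ord.
by [].
Qed.

End Minkowski.

(** * Integer kernels *)

Section IntegerMatrices.

(** In the Smith form L D U the matrix D vanishes beyond column k, so the columns of U^-1 from k on
    lie in the kernel; rows of U give the right inverse of [E]. *)
Lemma int_kernel_mx k m (A : 'M[int]_(k, m + k)) :
  exists E : 'M[int]_(m, m + k), exists2 V : 'M[int]_(m + k, m),
    E *m V = 1%:M & A *m E^T = 0.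
Proof.
have [L _ [U U1 [d _ ->]]] := int_Smith_normal_form A.
pose J : 'M[int]_(m + k, m) := \matrix_(i, j) (i == k + j :> nat)%N%:R.
exists (invmx U *m J)^T, (U^T *m J).
  rewrite trmx_mul -mulmxA [X in _ *m X]mulmxA -trmx_mul mulmxV// trmx1 mul1mx.
  apply/matrixP => i j; rewrite !mxE.
  have ik : (k + i < m + k)%N by rewrite addnC ltn_add2r.
  rewrite (bigD1 (Ordinal ik))//= !mxE/= eqxx mul1r eqn_add2l big1 ?addr0//.
  move=> l li; rewrite !mxE [X in X%:R * _](_ : _ = 0%N) ?mul0r//.
  by apply/eqP; rewrite eqb0; apply: contra li => /eqP li; apply/eqP/val_inj.
rewrite trmxK mulmxA mulmxK// -mulmxA [X in L *m X](_ : _ = 0) ?mulmx0//.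
apply/matrixP => i j; rewrite !mxE big1// => l _; rewrite !mxE.
have [il|_] := eqVneq (i : nat) l; last by rewrite mulr0n mul0r.
rewrite [X in _ * X%:R](_ : _ = 0%N) ?mulr0//.
by apply/eqP; rewrite eqb0 -il neq_ltn ltn_addr.
Qed.

(** The Smith form of the first row clears it beyond its first entry; the lower right block is
    treated by induction. *)
Lemma int_lower_triangular m n (Z : 'M[int]_(m, n)) :
  exists2 U : 'M[int]_n, U \in unitmx &
    forall (i : 'I_m) (j : 'I_n), (i < j)%N -> (Z *m U) i j = 0.
Proof.
elim: m n Z => [|m IH] n Z; first by exists 1%:M; [exact: unitmx1|case].
case: n Z => [|n] Z; first by exists 1%:M; [exact: unitmx1|move=> i []].
have [L _ [U U1 [d _ ZE]]] := int_Smith_normal_form (row 0 Z).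
have [Y YE] : {Y : 'M[int]_(1 + m, 1 + n) | Y = Z *m invmx U} by exists (Z *m invmx U).
have Y0 i j : Y (lshift m i) (rshift 1 j) = 0.
  have -> : lshift m i = 0 :> 'I_m.+1 by apply/val_inj; rewrite /= ord1.
  have : row 0 Y 0 (rshift 1 j) = 0.
    by rewrite YE row_mul ZE mulmxK// !mxE big1// => l _; rewrite !mxE ord1/= mulr0n mulr0.
  by rewrite mxE.
have [V V1 VE] := IH n (drsubmx Y).
pose W : 'M[int]_(1 + n) := block_mx 1%:M 0 0 V.
have W1 : W \in unitmx by rewrite unitmxE (@det_ublock _ 1 n) det1 mul1r -unitmxE.
exists (invmx U *m W); first by rewrite unitmx_mul unitmx_inv U1.
have YW : Y *m W = block_mx (ulsubmx Y) (ursubmx Y *m V) (dlsubmx Y) (drsubmx Y *m V).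
  by rewrite -{1}[Y]submxK mulmx_block !mulmx0 !mulmx1 !add0r !addr0.
move=> i j ij; rewrite mulmxA -YE -[LHS]/((Y *m W : 'M[int]_(1 + m, 1 + n)) (i : 'I_(1 + m)) (j : 'I_(1 + n))) YW.
rewrite -(@splitK 1 m i) -(@splitK 1 n j).
case: (@splitP 1 m i) => i' Ei; case: (@splitP 1 n j) => j' Ej/=.
- by move: ij; rewrite Ei Ej !ord1.
- rewrite block_mxEur !mxE big1// => l _.
  by rewrite !mxE Y0 mul0r.
- by move: ij; rewrite Ei Ej ord1.
- by rewrite block_mxEdr; apply: VE; move: ij; rewrite Ei Ej !add1n ltnS.
Qed.

(** The first half of Cauchy-Binet, with all maps [f] instead of increasing ones. Divisibility of
    the sum by a common divisor of the minors is already visible in this form. *)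
Lemma det_mulmx_rect (R : comNzRingType) k n (M : 'M[R]_(k, n)) (A : 'M[R]_(n, k)) :
  \det (M *m A) = \sum_(f : {ffun 'I_k -> 'I_n}) (\prod_i M i (f i)) * \det (rowsub f A).
Proof.
rewrite /determinant.
under eq_bigr => s _.
  under eq_bigr => i _ do rewrite mxE.
  rewrite bigA_distr_bigA/= big_distrr/=.
  over.
rewrite exchange_big/=; apply: eq_bigr => f _; rewrite big_distrr/=.
apply: eq_bigr => s _; rewrite big_split/= mulrCA; congr (_ * (_ * _)).
by apply: eq_bigr => i _; rewrite mxE.
Qed.

Lemma dvdz_det_mulmx D k n (A : 'M[int]_(k, n)) (M : 'M[int]_(n, k)) :
  (forall f : {ffun 'I_k -> 'I_n}, D %| absz (\det (colsub f A)))%N ->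
  (D %| absz (\det (A *m M)))%N.
Proof.
move=> DA; rewrite -det_tr trmx_mul det_mulmx_rect -[(_ %| _)%N]/(D%:Z %| _)%Z.
apply: (big_ind (fun x => (D%:Z %| x)%Z)); [exact: dvdz0|by move=> *; exact: rpredD|].
move=> f _; apply: dvdz_mull; have := DA f.
rewrite -[(_ %| _)%N]/(D%:Z %| _)%Z -det_tr; congr (_ %| \det _)%Z.
by apply/matrixP => i j; rewrite !mxE.
Qed.

End IntegerMatrices.

Section Reduction.
Variables (R : numFieldType) (k m : nat) (A : 'M[int]_(k, m + k)) (N : 'rV[int]_(m + k) -> nat).
Local Notation ir := (map_mx (intr : int -> R)).

Lemma map_intr_inj a b : injective (ir : 'M[int]_(a, b) -> 'M[R]_(a, b)).
Proof. by move=> X Y /matrixP E; apply/matrixP => i j; have := E i j; rewrite !mxE => /intr_inj. Qed.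

(** The change of rows is the identity matrix with row [l] replaced by [a]; expansion along column
    [l] gives determinant [a 0 l]. *)
Lemma row_free_replace (Z : 'M[R]_(m, m + k)) (a : 'rV[R]_m) l :
  row_free Z -> a 0 l != 0 -> row_free (\matrix_i if i == l then a *m Z else row i Z).
Proof.
move=> Zf al; pose M : 'M[R]_m := \matrix_i if i == l then a else delta_mx 0 i.
have -> : (\matrix_i if i == l then a *m Z else row i Z) = M *m Z.
  by apply/row_matrixP => i; rewrite row_mul !rowK; case: eqP => // _; rewrite -rowE.
rewrite /row_free mxrankMfree// -/(row_free M) row_free_unit unitmxE.
rewrite (expand_det_col _ l) (bigD1 l)//= big1 => [|i il]; last first.
  by rewrite !mxE (negPf il) !mxE (negPf (_ : l != i)) 1?eq_sym// andbF mul0r.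
rewrite addr0 mxE eqxx unitfE mulf_neq0// /cofactor mulf_neq0 ?expf_neq0 ?oppr_eq0 ?oner_eq0//.
rewrite (_ : row' l (col' l M) = 1%:M) ?det1 ?oner_eq0//.
apply/matrixP => i j; rewrite !mxE (negPf (_ : lift l i != l)) 1?eq_sym ?neq_lift//.
by rewrite mxE eqxx/= (inj_eq lift_inj) eq_sym.
Qed.

(* The exchange property in the last clause holds because [Z] minimises the sum of
   the [N (row i Z)]. *)
Lemma int_reduced_basis : exists Z : 'M[int]_(m, m + k),
  [/\ A *m Z^T = 0, row_free (ir Z),
      forall i j : 'I_m, (i <= j)%N -> (N (row i Z) <= N (row j Z))%N &
      forall x (a : 'rV[R]_m) l, ir x = a *m ir Z -> a 0 l != 0 -> (N (row l Z) <= N x)%N].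
Proof.
pose Q s := exists2 Z : 'M[int]_(m, m + k), A *m Z^T = 0 /\ row_free (ir Z) &
  (\sum_i N (row i Z))%N = s.
have exQ : exists s, `[< Q s >].
  have [E [V EV AE]] := int_kernel_mx A.
  exists (\sum_i N (row i E))%N; apply/asboolP; exists E => //; split => //.
  by apply/row_freeP; exists (ir V); rewrite -map_mxM EV map_mx1.
have [s /asboolP[Z [AZ Zf] Zs] smin] := ex_minnP exQ.
have exch x (a : 'rV[R]_m) l : ir x = a *m ir Z -> a 0 l != 0 -> (N (row l Z) <= N x)%N.
  move=> xE al; pose Z' : 'M[int]_(m, m + k) := \matrix_i if i == l then x else row i Z.
  have ZE' : ir Z' = \matrix_i if i == l then a *m ir Z else row i (ir Z).
    apply/row_matrixP => i; rewrite rowK -map_row rowK; case: eqP => // _.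
    by rewrite map_row.
  have /smin : `[< Q (\sum_i N (row i Z'))%N >].
    apply/asboolP; exists Z' => //; split; last by rewrite ZE'; exact: row_free_replace.
    apply: map_intr_inj; rewrite map_mxM -map_trmx ZE' map_mx0.
    apply: trmx_inj; rewrite trmx_mul trmxK trmx0; apply/row_matrixP => i.
    have ZA : ir Z *m (ir A)^T = 0.
      by apply: trmx_inj; rewrite trmx_mul !trmxK map_trmx -map_mxM AZ map_mx0 trmx0.
    by rewrite row_mul rowK row0; case: eqP => _; rewrite -?row_mul -?mulmxA ZA ?mulmx0 ?row0.
  rewrite -Zs (bigD1 l)//= [X in (_ <= X)%N](bigD1 l)//= rowK eqxx.
  rewrite [X in (_ <= _ + X)%N -> _](eq_bigr (fun i => N (row i Z))); first by rewrite leq_add2r.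
  by move=> i il; rewrite rowK (negPf il).
(* The rows are put in increasing order of [N]; the exchange property survives the permutation. *)
pose f i := N (row i Z).
pose ss := sort (fun i j : 'I_m => (f i <= f j)%N) (enum 'I_m).
have ssz : size ss = m by rewrite size_sort -cardE card_ord.
have ssu : uniq ss by rewrite sort_uniq enum_uniq.
case: (posnP m) => [m0|m0].
  by exists Z; split => // -[i ilt]; exfalso; move: ilt; rewrite m0.
pose x0 := Ordinal m0.
have ginj : injective (fun i : 'I_m => nth x0 ss i).
  by move=> i j /eqP; rewrite nth_uniq ?ssz// => /eqP /val_inj.
pose g := perm ginj.
have rowg i : row i (row_perm g Z) = row (g i) Z by apply/rowP => j; rewrite !mxE.
exists (row_perm g Z); split => //.
- by rewrite tr_row_perm col_permE mulmxA AZ mul0mx.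
- by rewrite row_permE map_mxM /row_free mxrankMfree// map_perm_mx -/(row_free _) row_free_unit unitmx_perm.
- move=> i j ij; rewrite !rowg !permE.
  have : sorted (fun i j : 'I_m => (f i <= f j)%N) ss by apply: sort_sorted => a b; exact: leq_total.
  move/(sorted_leq_nth (fun a b c => @leq_trans _ _ _) (fun a => leqnn _) x0).
  by apply; rewrite ?inE ?ssz.
- move=> x a l xE al; rewrite rowg; apply: (exch _ (a *m perm_mx g)).
    by rewrite -mulmxA xE -(map_perm_mx (intr : {rmorphism int -> R})) -map_mxM -row_permE.
  have -> // : (a *m perm_mx g) 0 (g l) = a 0 l.
  by rewrite -[g in perm_mx g]invgK -col_permE mxE permK.
Qed.

(* [Z = H *m P] with [H] lower triangular, so a vector [X *m P] with [X j != 0]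
   involves some row of [Z] of index at least [j]. *)
Lemma adapted_basis : exists Z : 'M[int]_(m, m + k), exists P : 'M[int]_(m, m + k), exists P' : 'M[int]_(k, m + k),
  [/\ A *m Z^T = 0, row_free (ir Z),
      forall i j : 'I_m, (i <= j)%N -> (N (row i Z) <= N (row j Z))%N,
      col_mx P P' \in unitmx /\ A *m P^T = 0 &
      forall (X : 'rV[int]_m) (j : 'I_m), X 0 j != 0 -> (N (row j Z) <= N (X *m P))%N].
Proof.
have [Z [AZ Zf Zs Zx]] := int_reduced_basis.
have [V V1 VE] := int_lower_triangular Z.
pose W : 'M[int]_(m + k) := invmx V; pose P := usubmx W.
pose H : 'M[int]_m := lsubmx (Z *m V).
have Ht (i j : 'I_m) : (i < j)%N -> H i j = 0 by move=> ij; rewrite mxE VE.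
have ZE : Z = H *m P.
  have -> : Z = (Z *m V) *m W by rewrite mulmxK.
  rewrite -[Z *m V]hsubmxK -[W]vsubmxK mul_row_col (_ : rsubmx _ = 0) ?mul0mx ?addr0//.
  by apply/matrixP => i j; rewrite mxE VE ?mxE//= ltn_addr.
have H1 : ir H \in unitmx.
  rewrite -row_free_unit /row_free eqn_leq rank_leq_row/=.
  by rewrite -{1}(eqP Zf) ZE map_mxM mxrankM_maxl.
exists Z, P, (dsubmx W); split => //.
  rewrite vsubmxK unitmx_inv V1; split => //; apply: map_intr_inj.
  have /(congr1 ir) := AZ; rewrite ZE trmx_mul !map_mxM mulmxA -!map_trmx map_mx0.
  move/(congr1 (mulmxr (invmx (ir H)^T))); rewrite /= mulmxK ?unitmx_tr// mul0mx => ->; apply/matrixP => i j; rewrite !mxE//.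
move=> X j Xj; pose a := ir X *m invmx (ir H).
have aH : a *m ir H = ir X by rewrite mulmxKV.
have [l jl al] : exists2 l : 'I_m, (j <= l)%N & a 0 l != 0.
  apply/exists_inP; apply: contraNT Xj => /exists_inPn h.
  have := congr1 (fun Y : 'rV[R]_m => Y 0 j) aH; rewrite !mxE big1.
    by move=> /esym/eqP; rewrite intr_eq0.
  move=> l _; rewrite [ir H _ _]mxE; case: (leqP j l) => jl.
    by have := h l jl; rewrite negbK => /eqP ->; rewrite mul0r.
  by rewrite Ht// mulr0.
apply: leq_trans (Zs _ _ jl) (Zx _ a _ _ al).
by rewrite map_mxM -aH -mulmxA -map_mxM -ZE.
Qed.

End Reduction.

Section Complement.
Variables (k m : nat).

(** As A U^T = (0 | C), one has A A^T = C W C^T, where [W] is the lower right block of the inverse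
    of G = U U^T. Jacobi's identity for complementary minors, here [GW], gives det W = det(P P^T),
    since det G = 1. *)
Lemma det_gram_complement (F : fieldType) (A P' : 'M[F]_(k, m + k)) (P : 'M[F]_(m, m + k)) :
  A *m P^T = 0 -> \det (col_mx P P') ^+ 2 = 1 ->
  \det (A *m A^T) = \det (A *m P'^T) ^+ 2 * \det (P *m P^T).
Proof.
move=> AP dU; set U := col_mx P P' in dU; set C := A *m P'^T.
have Uu : U \in unitmx.
  by rewrite unitmxE unitfE; apply: contra_eq_neq dU => ->; rewrite expr0n eq_sym oner_eq0.
pose G := U *m U^T.
have Gu : G \in unitmx by rewrite unitmx_mul unitmx_tr Uu.
pose Y : 'M[F]_(m, k) := ursubmx (invmx G); pose W : 'M[F]_k := drsubmx (invmx G).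
have AE : A = row_mx 0 C *m invmx U^T.
  have <- : A *m U^T = row_mx 0 C by rewrite tr_col_mx mul_mx_row AP.
  by rewrite mulmxK ?unitmx_tr.
have AAE : A *m A^T = C *m W *m C^T.
  have GE : invmx U^T *m (invmx U^T)^T = invmx G.
    apply: (can_inj (mulmxK Gu)); rewrite mulVmx// trmx_inv trmxK /G mulmxA mulmxKV//.
    by rewrite mulVmx// unitmx_tr.
  rewrite {1 2}AE trmx_mul -mulmxA [X in _ *m X]mulmxA GE tr_row_mx trmx0.
  rewrite -[invmx G]submxK mulmxA mul_row_block !mul0mx !add0r mul_row_col mulmx0 add0r.
  by [].
have GW : G *m block_mx 1%:M Y 0 W = block_mx (P *m P^T) 0 (P' *m P^T) 1%:M.
  have GE : G = block_mx (P *m P^T) (P *m P'^T) (P' *m P^T) (P' *m P'^T).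
    by rewrite /G /U tr_col_mx mul_col_row.
  have GI : G *m col_mx Y W = col_mx 0 1%:M.
    have -> : col_mx Y W = rsubmx (invmx G).
      by rewrite -[in RHS](submxK (invmx G)) block_mxEh row_mxKr.
    by rewrite mulmx_rsub mulmxV// scalar_mx_block block_mxEh row_mxKr.
  rewrite [block_mx 1%:M _ _ _]block_mxEh mul_mx_row GI GE.
  rewrite mul_block_col !mulmx1 !mulmx0 !addr0.
  by rewrite block_mxEh.
have := congr1 determinant GW.
rewrite det_mulmx det_ublock det_lblock !det1 mul1r mulr1 /G det_mulmx det_tr -expr2 dU mul1r.
by rewrite AAE !det_mulmx det_tr => ->; ring.
Qed.

End Complement.

Lemma supnorm_add k (v w : 'rV[int]_k) : (supnorm (v + w)%R <= supnorm v + supnorm w)%N.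
Proof.
apply/bigmax_leqP => i _; rewrite mxE.
apply: (@leq_trans (absz (v ord0 i) + absz (w ord0 i))).
  by move: (v _ _) (w _ _) => a b; lia.
by apply: leq_add; [exact: (leq_bigmax i) | exact: (leq_bigmax i)].
Qed.

Lemma supnormZ k (a : int) (v : 'rV[int]_k) : supnorm (a *: v) = (absz a * supnorm v)%N.
Proof.
rewrite /supnorm (big_morph (muln (absz a)) (maxnMr _) (muln0 _)).
by apply: eq_bigr => i _; rewrite mxE abszM.
Qed.

Section Coercive.
Context {R : realType}.

Lemma sqr_sum_le n (a : 'I_n -> R) : (\sum_i a i) ^+ 2 <= n%:R * \sum_i a i ^+ 2.
Proof.
have -> : n%:R * \sum_i a i ^+ 2 = \sum_(i < n) \sum_(j < n) (a i ^+ 2 + a j ^+ 2) / 2.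
  transitivity (\sum_(i < n) (n%:R * a i ^+ 2 / 2 + (\sum_j a j ^+ 2) / 2)).
    rewrite big_split/= sumr_const card_ord -!mulr_suml -mulr_sumr -mulrnAl.
    by rewrite -[_ *+ n]mulr_natl; lra.
  apply: eq_bigr => i _; rewrite -[RHS]mulr_suml big_split/= sumr_const card_ord -[a i ^+ 2 *+ n]mulr_natl.
  by rewrite -mulrDl.
rewrite expr2 big_distrl/=; apply: ler_sum => i _; rewrite big_distrr/=.
apply: ler_sum => j _; have := sqr_ge0 (a i - a j); move: (a i) (a j) => x y; nra.
Qed.

(** A right inverse [Q] recovers y = (y P) Q, and Cauchy-Schwarz bounds |y| by |y P|. *)
Lemma row_free_coercive m n (P : 'M[R]_(m, n)) : row_free P ->
  exists2 e : R, 0 < e & forall y, e * sqn y <= \sum_i dot (row i P^T) y ^+ 2.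
Proof.
move=> /row_freeP[Q PQ].
pose K := \sum_i \sum_j Q i j ^+ 2.
have K0 : 0 <= K by apply: sumr_ge0 => i _; apply: sumr_ge0 => j _; exact: sqr_ge0.
have p0 : 0 < n%:R * K + 1 by rewrite ltr_wpDl// mulr_ge0.
exists (n%:R * K + 1)^-1 => [|y]; first by rewrite invr_gt0.
rewrite mulrC ler_pdivrMr//; set W := \sum_i _.
have W0 : 0 <= W by apply: sumr_ge0 => i _; exact: sqr_ge0.
have dE i : dot (row i P^T) y = (y *m P) 0 i.
  by rewrite /dot mxE; apply: eq_bigr => j _; rewrite !mxE mulrC.
apply: (@le_trans _ _ (n%:R * K * W)); last by lra.
have yE : y = (y *m P) *m Q by rewrite -mulmxA PQ mulmx1.
rewrite /sqn {1}yE.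
apply: (@le_trans _ _ (\sum_j n%:R * \sum_i ((y *m P) 0 i * Q i j) ^+ 2)).
  by apply: ler_sum => j _; rewrite mxE; exact: sqr_sum_le.
rewrite -mulr_sumr -mulrA; apply: ler_wpM2l; first by [].
rewrite exchange_big/= mulr_suml; apply: ler_sum => i _.
rewrite mulr_suml; apply: ler_sum => j _; rewrite exprMn mulrC ler_wpM2l ?sqr_ge0//.
by rewrite /W (bigD1 i)//= dE lerDl; apply: sumr_ge0 => l _; exact: sqr_ge0.
Qed.

End Coercive.

Section Successive.
Context {R : realType}.
Variables (m n : nat) (P : 'M[int]_(m, n)) (lam : nat -> nat).
Let B : 'M[R]_(n, m) := (map_mx intr P)^T.
Hypotheses (Pf : row_free (map_mx (intr : int -> R) P))
  (lam_gt0 : forall i, (i < m)%N -> (0 < lam i)%N)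
  (lam_mono : forall i, (i.+1 < m)%N -> (lam i <= lam i.+1)%N)
  (lam_min : forall (X : 'rV[int]_m) (j : 'I_m), X 0 j != 0 -> (lam j <= supnorm (X *m P))%N).

(** Under dilation only the determinant in [box_volume] changes. *)
Lemma leverageZ (a : R) i : a != 0 -> leverage (a *: B) i = leverage B i.
Proof.
move=> a0; rewrite /leverage.
have -> : row i (a *: B) = a *: row i B by apply/rowP => j; rewrite !mxE.
have tZ p q (C : 'M[R]_(p, q)) : (a *: C)^T = a *: C^T by apply/matrixP => i' j; rewrite !mxE.
have -> : (a *: B)^T *m (a *: B) = a ^+ 2 *: (B^T *m B).
  by rewrite tZ -scalemxAl -scalemxAr scalerA.
have [e e0 Be] := row_free_coercive Pf.
have uS : B^T *m B \in unitmx by exact: posdef_unit (gram_posdef e0 Be).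
rewrite tZ invmxZ ?unitmxZ ?unitfE ?sqrf_eq0//.
rewrite -!scalemxAl -!scalemxAr -scalemxAl !scalerA.
rewrite [X in X *: _](_ : _ = 1) ?scale1r//; by field.
Qed.

(** For the forms divided by [t] the lower bound [V] is multiplied by t^m. The two counting results
    then give L V t^m <= (t + K)^m with [K] independent of [t], and [t] tends to infinity. *)
Theorem successive_minima_bound (c : R) (Q : pred 'I_n) : 0 < c ->
  (\prod_(i < m) lam i)%:R * (expR (1 / 2 * (m%:R - \sum_i (if Q i then leverage B i / c
     else 24 / pi ^+ 2 * (leverage B i / c) ^+ 2))) / Num.sqrt (\det (c *: (B^T *m B)))) <= 1.
Proof.
move=> c0; set V := _ / Num.sqrt _; set L : R := (\prod_(i < m) lam i)%:R.
have [e e0 Be] := row_free_coercive Pf.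
have pS := gram_posdef e0 Be.
have V0 : 0 < V.
  rewrite divr_gt0 ?expR_gt0// sqrtr_gt0 detZ mulr_gt0 ?exprn_gt0//.
  exact: (gauss_itint 0 pS).1.
have L0 : 0 < L by rewrite ltr0n; apply: prodn_gt0 => i; exact: lam_gt0.
pose nu X := supnorm (X *m P).
pose K := (2 * abssum P + (\sum_(j < m) lam j * nu (delta_mx ord0 j)).+1)%N.
have main (t : nat) : (0 < t)%N -> L * V * t%:R ^+ m <= (t + K)%:R ^+ m.
  move=> t0; have [F [uF FM FV]] := count_box e0 Be t0.
  have tp : 0 < t%:R :> R by rewrite ltr0n.
  pose Bt := t%:R^-1 *: B.
  have rowBt i y : dot (row i Bt) y = t%:R^-1 * dot (row i B) y.
    by rewrite /dot mulr_sumr; apply: eq_bigr => j _; rewrite !mxE mulrA.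
  have Bte y : (t%:R^-1 ^+ 2 * e) * sqn y <= \sum_i dot (row i Bt) y ^+ 2.
    under eq_bigr do rewrite rowBt exprMn.
    by rewrite -mulr_sumr -mulrA ler_wpM2l ?sqr_ge0.
  have et : 0 < t%:R^-1 ^+ 2 * e by rewrite mulr_gt0// exprn_gt0// invr_gt0.
  have VF := le_trans (box_volume et Bte c0 Q) FV.
  have FM' X : X \in F -> (2 * nu X + (\sum_(j < m) lam j * nu (delta_mx ord0 j)).+1 <= t + K)%N.
    by move=> /FM h; rewrite /K addnA leq_add2r.
  have nuD X Y : (nu (X + Y)%R <= nu X + nu Y)%N by rewrite /nu mulmxDl supnorm_add.
  have nuZ a X : nu (a *: X) = (absz a * nu X)%N by rewrite /nu -scalemxAl supnormZ.
  have tK0 : (0 < t + K)%N by rewrite addn_gt0 t0.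
  have := minkowski_second_count nuD nuZ lam_gt0 lam_mono lam_min tK0 uF FM'.
  rewrite -(ler_nat R) natrM natrX; apply: le_trans.
  rewrite mulrAC -mulrA mulrC; apply: ler_wpM2r; first exact: ltW.
  apply: le_trans VF.
  rewrite (eq_bigr (fun i => if Q i then leverage B i / c
     else 24 / pi ^+ 2 * (leverage B i / c) ^+ 2)) => [|i _]; last first.
    by rewrite leverageZ// gt_eqF// invr_gt0.
  rewrite /V [leLHS]mulrC -[leLHS]mulrA; apply: ler_wpM2l; first exact: expR_ge0.
  have -> : \det (c *: (Bt^T *m Bt)) = t%:R^-1 ^+ 2 ^+ m * \det (c *: (B^T *m B)).
    rewrite -detZ; congr (\det _); rewrite /Bt.
    have -> : (t%:R^-1 *: B)^T = t%:R^-1 *: B^T by apply/matrixP => i' j; rewrite !mxE.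
    by rewrite -scalemxAl -scalemxAr !scalerA; congr (_ *: _); ring.
  rewrite sqrtrM; last by rewrite !exprn_ge0// invr_ge0.
  rewrite -exprM mulnC exprM sqrtr_sqr normrX ger0_norm ?invr_ge0// exprVn invfM invrK.
  by rewrite mulrC.
rewrite leNgt; apply/negP => LV.
have l0 : 0 < ln (L * V) by rewrite ln_gt0.
(* If L V > 1, then (1 + K/t)^m <= exp(m K/t) < L V as soon as t > m K / ln(L V). *)
pose q : R := (m * K)%:R / ln (L * V).
pose t := (Num.truncn q).+1.
have t0 : 0 < t%:R :> R by rewrite ltr0n.
have qt : q < t%:R by exact: truncnS_gt.
have := main t isT; rewrite -ler_pdivlMr ?exprn_gt0// -expr_div_n natrD mulrDl divff ?gt_eqF//.
move=> h; have : L * V <= expR (m%:R * (K%:R / t%:R)).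
  apply: le_trans h _; rewrite expRM_natl.
  by apply: lerXn2r; rewrite ?nnegrE ?expR_ge0 ?addr_ge0 ?divr_ge0// expR_ge1Dx.
rewrite -ler_ln; [|by rewrite posrE mulr_gt0|by rewrite posrE expR_gt0].
rewrite expRK mulrA -natrM ler_pdivlMr//.
by move: qt; rewrite /q ltr_pdivrMr// mulrC => h1 h2; move: (lt_le_trans h1 h2); rewrite ltxx.
Qed.

End Successive.

(** * Choice of the scale *)

Section RealInequality.
Context {R : realType}.
Implicit Types q x r : R.

Let kappa : R := 24 / pi ^+ 2.

Let kappa_gt0 : 0 < kappa.
Proof. by rewrite divr_gt0// exprn_gt0// pi_gt0. Qed.

Let ln_kappa : ln kappa <= 1.
Proof.
rewrite -[leRHS]expRK ler_ln ?posrE ?expR_gt0//.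
apply: le_trans expR1_ge.
rewrite /kappa ler_pdivrMr ?exprn_gt0 ?pi_gt0//.
have := @pi_ge3 R; move: (pi : R) => P P3; nra.
Qed.

(** Weighted AM-GM for x^r and 1 with weights 1/r and 1 - 1/r. *)
Lemma powR_tangent x r : 0 <= x -> 1 <= r -> x <= x `^ r / r + (1 - r^-1).
Proof.
move=> x0 r1; have rp : 0 < r by exact: lt_le_trans r1.
have ri : r^-1 <= 1 by rewrite invf_le1.
move: x0; rewrite le_eqVlt => /predU1P[<-|x0].
  by rewrite powR0 ?gt_eqF// mul0r add0r subr_ge0.
have := amgm_expR (r * ln x) 0 (_ : 0 <= r^-1 <= 1).
rewrite invr_ge0 ltW// ri => /(_ isT).
rewrite mulr0 addr0 mulKf ?gt_eqF// lnK// expR0 mulr1.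
by rewrite /powR gt_eqF// mulrC.
Qed.

(** The smaller of x and kappa x^2 is at most their geometric mean with exponents 2 - q and q - 1,
    which is the right side; the test [1 <= kappa * x] tells which is smaller. *)
Lemma min_le_powR x q : 0 <= x -> 1 <= q <= 2 ->
  (if 1 <= kappa * x then x else kappa * x ^+ 2) <= expR ((q - 1) * ln kappa) * x `^ q.
Proof.
move=> x0 /andP[q1 q2].
move: x0; rewrite le_eqVlt => /predU1P[<-|x0].
  by rewrite mulr0 ler10 expr0n/= mulr0 mulr_ge0 ?expR_ge0 ?powR_ge0.
have lk : ln (kappa * x) = ln kappa + ln x by rewrite lnM.
rewrite /powR gt_eqF// -expRD; case: ifPn => [h|].
  rewrite -{1}(lnK x0) ler_expR.
  have : 0 <= ln (kappa * x) by exact: ln_ge0.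
  by rewrite lk; move: (ln kappa) (ln x) => a b; nra.
rewrite -ltNge => h; have kx : 0 < kappa * x by exact: mulr_gt0.
have -> : kappa * x ^+ 2 = expR (ln kappa + 2 * ln x).
  by rewrite expRD (lnK kappa_gt0) -[2]/(2%:R) expRM_natl lnK.
rewrite ler_expR; have : ln (kappa * x) <= 0 by apply: ln_le0; exact: ltW.
by rewrite lk; move: (ln kappa) (ln x) => a b; nra.
Qed.

Variables (n m : nat) (beta : 'I_n -> R).
Hypotheses (m0 : (0 < m)%N) (beta0 : forall i, 0 <= beta i) (beta1 : \sum_i beta i = m%:R).

Let mp : 0 < m%:R :> R. Proof. by rewrite ltr0n. Qed.

Let rho q := m%:R^-1 * \sum_i beta i `^ q.

Lemma rho_gt0 q : 0 < rho q.
Proof.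
rewrite mulr_gt0 ?invr_gt0// lt_neqAle sumr_ge0 ?andbT => [|i _]; last exact: powR_ge0.
apply/negP => /eqP /esym/eqP; rewrite psumr_eq0 => [|i _]; last exact: powR_ge0.
move=> /allP h; move: mp; rewrite -beta1 big1 ?ltxx// => i _.
have := h i; rewrite mem_index_enum => /(_ isT) /=; rewrite powR_eq0 => /andP[/eqP ->].
by [].
Qed.

(** Jensen's inequality for t^(q-1) with weights beta_i/m, obtained from the tangent inequality at
    [T], whose power of exponent q - 1 is [rho q]. *)
Lemma power_mean q : 2 < q -> m%:R^-1 * \sum_i beta i ^+ 2 <= expR (ln (rho q) / (q - 1)).
Proof.
move=> q2; set r := q - 1; have r1 : 1 <= r by rewrite /r; lra.
set T := expR _; have T0 : 0 < T by exact: expR_gt0.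
have rp : 0 < r by exact: lt_le_trans r1.
have Tr : T `^ r = rho q.
  by rewrite /powR gt_eqF// expRK mulrC divfK ?gt_eqF// lnK// posrE rho_gt0.
have h i : beta i ^+ 2 / T <= beta i `^ q / (rho q * r) + beta i * (1 - r^-1).
  have := powR_tangent (divr_ge0 (beta0 i) (ltW T0)) r1.
  move=> /(ler_wpM2l (beta0 i)); rewrite mulrA -expr2 => h; apply: le_trans h _.
  rewrite mulrDr lerD2r; have := beta0 i; rewrite le_eqVlt => /predU1P[<-|b0].
    by rewrite mul0r powR0 ?mul0r// gt_eqF// (lt_trans _ q2).
  have bT : 0 < beta i / T by exact: divr_gt0.
  rewrite /powR !gt_eqF// ln_div// /T expRK mulrBr (mulrC r (_ / r)) divfK ?gt_eqF//.
  rewrite expRD expRN (lnK (rho_gt0 q)) -{1}(lnK b0) !mulrA -expRD.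
  have -> : ln (beta i) + r * ln (beta i) = q * ln (beta i) by rewrite /r; ring.
  by rewrite (invfM (rho q) r) mulrA.
have := ler_sum (index_enum _) (fun i (_ : true) => h i).
rewrite big_split/= -!mulr_suml beta1 => H.
have E : \sum_i beta i `^ q = m%:R * rho q by rewrite /rho mulrA divff ?mul1r// gt_eqF.
rewrite mulrC ler_pdivrMr// (mulrC T) -ler_pdivrMr//; apply: le_trans H _; rewrite E.
have -> : m%:R * rho q / (rho q * r) = m%:R / r.
  by field; rewrite !gt_eqF// rho_gt0.
by rewrite mulrBr mulr1 addrC subrK.
Qed.

(* [c] minimises the bound obtained from [min_le_powR] when [q <= 2], and from
   [power_mean] with the quartic weight everywhere when [2 < q]. If the right-hand
   side is negative the factor [m >= 2] may be replaced by 2. *)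
Theorem exists_scale_bound q : 1 <= q -> (1 < m)%N -> exists (c : R) (Q : pred 'I_n), 0 < c /\
  m%:R * ln c + (\sum_i (if Q i then beta i / c else 24 / pi ^+ 2 * (beta i / c) ^+ 2) - m%:R) <=
  ln q + ln (rho q) / q.
Proof.
move=> q1 m1; set y := ln q + _.
have qp : 0 < q by exact: lt_le_trans q1.
have lq : 0 <= ln q by exact: ln_ge0.
(* With c = 1 and Gaussian weights only, the left side is 0 because the [beta i] add up to [m]; this
   is Vaaler's bound for cube sections. *)
have [y0|y0] := leP 0 y.
  exists 1, xpredT; split => //=.
  by under eq_bigr do rewrite divr1; rewrite beta1 subrr addr0 ln1 mulr0.
suff [c [Q [c0 H]]] : exists (c : R) (Q : pred 'I_n), 0 < c /\
    ln c - 1 + m%:R^-1 * \sum_i (if Q i then beta i / c else kappa * (beta i / c) ^+ 2) <= y / 2.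
  exists c, Q; split => //; set S := \sum_i _ in H *.
  have m2 : 2 <= m%:R :> R by rewrite ler_nat.
  have -> : m%:R * ln c + (S - m%:R) = m%:R * (ln c - 1 + m%:R^-1 * S).
    by field; rewrite gt_eqF.
  apply: le_trans (ler_wpM2l (ltW mp) H) _.
  have hb (a b : R) : 2 <= a -> b < 0 -> a * (b / 2) <= b by move=> *; nra.
  exact: hb.
have r0 := rho_gt0 q.
have lr : ln (rho q) < - (q * ln q).
  by move: y0; rewrite /y -(ltr_pM2r qp) mulrDl divfK ?gt_eqF// mul0r; lra.
have [q2|q2] := leP q 2.
  (* The minimum of ln c + kappa^(q-1) (rho q) c^(-q) is at c^q = q kappa^(q-1) (rho q), where the
     last term equals 1/q. *)
  pose lc := (ln q + (q - 1) * ln kappa + ln (rho q)) / q.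
  exists (expR lc), (fun i => 1 <= kappa * (beta i / expR lc)); split; first exact: expR_gt0.
  set S := \sum_i _.
  have HS : m%:R^-1 * S <= q^-1.
    apply: (@le_trans _ _ (m%:R^-1 * \sum_i expR ((q - 1) * ln kappa) * (beta i / expR lc) `^ q)).
      rewrite ler_wpM2l ?invr_ge0//; apply: ler_sum => i _.
      by apply: min_le_powR; [rewrite divr_ge0 ?expR_ge0|rewrite q1].
    have E i : (beta i / expR lc) `^ q = beta i `^ q / (q * expR ((q - 1) * ln kappa) * rho q).
      rewrite powRM ?invr_ge0 ?expR_ge0//; congr (_ * _).
      rewrite -expRN /powR gt_eqF ?expR_gt0// expRK mulrN /lc mulrC divfK ?gt_eqF//.
      by rewrite expRN !expRD !lnK ?posrE.
    under eq_bigr do rewrite E.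
    rewrite -mulr_sumr -mulr_suml mulrCA (mulrA m%:R^-1) -/(rho q).
    rewrite le_eqVlt; apply/orP; left; apply/eqP; field.
    by rewrite !gt_eqF ?expR_gt0.
  apply: le_trans (lerD (lexx _) HS) _; rewrite expRK /lc.
  have -> : (ln q + (q - 1) * ln kappa + ln (rho q)) / q - 1 + q^-1 =
      (ln q + (q - 1) * ln kappa + ln (rho q) - q + 1) / q by field; rewrite gt_eqF.
  have -> : y / 2 = (q * ln q + ln (rho q)) / 2 / q by rewrite /y; field; rewrite gt_eqF.
  rewrite ler_pM2r ?invr_gt0//.
  (* The left side is ln q + ln(rho q) + (q-1)(ln kappa - 1), so ln kappa <= 1 removes kappa; the
     rest follows from ln(rho q) < - q ln q. *)
  have hb (k a b : R) : k <= 1 -> 0 <= a -> b < - (q * a) ->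
    a + (q - 1) * k + b - q + 1 <= (q * a + b) / 2 by move=> *; nra.
  exact: hb.
pose T := ln (rho q) / (q - 1).
(* The minimum of ln c + kappa e^T / c^2 is at c^2 = 2 kappa e^T, where the last term equals 1/2. *)
pose lc := (ln 2 + ln kappa + T) / 2.
exists (expR lc), xpred0; split; first exact: expR_gt0.
rewrite expRK /=; set S := \sum_i _.
have HS : m%:R^-1 * S <= 1 / 2.
  rewrite /S; under eq_bigr do rewrite exprMn.
  rewrite -mulr_sumr -mulr_suml mulrCA mulrA.
  have -> : (expR lc)^-1 ^+ 2 = (2 * kappa * expR T)^-1.
    rewrite exprVn -expRM_natl (_ : _ * lc = ln 2 + ln kappa + T); last by rewrite /lc; field.
    by rewrite !expRD !lnK ?posrE.
  rewrite mulrA ler_pdivrMr; last by apply: mulr_gt0 (expR_gt0 _); exact: mulr_gt0.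
  rewrite -mulrA (_ : 1 / 2 * _ = kappa * expR T); last by rewrite !mulrA mul1r mulVf ?mul1r.
  by apply: ler_wpM2l (power_mean q2); exact: ltW.
have l2 : ln 2 <= ln q by rewrite ler_ln ?posrE// ltW.
have TT : T <= ln (rho q) / q.
  have q1' : 0 < q - 1 by lra.
  rewrite /T ler_pdivrMr// mulrAC ler_pdivlMr//.
  by move: lr lq; move: (ln (rho q)) (ln q) => a b *; nra.
have hb (a k t b z : R) : a <= b -> k <= 1 -> t <= z -> (a + k + t) / 2 - 1 + 1 / 2 <= (b + z) / 2.
  by move=> *; lra.
by apply: le_trans (lerD (lexx _) HS) _; exact: hb.
Qed.
End RealInequality.

(** * Assembly *)

Section LatticeBound.
Context {R : realType}.

Lemma rank1_leverage n (B : 'M[R]_(n, 1)) i :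
  B^T *m B \in unitmx -> `|B i 0| = Num.sqrt (leverage B i) * Num.sqrt (\det (B^T *m B)).
Proof.
have dge : 0 <= (B^T *m B) 0 0.
  by rewrite mxE; apply: sumr_ge0 => j _; rewrite mxE -expr2 sqr_ge0.
rewrite /leverage; move: dge; rewrite [B^T *m B]mx11_scalar.
move: ((B^T *m B) 0 0) => d; rewrite mxE eqxx mulr1n => d0.
rewrite unitmxE det_scalar1 unitfE => dn0.
rewrite invmx_scalar mul_mx_scalar -scalemxAl !mxE big_ord1 !mxE; move: (B i 0) => b.
rewrite -expr2 -sqrtrM; last by rewrite mulr_ge0 ?invr_ge0// sqr_ge0.
by rewrite mulrAC mulVf// mul1r sqrtr_sqr.
Qed.

Variables (m n : nat) (P : 'M[int]_(m, n)) (lam : nat -> nat).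
Let B : 'M[R]_(n, m) := (map_mx intr P)^T.
Hypotheses (m0 : (0 < m)%N) (Pf : row_free (map_mx (intr : int -> R) P))
  (lam_gt0 : forall i, (i < m)%N -> (0 < lam i)%N)
  (lam_mono : forall i, (i.+1 < m)%N -> (lam i <= lam i.+1)%N)
  (lam_min : forall (X : 'rV[int]_m) (j : 'I_m), X 0 j != 0 -> (lam j <= supnorm (X *m P))%N).

Theorem successive_minima_moment (q : R) : 1 <= q ->
  (\prod_(i < m) lam i)%:R <=
    Num.sqrt q * (m%:R^-1 * \sum_i leverage B i `^ q) `^ (2 * q)^-1 * Num.sqrt (\det (B^T *m B)).
Proof.
move=> q1; have qp : 0 < q by exact: lt_le_trans q1.
have [e e0 Be] := row_free_coercive Pf.
have pS := gram_posdef e0 Be; have uS := posdef_unit pS.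
have b0 := leverage_ge0 e0 Be; have b1 := sum_leverage e0 Be.
have G0 : 0 < \det (B^T *m B) by exact: (gauss_itint 0 pS).1.
have r0 := rho_gt0 m0 b1 q; set rho := m%:R^-1 * _ in r0 *.
have [m1|m2] := leqP m 1.
  have mE : m = 1%N by apply/eqP; rewrite eqn_leq m1.
  subst m; rewrite big_ord1.
  have h := @lam_min 1%:M 0; rewrite mul1mx !mxE eqxx in h.
  apply: (@le_trans _ _ (supnorm P)%:R); first by rewrite ler_nat h.
  have n0 : (0 < n)%N.
    by rewrite lt0n; apply/eqP => n0; subst n; move: b1; rewrite big_ord0 => /eqP; rewrite eq_sym oner_eq0.
  have [i iE] : {i | supnorm P = absz (P 0 i)} by apply: (@bigop.eq_bigmax 'I_n (fun i => absz (P 0 i))); rewrite card_ord.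
  have -> : (supnorm P)%:R = `|B i 0| :> R by rewrite iE !mxE -intr_norm -abszE.
  rewrite (rank1_leverage i uS).
  rewrite ler_wpM2r ?sqrtr_ge0//.
  have q2 : 0 <= (2 * q)^-1 by rewrite invr_ge0 mulr_ge0// ltW.
  have sq : 1 <= Num.sqrt q by rewrite -[leLHS]sqrtr1 ler_wsqrtr.
  apply: (@le_trans _ _ (rho `^ (2 * q)^-1)); last by rewrite ler_peMl// powR_ge0.
  have -> : Num.sqrt (leverage B i) = (leverage B i `^ q) `^ (2 * q)^-1.
    by rewrite -powR12_sqrt// -powRrM; congr (_ `^ _); field; rewrite gt_eqF.
  rewrite ge0_ler_powR ?nnegrE ?powR_ge0//; first exact: ltW.
  rewrite /rho invr1 mul1r (bigD1 i)//= lerDl; apply: sumr_ge0 => j _; exact: powR_ge0.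
have [c [Q [c0 H]]] := exists_scale_bound m0 b0 b1 q1 m2.
have := successive_minima_bound Pf lam_gt0 lam_mono lam_min Q c0; rewrite -/B.
set L : R := _%:R; rewrite -/rho in H *; move: H; set S := \sum_i _ => H.
rewrite detZ mulrA ler_pdivrMr; last by rewrite sqrtr_gt0 mulr_gt0 ?exprn_gt0.
rewrite [leRHS]mul1r sqrtrM ?exprn_ge0 ?(ltW c0)// => h.
have -> : Num.sqrt q * rho `^ (2 * q)^-1 = expR ((ln q + ln rho / q) / 2).
  rewrite -(powR12_sqrt (ltW qp)) /powR !gt_eqF// -expRD; congr expR.
  by field; rewrite gt_eqF.
rewrite -ler_pdivrMr ?sqrtr_gt0//.
have {h} : L / Num.sqrt (\det (B^T *m B)) <= Num.sqrt (c ^+ m) * expR (- (1 / 2 * (m%:R - S))).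
  by rewrite ler_pdivrMr ?sqrtr_gt0// expRN mulrAC ler_pdivlMr ?expR_gt0.
move=> h; apply: le_trans h _.
have -> : Num.sqrt (c ^+ m) = expR (m%:R * ln c / 2).
  by rewrite -powR12_sqrt ?exprn_ge0 ?(ltW c0)// /powR gt_eqF ?exprn_gt0// lnXn// mulr_natl mulrC.
rewrite -expRD ler_expR; move: H; lra.
Qed.

End LatticeBound.

(** The orthogonal projections onto the two row spaces add up to the identity, as is checked on the
    rows of [A] and [P] together. *)
Lemma gram_projection_complement (F : fieldType) k m (A : 'M[F]_(k, m + k)) (P : 'M[F]_(m, m + k)) :
  A *m P^T = 0 -> A *m A^T \in unitmx -> P *m P^T \in unitmx ->
  A^T *m invmx (A *m A^T) *m A + P^T *m invmx (P *m P^T) *m P = 1%:M.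
Proof.
move=> AP uA uP; set E := _ + _.
have PA : P *m A^T = 0 by apply: trmx_inj; rewrite trmx_mul trmxK AP trmx0.
pose Q := col_mx P A.
have QQ : Q *m Q^T = block_mx (P *m P^T) 0 0 (A *m A^T).
  by rewrite tr_col_mx mul_col_row AP PA.
have uQ : Q^T \in unitmx.
  have : Q *m Q^T \in unitmx by rewrite QQ unitmxE det_ublock unitrM -!unitmxE uP.
  by rewrite unitmx_mul => /andP[].
apply: (can_inj (mulmxK uQ)); rewrite mul1mx /Q tr_col_mx mul_mx_row; congr row_mx.
  by rewrite /E mulmxDl -(mulmxA _ A) AP mulmx0 add0r -(mulmxA _ P) -mulmxA mulVmx// mulmx1.
by rewrite /E mulmxDl -(mulmxA _ P) PA mulmx0 addr0 -(mulmxA _ A) -mulmxA mulVmx// mulmx1.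
Qed.

(** The quotient is a Schur complement, namely 1 minus the squared length of the projection of e_i
    onto the rows of [A]; this is the squared length of its projection onto the rows of [P]. *)
Lemma leverage_complement (R : realType) k m (A : 'M[R]_(k, m + k)) (P : 'M[R]_(m, m + k)) i :
  A *m P^T = 0 -> A *m A^T \in unitmx -> P *m P^T \in unitmx ->
  \det (col_mx A (delta_mx 0 i) *m (col_mx A (delta_mx 0 i : 'rV[R]_(m + k)))^T) / \det (A *m A^T)
    = leverage P^T i.
Proof.
move=> AP uA uP; rewrite tr_col_mx mul_col_row det_schur_ul// mulrAC divff ?mul1r; last first.
  by rewrite -unitfE -unitmxE.
rewrite det_mx11 /leverage trmxK !rowE trmx_mul trmxK.
have := gram_projection_complement AP uA uP.
move=> /(congr1 (fun X => delta_mx 0 i *m X *m (delta_mx 0 i)^T : 'M[R]_1)).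
rewrite mulmxDr mulmxDl mulmx1 !mulmxA => <-.
by rewrite addrC addKr.
Qed.

Section Main.
Variables (k m : nat) (A : 'M[int]_(k, m + k)).
Hypotheses (m0 : (0 < m)%N) (Ar : \rank (mxR A) = k).

Lemma minor_gcd_dvd (f : {ffun 'I_k -> 'I_(m + k)}) : (minor_gcd A %| absz (\det (colsub f A)))%N.
Proof. exact: (@biggcdn_inf _ f xpredT). Qed.

Lemma short_kernel_basis : exists Z : 'M[int]_(m, m + k),
    A *m Z^T = 0 /\ row_free (mxR Z) /\
    forall p : Rr, 2 <= p ->
      ((\prod_(r < m) \max_(i < m + k) absz (Z r i))%N%:R : Rr) <=
        (minor_gcd A)%:R^-1 * Num.sqrt (p / 2) *
        powR (m%:R^-1 * \sum_(i < m + k) powR (cdist A i) p) p^-1 *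
        Num.sqrt (\det (mxR A *m (mxR A)^T)).
Proof.
have [Z [P [P' [AZ Zf Zs [uU AP] Pmin]]]] := adapted_basis Rr A (@supnorm (m + k)).
exists Z; split=> //; split=> // p p2.
pose lam i := oapp (fun r : 'I_m => supnorm (row r Z)) 0%N (insub i).
have lamE (r : 'I_m) : lam r = supnorm (row r Z) by rewrite /lam valK.
have lamE' i (im : (i < m)%N) : lam i = supnorm (row (Ordinal im) Z) by rewrite -lamE.
have -> : (\prod_(r < m) \max_(i < m + k) absz (Z r i))%N = (\prod_(r < m) lam r)%N.
  by apply: eq_bigr => r _; rewrite lamE /supnorm; apply: eq_bigr => i _; rewrite mxE.
have Pf : row_free (mxR P).
  apply/row_freeP; exists (mxR (invmx (col_mx P P') *m col_mx 1%:M 0)).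
  rewrite -map_mxM mulmxA -{1}(col_mxKu P P') mul_usub_mx mulmxV//.
  by rewrite scalar_mx_block block_mxEv col_mxKu mul_row_col mulmx1 mul0mx addr0 map_mx1.
have lam_gt0 i : (i < m)%N -> (0 < lam i)%N.
  move=> im; rewrite lamE' lt0n; apply/negP => /eqP z0.
  have r0 : row (Ordinal im) (mxR Z) = 0.
    apply/rowP => j; rewrite !mxE; apply/eqP; rewrite intr_eq0 -absz_eq0 -leqn0 -z0.
    by have := leq_bigmax (F := fun j => absz (row (Ordinal im) Z ord0 j)) j; rewrite mxE.
  move: r0; rewrite rowE => /eqP; rewrite mulmx_free_eq0// => /eqP /matrixP /(_ 0 (Ordinal im)).
  by rewrite !mxE !eqxx => /eqP; rewrite oner_eq0.
have lam_mono i : (i.+1 < m)%N -> (lam i <= lam i.+1)%N.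
  by move=> im; rewrite (lamE' _ (ltnW im)) (lamE' _ im); apply: Zs => /=.
have lam_min (X : 'rV[int]_m) (j : 'I_m) : X 0 j != 0 -> (lam j <= supnorm (X *m P))%N.
  by rewrite lamE; exact: Pmin.
have q1 : 1 <= p / 2 by rewrite ler_pdivlMr// mul1r.
apply: le_trans (successive_minima_moment m0 Pf lam_gt0 lam_mono lam_min q1) _.
have APr : mxR A *m (mxR P)^T = 0 by rewrite map_trmx -map_mxM AP map_mx0.
have posA : posdef (mxR A *m (mxR A)^T).
  have [|e e0 Be] := @row_free_coercive _ _ _ (mxR A); first by rewrite /row_free Ar.
  by have := gram_posdef e0 Be; rewrite trmxK.
have posP : posdef (mxR P *m (mxR P)^T).
  have [e e0 Be] := row_free_coercive Pf.
  by have := gram_posdef e0 Be; rewrite trmxK.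
have [uA uP] := (posdef_unit posA, posdef_unit posP).
have dA := (gauss_itint 0 posA).1; have dP := (gauss_itint 0 posP).1.
have cE i : powR (cdist A i) p = leverage (mxR P)^T i `^ (p / 2).
  rewrite /cdist (leverage_complement i APr uA uP).
  have [e e0 Be] := row_free_coercive Pf.
  by rewrite -powR12_sqrt ?(leverage_ge0 e0 Be)// -powRrM mulrC.
rewrite trmxK mulrCA divff// mulr1.
under [X in _ <= _ * _ * powR (_ * X) _ * _]eq_bigr do rewrite cE.
set W := powR _ _.
have dU : \det (col_mx (mxR P) (mxR P')) ^+ 2 = 1.
  rewrite -map_col_mx det_map_mx; move: uU; rewrite unitmxE.
  by rewrite unfold_in => /orP[] /eqP ->; rewrite ?rmorphN1 ?rmorph1 ?sqrrN expr1n.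
have -> : Num.sqrt (\det (mxR A *m (mxR A)^T)) =
    (absz (\det (A *m P'^T)))%:R * Num.sqrt (\det (mxR P *m (mxR P)^T)).
  rewrite (det_gram_complement APr dU) sqrtrM ?sqr_ge0// sqrtr_sqr; congr (_ * _).
  by rewrite map_trmx -map_mxM det_map_mx -intr_norm -abszE.
set c := absz _.
(* [c] is nonzero since det(A A^T) > 0; as a positive multiple of the gcd of the minors it is at
   least that gcd, so the factor c/D can only help. *)
have c0 : (0 < c)%N.
  rewrite lt0n absz_eq0; apply: contraTneq dA => c0.
  rewrite (det_gram_complement APr dU) map_trmx -map_mxM det_map_mx c0.
  by rewrite rmorph0 expr0n/= mul0r ltxx.
have Dc : (minor_gcd A %| c)%N by apply: dvdz_det_mulmx => f; exact: minor_gcd_dvd.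
have D0 := dvdn_gt0 c0 Dc.
have -> : (minor_gcd A)%:R^-1 * Num.sqrt (p / 2) * W * (c%:R * Num.sqrt (\det (mxR P *m (mxR P)^T))) =
    c%:R / (minor_gcd A)%:R * (Num.sqrt (p / 2) * W * Num.sqrt (\det (mxR P *m (mxR P)^T))) by ring.
rewrite ler_peMl ?mulr_ge0 ?sqrtr_ge0 ?powR_ge0//.
by rewrite ler_pdivlMr ?ltr0n// mul1r ler_nat dvdn_leq.
Qed.

End Main.

Theorem theorem6 (k n : nat) (A : 'M[int]_(k, n)) :
  (0 < k)%N -> (k < n)%N -> \rank (mxR A) = k ->
  exists Z : 'M[int]_(n - k, n),
    A *m Z^T = 0 /\ row_free (mxR Z) /\
    forall p : Rr, 2 <= p ->
      ((\prod_(r < n - k) \max_(i < n) absz (Z r i))%N%:R : Rr) <=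
        (minor_gcd A)%:R^-1 * Num.sqrt (p / 2) *
        powR ((n - k)%:R^-1 * \sum_(i < n) powR (cdist A i) p) p^-1 *
        Num.sqrt (\det (mxR A *m (mxR A)^T)).
Proof.
move=> _ kn Ar; have nk0 : (0 < n - k)%N by rewrite subn_gt0.
have nE := subnK (ltnW kn).
(* Generalising the codimension writes [n] as [m + k], the shape of the block decompositions. *)
move: (n - k)%N nk0 nE => m m0 nE; subst n.
exact: short_kernel_basis.
Qed.
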